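(* For each twinic group $X$ there are cardinals $q(X,C_{2^k})$, $q(X,Q_{2^k})$, $k\in\mathbb N\cup\{\infty\}$, such that: (1) each minimal left ideal of $\lambda(X)$ is algebraically isomorphic to $$Z\times\prod_{1\le k\le\infty}C_{2^k}^{\,q(X,C_{2^k})}\times\prod_{3\le k\le\infty}Q_{2^k}^{\,q(X,Q_{2^k})}$$ for some semigroup $Z$ of left zeros; (2) each maximal subgroup of the minimal ideal of $\lambda(X)$ is algebraically isomorphic to $$\prod_{1\le k\le\infty}C_{2^k}^{\,q(X,C_{2^k})}\times\prod_{3\le k\le\infty}Q_{2^k}^{\,q(X,Q_{2^k})};$$ (3) if $q(X,C_{2^\infty})=q(X,Q_{2^\infty})=0$, then each maximal subgroup of the minimal ideal of $\lambda(X)$ is topologically isomorphic to the compact topological group $$\prod_{1\le k<\infty}C_{2^k}^{\,q(X,C_{2^k})}\times\prod_{3\le k<\infty}Q_{2^k}^{\,q(X,Q_{2^k})}$$ (where the finite groups $C_{2^k},Q_{2^k}$ are discrete and the product carries the product topology). If moreover the group $X$ is abelian, then (4) $q(X,Q_{2^k})=0$ for every $k\in\mathbb N\cup\{\infty\}$, while $q(X,C_{2^k})$ is equal to the number of subgroups $H\subset X$ such that the quotient group $X/H$ is isomorphic to $C_{2^k}$; (5) for every $k\in\mathbb N$ $$q(X,C_{2^k})=\frac{|\hom(X,C_{2^k})|-|\hom(X,C_{2^{k-1}})|}{2^{k-1}},$$ where $\hom(X,C_{2^k})$ is the group of homomorphisms from $X$ into $C_{2^k}$ and the numerator is understood as the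 cardinality of the set difference $\hom(X,C_{2^k})\setminus\hom(X,C_{2^{k-1}})$ (with $C_{2^{k-1}}\subset C_{2^k}$).
   Context: Superextension. For a group $X$, $\mathsf P(X)$ is the power-set of $X$. A family $\mathcal L\subset\mathsf P(X)$ is linked if $A\cap B\ne\emptyset$ for all $A,B\in\mathcal L$, and maximal linked if it is linked and coincides with every linked family containing it. $\lambda(X)\subset\mathsf P(\mathsf P(X))$ is the set of all maximal linked systems on $X$, with the subspace topology of $\mathsf P(\mathsf P(X))\cong\{0,1\}^{\mathsf P(X)}$ (Tychonoff product topology) and the operation $\mathcal A\circ\mathcal B=\{A\subset X:\{x\in X:x^{-1}A\in\mathcal B\}\in\mathcal A\}$; it is a compact Hausdorff right-topological semigroup (all right shifts $x\mapsto x\circ a$ are continuous). The minimal ideal is the smallest two-sided ideal; it is the union of all minimal left ideals. A maximal subgroup of the minimal ideal is the largest subgroup containing some idempotent of the minimal ideal, with the subspace topology. A semigroup of left zeros is a semigroup with $xy=x$ for all $x,y$. ''Algebraically isomorphic'' means isomorphic as semigroups; ''topologically isomorphic'' means isomorphic by a semigroup isomorphism that is a homeomorphism. Twinic groups. An ideal on $X$ is a nonempty family $\mathcal I\subset\mathsf P(X)$ closed under finite unions and under taking subsets, with $X\notin\mathcal I$; it is left-invariant if $xA\in\mathcal I$ for all $A\in\mathcal I$, $x\in X$. Write $A\subset_{\mathcal I}B$ if $A\setminus B\in\mathcal I$, and $A=_{\mathcal I}B$ if $A\subset_{\mathcal I}B$ and $B\subset_{\mathcal I}A$. A group $X$ is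 twinic if it admits a left-invariant ideal $\mathcal I$ such that for every $A\subset X$ and $x,y\in X$ with $xA\subset_{\mathcal I}X\setminus A\subset_{\mathcal I}yA$ one has $xA=_{\mathcal I}yA$. Groups. $C_{2^k}=\{z\in\mathbb C:z^{2^k}=1\}$ for finite $k\ge 0$; $Q_8=\{\pm1,\pm i,\pm j,\pm k\}$ is the quaternion group inside the quaternion algebra $\mathbb H\supset\mathbb C$; for finite $k$, $Q_{2^k}$ is the multiplicative subgroup of $\mathbb H$ generated by $C_{2^{k-1}}\cup Q_8$; $C_{2^\infty}=\bigcup_{k\ge1}C_{2^k}$ and $Q_{2^\infty}=\bigcup_{k\ge3}Q_{2^k}$. *)

(* Defs.v *)
From HB Require Import structures.
From mathcomp Require Import all_boot all_order all_algebra.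
From mathcomp Require Import complex.
From mathcomp Require Import ring.
From mathcomp Require Import all_classical all_reals.
From mathcomp Require Import topology.

Set Implicit Arguments.
Unset Strict Implicit.
Unset Printing Implicit Defensive.

Import GRing.Theory Num.Theory.

Local Open Scope classical_set_scope.
Local Open Scope group_scope.

Section SemigroupNotions.
Variable S : semigroupType.
Implicit Types A G I L : set S.

Definition left_ideal L := L !=set0 /\ forall s x, L x -> L (s * x).

Definition minimal_left_ideal L :=
  left_ideal L /\ forall L', left_ideal L' -> L' `<=` L -> L' = L.

Definition two_sided_ideal I :=
  I !=set0 /\ forall s x, I x -> I (s * x) /\ I (x * s).

(* The intersection of all two-sided ideals: it is the smallest two-sided
   ideal as soon as there is one. *)
Definition minimal_ideal : set S := smallest two_sided_ideal set0.

Definition is_subgroup G :=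
  (forall x y, G x -> G y -> G (x * y)) /\
  exists e, [/\ G e, forall x, G x -> e * x = x /\ x * e = x &
                forall x, G x -> exists y, [/\ G y, x * y = e & y * x = e]].

Definition maximal_subgroup_of A G :=
  exists e, [/\ A e, e * e = e, is_subgroup G /\ G e &
                forall H, is_subgroup H -> H e -> H `<=` G].

Definition left_zeros := forall x y : S, x * y = x.
End SemigroupNotions.
Arguments minimal_ideal S : clear implicits.

Definition is_isomorphism (S T : magmaType) (A : set S) (B : set T)
    (f : S -> T) :=
  set_bij A B f /\ forall x y, A x -> A y -> f (x * y) = f x * f y.

Definition algebraically_isomorphic (S T : magmaType) (A : set S) (B : set T) :=
  exists f : S -> T, is_isomorphism A B f.

Definition is_homeomorphism (S T : topologicalType) (A : set S) (B : set T)
    (f : S -> T) :=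
  [/\ set_bij A B f, {within A, continuous f} &
      exists g : T -> S, {within B, continuous g} /\ {in A, cancel f g}].

Section Translates.
Variable X : groupType.

Definition ltranslate (x : X) (A : set X) : set X := [set x * a | a in A].

Lemma ltranslateVE x A : ltranslate x^-1 A = [set y | A (x * y)].
Proof.
apply/seteqP; split=> [_ [a Aa <-]|y /= Axy]; first by rewrite /= mulVKg.
by exists (x * y) => //; rewrite mulKg.
Qed.

Lemma ltranslateV_ltranslate x y (A : set X) :
  ltranslate y^-1 (ltranslate x^-1 A) = ltranslate (x * y)^-1 A.
Proof. by rewrite !ltranslateVE; apply/funext => z /=; rewrite mulgA. Qed.
End Translates.

Section Superextension.
Variable X : groupType.
Implicit Types (L M : set (set X)) (A : set X).

Definition linked L := forall A B, L A -> L B -> A `&` B !=set0.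

Definition maximal_linked L :=
  linked L /\ forall M, linked M -> L `<=` M -> M = L.

Lemma maximal_linkedP L :
  maximal_linked L <->
  [/\ linked L, (forall A B, A `<=` B -> L A -> L B) &
      forall A, L A \/ L (~` A)].
Proof.
split=> [[Ll Lmax]|[Ll Lup Lor]]; last first.
  split=> // M Ml LM; apply/seteqP; split=> // A MA.
  by case: (Lor A) => // /LM MCA; have [x []] := Ml _ _ MA MCA.
have crit A : A !=set0 -> (forall B, L B -> A `&` B !=set0) -> L A.
  move=> A0 meetA; rewrite -(Lmax (L `|` [set A])); first by right.
    move=> B C [LB|->] [LC|->]; [exact: Ll| |exact: meetA|by rewrite setIid].
    by rewrite setIC; exact: meetA.
  by move=> B LB; left.
split=> // [A B AB LA|A].
  have [x []] := Ll _ _ LA LA => Ax _.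
  apply: crit => [|C LC]; first by exists x; exact: AB.
  by have [y [Ay Cy]] := Ll _ _ LA LC; exists y; split=> //; exact: AB.
case: (pselect (L A)) => [|nLA]; [by left|right].
have [[B LB BA]|noB] := pselect (exists2 B, L B & B `<=` ~` A).
  have [x [Bx _]] := Ll _ _ LB LB.
  apply: crit => [|C LC]; first by exists x; exact: BA.
  by have [y [By Cy]] := Ll _ _ LB LC; exists y; split=> //; exact: BA.
exfalso.
have meetA B : L B -> A `&` B !=set0.
  move=> LB; apply: contrapT => AB0; apply: noB; exists B => // x Bx Ax.
  by apply: AB0; exists x.
have [A0|A0] := pselect (A !=set0); first exact: nLA (crit _ A0 meetA).
have [[B LB]|Le] := pselect (exists B, L B).
  by have [x [Ax _]] := meetA _ LB; apply: A0; exists x.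
suff L1 : L [set 1] by apply: Le; exists [set 1].
by apply: crit => [|B LB]; [exists 1 | case: Le; exists B].
Qed.

Definition mls_comp L M : set (set X) :=
  [set A | L [set x | M (ltranslate x^-1 A)]].

Lemma maximal_linked_comp L M :
  maximal_linked L -> maximal_linked M -> maximal_linked (mls_comp L M).
Proof.
move=> /maximal_linkedP[Ll Lup Lor] /maximal_linkedP[Ml Mup Mor].
apply/maximal_linkedP; split.
- move=> A B LA LB; have [x [MA MB]] := Ll _ _ LA LB.
  have [y []] := Ml _ _ MA MB.
  by rewrite !ltranslateVE => Ay By; exists (x * y).
- move=> A B AB; apply: Lup => x /=; apply: Mup.
  by rewrite !ltranslateVE => y; exact: AB.
- move=> A; have [LA|LA] := Lor [set x | M (ltranslate x^-1 A)]; [by left|right].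
  apply: Lup LA => x /= nMA; have [|] := Mor (ltranslate x^-1 A) => //.
  by rewrite !ltranslateVE.
Qed.

Definition superextension : Type := set_type [set L | maximal_linked L].

HB.instance Definition _ := Choice.on superextension.

Lemma superextensionP (L : superextension) : maximal_linked (val L).
Proof. by have := valP L; rewrite inE. Qed.

Definition superextension_mul (L M : superextension) : superextension :=
  SigSub (mem_set (maximal_linked_comp (superextensionP L) (superextensionP M))).

Lemma superextension_mulA : associative superextension_mul.
Proof.
move=> L M N; apply/val_inj/funext => A /=; rewrite /mls_comp /=; congr (val L _).
apply/funext => x /=; rewrite [in RHS]ltranslateVE /=; congr (val M _).
by apply/funext => y /=; rewrite ltranslateV_ltranslate.
Qed.

HB.instance Definition _ := isSemigroup.Build superextension superextension_mulA.

Definition superextension_embedding (L : superextension) :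
  {ptws set X -> bool} := fun A => `[< val L A >].

(* The subspace topology inherited from P(P(X)) = {0,1}^P(X). *)
HB.instance Definition _ := Topological.copy superextension
  (initial_topology superextension_embedding).
End Superextension.

Section Twinic.
Variable X : groupType.
Implicit Types (I : set (set X)) (A B : set X).

Definition is_ideal_of_sets I :=
  [/\ I !=set0, (forall A B, I A -> I B -> I (A `|` B)),
      (forall A B, B `<=` A -> I A -> I B) & ~ I setT].

Definition left_invariant I := forall A x, I A -> I (ltranslate x A).

Definition subset_mod I A B := I (A `\` B).

Definition eq_mod I A B := subset_mod I A B /\ subset_mod I B A.

Definition twinic := exists I, [/\ is_ideal_of_sets I, left_invariant I &
  forall A x y, subset_mod I (ltranslate x A) (~` A) ->
    subset_mod I (~` A) (ltranslate y A) ->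
    eq_mod I (ltranslate x A) (ltranslate y A)].
End Twinic.

Definition zero_cardinal (c : Type) := [set: c] = set0.

(* None stands for infinity. *)
Definition natinf := option nat.

Definition leinf (m : nat) (k : natinf) : bool :=
  if k is Some n then (m <= n)%N else true.

Definition from_to_inf (m : nat) : set natinf := [set k | leinf m k].

Definition from_finite (m : nat) : set natinf :=
  [set k | leinf m k /\ k <> None].

Section CyclicGroups.
Variable R : realType.
Local Open Scope ring_scope.

Definition C2fin (k : nat) : set R[i] := [set z | z ^+ (2 ^ k) = 1].

Definition C2set (k : natinf) : set R[i] :=
  if k is Some n then C2fin n else \bigcup_(n in [set n | (1 <= n)%N]) C2fin n.

Lemma C2fin_le m n : (m <= n)%N -> C2fin m `<=` C2fin n.
Proof.
by move=> /subnKC <- z; rewrite /C2fin /= expnD exprM => ->; rewrite expr1n.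
Qed.

Lemma C2set1 k : C2set k 1.
Proof. by case: k => [n|] /=; [|exists 1%N => //]; rewrite /C2fin /= expr1n. Qed.

Lemma C2setM k z w : C2set k z -> C2set k w -> C2set k (z * w).
Proof.
have fin n : C2fin n z -> C2fin n w -> C2fin n (z * w).
  by rewrite /C2fin /= exprMn => -> ->; rewrite mulr1.
case: k => [n|] /=; first exact: fin.
move=> [m m1 zm] [n n1 wn]; exists (maxn m n); first by rewrite /= leq_max m1.
by apply: fin; [apply: C2fin_le zm|apply: C2fin_le wn];
  rewrite ?leq_maxl ?leq_maxr.
Qed.

Lemma C2setV k z : C2set k z -> C2set k z^-1.
Proof.
have fin n : C2fin n z -> C2fin n z^-1.
  by rewrite /C2fin /= exprVn => ->; rewrite invr1.
by case: k => [n|] /=; [exact: fin|move=> [m m1 /fin ?]; exists m].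
Qed.

Lemma C2set_neq0 k z : C2set k z -> z != 0.
Proof.
have fin n : C2fin n z -> z != 0.
  apply: contra_eq_neq => ->; rewrite expr0n expn_eq0 /= eq_sym.
  exact: oner_neq0.
by case: k => [n|] /=; [exact: fin|move=> [m m1 /fin]].
Qed.

Definition C2 (k : natinf) : Type := set_type (C2set k).

Section C2group.
Variable k : natinf.
HB.instance Definition _ := Choice.on (C2 k).

Definition C2_one : C2 k := SigSub (mem_set (C2set1 k)).
Definition C2_mul (x y : C2 k) : C2 k :=
  SigSub (mem_set (C2setM (set_mem (valP x)) (set_mem (valP y)))).
Definition C2_inv (x : C2 k) : C2 k :=
  SigSub (mem_set (C2setV (set_mem (valP x)))).

Lemma C2_mulA : associative C2_mul.
Proof. by move=> x y z; apply/val_inj; rewrite /= mulrA. Qed.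
Lemma C2_mul1 : left_id C2_one C2_mul.
Proof. by move=> x; apply/val_inj; rewrite /= mul1r. Qed.
Lemma C2_mulr1 : right_id C2_one C2_mul.
Proof. by move=> x; apply/val_inj; rewrite /= mulr1. Qed.
Lemma C2_mulV : left_inverse C2_one C2_inv C2_mul.
Proof.
move=> x; apply/val_inj; rewrite /= mulVf //.
exact: C2set_neq0 (set_mem (valP x)).
Qed.
Lemma C2_mulrV : right_inverse C2_one C2_inv C2_mul.
Proof.
move=> x; apply/val_inj; rewrite /= mulfV //.
exact: C2set_neq0 (set_mem (valP x)).
Qed.

HB.instance Definition _ :=
  isGroup.Build (C2 k) C2_mulA C2_mul1 C2_mulr1 C2_mulV C2_mulrV.
End C2group.
End CyclicGroups.

Section Quaternions.
Variable R : realType.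
Local Open Scope ring_scope.

(* The quaternion z + w j, with z, w complex, where j^2 = -1 and
   j z = z^* j; only the multiplicative monoid of the algebra is needed. *)
Record quat := Quat { qfst : R[i]; qsnd : R[i] }.

HB.instance Definition _ := gen_eqMixin quat.
HB.instance Definition _ := gen_choiceMixin quat.

Definition quat_of_complex (z : R[i]) : quat := Quat z 0.

Definition quat_mul (p q : quat) : quat :=
  Quat (qfst p * qfst q - qsnd p * (qsnd q)^*)
       (qfst p * qsnd q + qsnd p * (qfst q)^*).

Lemma quat_mulA : associative quat_mul.
Proof.
move=> [a b] [c d] [e f]; rewrite /quat_mul /=.
by congr Quat; rewrite !(rmorphD, rmorphN, rmorphM) /= ?conjCK; ring.
Qed.
Lemma quat_mul1 : left_id (quat_of_complex 1) quat_mul.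
Proof. by move=> [a b]; rewrite /quat_mul /= !mul1r !mul0r subr0 addr0. Qed.
Lemma quat_mulr1 : right_id (quat_of_complex 1) quat_mul.
Proof.
move=> [a b]; rewrite /quat_mul /= rmorph0 rmorph1.
by rewrite !mulr1 !mulr0 subr0 add0r.
Qed.

HB.instance Definition _ := isMonoid.Build quat quat_mulA quat_mul1 quat_mulr1.

(* The units j and k = i j are Quat 0 1 and Quat 0 'i. *)
Definition Q8 : set quat :=
  [set Quat 1 0; Quat (-1) 0; Quat 'i 0; Quat (- 'i) 0;
       Quat 0 1; Quat 0 (-1); Quat 0 'i; Quat 0 (- 'i)].

Definition Q2fin (k : nat) : set quat :=
  smallest (@is_subgroup quat)
    ((quat_of_complex @` C2fin k.-1) `|` Q8).

Definition Q2set (k : natinf) : set quat :=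
  if k is Some n then Q2fin n else \bigcup_(n in [set n | (3 <= n)%N]) Q2fin n.

Definition quat_conj (q : quat) : quat := Quat (qfst q)^* (- qsnd q).

Definition quat_unit : set quat :=
  [set q | qfst q * (qfst q)^* + qsnd q * (qsnd q)^* = 1].

Lemma quat_mulV q : quat_unit q -> (quat_conj q * q)%g = 1%g.
Proof.
case: q => a b; rewrite /quat_unit /= => h.
rewrite /quat_conj -[1%g]/(Quat 1 0) -[(_ * _)%g]/(quat_mul _ _) /quat_mul /= -h.
by congr Quat; ring.
Qed.

Lemma quat_mulrV q : quat_unit q -> (q * quat_conj q)%g = 1%g.
Proof.
case: q => a b; rewrite /quat_unit /= => h.
rewrite /quat_conj -[1%g]/(Quat 1 0) -[(_ * _)%g]/(quat_mul _ _) /quat_mul /=.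
by rewrite conjCK rmorphN -h; congr Quat; ring.
Qed.

Lemma is_subgroup_quat_unit : is_subgroup quat_unit.
Proof.
have unit1 : quat_unit 1%g.
  by rewrite /quat_unit /= rmorph0 rmorph1 mulr0 addr0 mulr1.
split=> [[a b] [c d]|].
  rewrite /quat_unit /= !(rmorphD, rmorphN, rmorphM) /= ?conjCK => h1 h2.
  transitivity ((a * a^* + b * b^*) * (c * c^* + d * d^*)); first by ring.
  by rewrite h1 h2 mulr1.
exists 1%g; split=> // [x _|x ux]; first by rewrite mul1g mulg1.
exists (quat_conj x); rewrite quat_mulV // quat_mulrV //; split=> //.
move: ux; rewrite /quat_unit /= conjCK rmorphN mulrNN => <-.
by rewrite mulrC.
Qed.

Lemma Q2gen_unit k : (quat_of_complex @` C2fin k) `|` Q8 `<=` quat_unit.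
Proof.
move=> q; rewrite /quat_unit /=; case=> [[z zk <-] /=|].
  rewrite rmorph0 mulr0 addr0 -normCK.
  have : `|z| ^+ (2 ^ k) = 1 by rewrite -normrX zk normr1.
  move/eqP; rewrite pexpr_eq1 ?expn_gt0 ?normr_ge0 //.
  by move/eqP ->; rewrite expr1n.
by rewrite /Q8 /=; move=> [[[[[[[|]|]|]|]|]|]|] ->; rewrite /=
  ?(rmorphN, rmorph0, rmorph1) /= ?conjCi ?(mulrNN, mulrN, mulNr) ?mulCii
  ?(mulr0, mulr1, oppr0, opprK, addr0, add0r).
Qed.

Lemma Q2fin_unit k : Q2fin k `<=` quat_unit.
Proof.
move=> q; apply; split; [exact: is_subgroup_quat_unit|exact: Q2gen_unit].
Qed.

Lemma subgroup_quat1 k (G : set quat) : is_subgroup G ->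
  (quat_of_complex @` C2fin k) `|` Q8 `<=` G ->
  [/\ G 1%g, forall x y, G x -> G y -> G (x * y)%g &
      forall x, G x -> quat_unit x -> G (quat_conj x)].
Proof.
move=> [GM [e [Ge e1 eV]]] genG.
have G1 : G 1%g by apply: genG; right; rewrite /Q8 /=; do 7!left.
have e_1 : e = 1%g by have [] := e1 _ G1; rewrite mulg1.
split=> // x Gx ux; have [y [Gy xy yx]] := eV _ Gx.
suff -> : quat_conj x = y by [].
by rewrite -[LHS]mulg1 -e_1 -xy mulgA quat_mulV // mul1g.
Qed.

Lemma Q2fin1 k : Q2fin k 1%g.
Proof. by move=> G [sG genG]; have [] := subgroup_quat1 sG genG. Qed.

Lemma Q2finM k p q : Q2fin k p -> Q2fin k q -> Q2fin k (p * q)%g.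
Proof.
move=> Qp Qq G GG; case: (GG) => sG genG.
by have [_ GM _] := subgroup_quat1 sG genG; apply: GM; [exact: Qp|exact: Qq].
Qed.

Lemma Q2finV k q : Q2fin k q -> Q2fin k (quat_conj q).
Proof.
move=> Qq G GG; case: (GG) => sG genG.
have [_ _ GV] := subgroup_quat1 sG genG.
by apply: GV; [exact: Qq|exact: Q2fin_unit Qq].
Qed.

Lemma Q2fin_le m n : (m <= n)%N -> Q2fin m `<=` Q2fin n.
Proof.
move=> mn q Qq G [sG genG]; apply: Qq; split=> //; apply: subset_trans genG.
apply: setSU; apply: image_subset.
by apply: C2fin_le; case: m n mn => [|m] [|n].
Qed.

Lemma Q2set1 k : Q2set k 1%g.
Proof. by case: k => [n|] /=; [|exists 3%N => //]; exact: Q2fin1. Qed.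

Lemma Q2setM k p q : Q2set k p -> Q2set k q -> Q2set k (p * q)%g.
Proof.
case: k => [n|] /=; first exact: Q2finM.
move=> [m m3 pm] [n n3 qn]; exists (maxn m n); first by rewrite /= leq_max m3.
by apply: Q2finM; [apply: Q2fin_le pm|apply: Q2fin_le qn];
  rewrite ?leq_maxl ?leq_maxr.
Qed.

Lemma Q2setV k q : Q2set k q -> Q2set k (quat_conj q).
Proof.
by case: k => [n|] /=; [exact: Q2finV|move=> [m m3 /Q2finV ?]; exists m].
Qed.

Lemma Q2set_unit k : Q2set k `<=` quat_unit.
Proof.
by case: k => [n|] /=; [exact: Q2fin_unit|move=> q [m _ /Q2fin_unit]].
Qed.

Definition Q2 (k : natinf) : Type := set_type (Q2set k).

Section Q2group.
Variable k : natinf.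
HB.instance Definition _ := Choice.on (Q2 k).

Definition Q2_one : Q2 k := SigSub (mem_set (Q2set1 k)).
Definition Q2_mul (x y : Q2 k) : Q2 k :=
  SigSub (mem_set (Q2setM (set_mem (valP x)) (set_mem (valP y)))).
Definition Q2_inv (x : Q2 k) : Q2 k :=
  SigSub (mem_set (Q2setV (set_mem (valP x)))).

Lemma Q2_mulA : associative Q2_mul.
Proof. by move=> x y z; apply/val_inj; rewrite /= mulgA. Qed.
Lemma Q2_mul1 : left_id Q2_one Q2_mul.
Proof. by move=> x; apply/val_inj; rewrite /= mul1g. Qed.
Lemma Q2_mulr1 : right_id Q2_one Q2_mul.
Proof. by move=> x; apply/val_inj; rewrite /= mulg1. Qed.
Lemma Q2_mulV : left_inverse Q2_one Q2_inv Q2_mul.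
Proof.
move=> x; apply/val_inj; rewrite /= quat_mulV //.
exact: Q2set_unit (set_mem (valP x)).
Qed.
Lemma Q2_mulrV : right_inverse Q2_one Q2_inv Q2_mul.
Proof.
move=> x; apply/val_inj; rewrite /= quat_mulrV //.
exact: Q2set_unit (set_mem (valP x)).
Qed.

HB.instance Definition _ :=
  isGroup.Build (Q2 k) Q2_mulA Q2_mul1 Q2_mulr1 Q2_mulV Q2_mulrV.
End Q2group.
End Quaternions.

Section ProductOfPowers.
Variables (K : set natinf) (G : natinf -> groupType) (q : natinf -> Type).

(* The product over k in K of the powers (G k)^(q k), a cardinal being
   represented by a type having that cardinality. *)
Definition prod_powers : Type := forall k : K, q (val k) -> G (val k).

HB.instance Definition _ := Choice.on prod_powers.

Definition prod_powers_one : prod_powers := fun k i => 1.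
Definition prod_powers_mul (x y : prod_powers) : prod_powers :=
  fun k i => x k i * y k i.
Definition prod_powers_inv (x : prod_powers) : prod_powers :=
  fun k i => (x k i)^-1.

Lemma prod_powers_mulA : associative prod_powers_mul.
Proof.
by move=> x y z; apply: functional_extensionality_dep => k;
  apply/funext => i; exact: mulgA.
Qed.
Lemma prod_powers_mul1 : left_id prod_powers_one prod_powers_mul.
Proof.
by move=> x; apply: functional_extensionality_dep => k;
  apply/funext => i; exact: mul1g.
Qed.
Lemma prod_powers_mulr1 : right_id prod_powers_one prod_powers_mul.
Proof.
by move=> x; apply: functional_extensionality_dep => k;
  apply/funext => i; exact: mulg1.
Qed.
Lemma prod_powers_mulV :
  left_inverse prod_powers_one prod_powers_inv prod_powers_mul.
Proof.
by move=> x; apply: functional_extensionality_dep => k;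
  apply/funext => i; exact: mulVg.
Qed.
Lemma prod_powers_mulrV :
  right_inverse prod_powers_one prod_powers_inv prod_powers_mul.
Proof.
by move=> x; apply: functional_extensionality_dep => k;
  apply/funext => i; exact: mulgV.
Qed.

HB.instance Definition _ := isGroup.Build prod_powers prod_powers_mulA
  prod_powers_mul1 prod_powers_mulr1 prod_powers_mulV prod_powers_mulrV.

(* The Tychonoff topology, every factor G k being discrete; to be used only
   when K contains finite indices only. *)
HB.instance Definition _ := Topological.copy prod_powers
  (prod_topology (fun k : K =>
    prod_topology (fun _ : q (val k) => discrete_topology (G (val k))))).
End ProductOfPowers.

Definition lcoset (X : groupType) (H : set X) (x : X) : set X := ltranslate x H.

(* The product of X / H is x H * y H = x y H; H is meant to be normal. *)
Definition quotient_isomorphic (X : groupType) (H : set X) (G : groupType) :=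
  exists f : set X -> G,
    set_bij (range (lcoset H)) [set: G] f /\
    forall x y : X, f (lcoset H (x * y)) = f (lcoset H x) * f (lcoset H y).

(* Homomorphisms to C_(2^k) are seen as complex-valued maps, so that
   hom(X, C_(2^(k-1))) is literally a subset of hom(X, C_(2^k)). *)
Definition homC2 (R : realType) (X : groupType) (k : nat) : set (X -> R[i]) :=
  [set f | (forall x, C2fin k (f x)) /\
           forall x y : X, f (x * y)%g = (f x * f y)%R].
Arguments homC2 R X k : clear implicits.

(* Main.v *)
(** A maximal linked system L is encoded by the self-map
    [A |-> {x | x^-1 A \in L}] of P(X).  This identifies the superextension with
    the semigroup, under composition, of equivariant, monotone and symmetric
    (complement-preserving) self-maps of P(X).

    Such a map can only enlarge the set K of those x with xA = X \ A.  When K is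
    nonempty it is a "cogroup": the complement of the index-2 subgroup KK in the
    subgroup generated by K.  On the sets A whose cogroup K is
    maximal, N(K)/KK acts freely.  In a twinic group a maximal invariant
    I-linked family splits P(X) into the sets that may be sent to X, those that
    may be sent to the empty set, and the twin sets modulo I, on which
    monotonicity holds automatically.  Hence the images of one chosen set b(K)
    for each conjugacy class of maximal cogroups K can be prescribed freely, and
    idempotents of the minimal ideal retract P(X) onto the orbits of such b(K)
    together with the empty set and X.  Therefore e S e is the product of the
    groups N(K)/KK, and S e is the product of e S e with left zeros.

    By maximality of K every nontrivial element of N(K)/KK has the involution K
    among its powers, and a 2-group with a unique involution is shown to be some
    C_(2^k) or Q_(2^k): the centralizer of an element of order 4 is a chain of
    cyclic groups, and some subgroup of order 4 is normal. *)

Require Import Defs.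
From HB Require Import structures.
From mathcomp Require Import all_boot all_order all_algebra.
From mathcomp Require Import complex.
From mathcomp Require Import all_classical all_reals.
From mathcomp Require Import topology.

Set Implicit Arguments.
Unset Strict Implicit.
Unset Printing Implicit Defensive.

Import GRing.Theory Num.Theory.

Local Open Scope classical_set_scope.
Local Open Scope card_scope.
Local Open Scope group_scope.

(** * Groups with a unique involution *)

(** Twinicity makes monotonicity automatic because nested sets that are both twin modulo I are equal
    modulo I. Prescribing a map then reduces to choosing one value D for one representative of each
    class of twin sets under translation and equality modulo I. A single condition on D, that every
    twin relation of the representative modulo I is an exact twin relation of D, makes the choice
    both well defined under translation and compatible with complements. The danger is that equality
    modulo I creates new twin relations for the sets b(K) and so restricts their values; maximality
    of K excludes this.

    In the classification, the configurations to exclude are those of the binary tetrahedral and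
    octahedral groups, where a quaternion group has a threefold symmetry. Since all orders are
    powers of 2, an element whose cube centralizes d already centralizes d, so no such symmetry
    exists. *)

Section UniqueInvolution.
Variables (H : groupType) (z : H).
Hypotheses (z1 : z <> 1) (zz : z * z = 1).
Hypothesis zpow : forall x, x <> 1 -> exists n, x ^+ n = z.
Implicit Types (c d e f g u v w x : H).

Lemma involution_comm x : commute x z.
Proof.
have [->|/zpow [n <-]] := pselect (x = 1); first exact/commute_sym/commute1.
exact: commuteX.
Qed.
Let zC := involution_comm.

Let zV : z^-1 = z. Proof. exact: mulg1_eq. Qed.

Lemma expg_involution_odd n : odd n -> z ^+ n = z.
Proof.
by move=> no; rewrite -(odd_double_half n) no -mul2n expgnDr expgnA expg2 zz
  expg1n mulg1.
Qed.

(** If [x] were nontrivial, some power of it would be [z], and raising that power to the odd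
    exponent [n] would give both [z] and 1. *)
Lemma expg_odd_eq1 x n : odd n -> x ^+ n = 1 -> x = 1.
Proof.
move=> no xn; apply: contrapT => /zpow [m xm].
by apply: z1; rewrite -(expg_involution_odd no) -xm expgnAC xn expg1n.
Qed.

Lemma square_eq1 x : x * x = 1 -> x = 1 \/ x = z.
Proof.
move=> xx; have [->|/zpow [n xn]] := pselect (x = 1); [by left|right].
move: xn; rewrite -(odd_double_half n) -mul2n expgnDr expgnA expg2 xx expg1n
  mulg1.
by case: (odd n) => // /esym.
Qed.

(** Take [n] with [x ^+ n = z]; then twice [n] kills [x], and [expg_odd_eq1] removes the odd part of
    [n]. *)
Lemma expg_two_power x : exists a, x ^+ (2 ^ a) = 1.
Proof.
have [->|/[dup] x1 /zpow [n xn]] := pselect (x = 1).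
  by exists 0%N; rewrite expg1n.
have n0 : (0 < n)%N by case: n xn => // /esym.
have [m m2 nE] := pfactor_coprime (isT : prime 2) n0.
rewrite coprime2n in m2.
exists (logn 2 n).+1; apply: (expg_odd_eq1 m2).
by rewrite -expgnA expnS -mulnA [(2 ^ _ * m)%N]mulnC -nE mulnC expgnA xn expg2.
Qed.

(** If the exponent [n] giving [z] were odd, the same power of [x * z] would be 1, hence [x = z].
    Below, this supplies an element of order 4 among the powers of [x]. *)
Lemma even_power_involution x : x <> 1 -> x <> z ->
  exists m, x ^+ m * x ^+ m = z.
Proof.
move=> x1 xz; have [n xn] := zpow x1.
exists n./2; rewrite -expgnDr addnn.
suff no : ~~ odd n by rewrite -xn -{2}(odd_double_half n) (negbTE no).
apply/negP => no; apply: xz.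
suff : x * z = 1 by move/mulg1_eq => xV; rewrite -[x]invgK xV zV.
apply: (expg_odd_eq1 no); rewrite expgMn; last exact: zC.
by rewrite xn expg_involution_odd.
Qed.

Lemma square_involution_comm d e :
  d * d = z -> e * e = z -> commute d e -> e = d \/ e = d * z.
Proof.
move=> dd ee de; have [|/(congr1 ( *%g d))|/(congr1 ( *%g d))] :=
  @square_eq1 (d^-1 * e).
- have deV : commute d^-1 e by exact/commute_sym/commuteV/commute_sym.
  by rewrite {1}deV -!mulgA (mulgA d^-1) -invgM dd zV -zC mulgA ee zz.
- by rewrite mulVKg mulg1; left.
- by rewrite mulVKg; right.
Qed.

Lemma invertsX g c n : g * c = c^-1 * g -> g * c ^+ n = c ^- n * g.
Proof.
move=> gc; elim: n => [|n IHn]; first by rewrite invg1 mulg1 mul1g.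
by rewrite [in LHS]expgS expgSr invgM mulgA gc -[LHS]mulgA IHn mulgA.
Qed.

Lemma invertsV g d : g * d = d^-1 * g -> g * d^-1 = d * g.
Proof. by move=> gd; apply: (mulIg d); rewrite mulgVK -mulgA gd mulVKg. Qed.

Lemma inverts_not_comm g e : e * e = z -> g * e = e^-1 * g -> ~ commute g e.
Proof.
move=> ee ge; rewrite /commute ge => /mulIg eV.
by apply: z1; rewrite -ee -{1}eV mulVg.
Qed.

Lemma square_involution_in_centralizer d e :
  d * d = z -> e * e = z -> commute d e -> forall g, commute g d -> commute g e.
Proof.
move=> dd ee de g gd.
have [->//|->] := square_involution_comm dd ee de.
by apply: commuteM => //; exact: zC.
Qed.

(* If [w] and [v] have the same square, then [w] inverts [w^-1 * v]. *)
Lemma centralizer_chain d : d * d = z -> forall n u v,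
  commute u d -> commute v d -> v ^+ (2 ^ n) = 1 ->
  (n = 0 \/ u ^+ (2 ^ n.-1) <> 1) -> exists j, v = u ^+ j.
Proof.
move=> dd n u v ud; elim: n v => [|n IHn] v vd.
  by rewrite expg1 => -> _; exists 0%N.
rewrite expnS expgnA expg2 => vn [//|/= un].
have [||j vu] := IHn (v * v) _ vn.
- by apply/commute_sym; apply: commuteM; exact/commute_sym.
- case: n un {IHn vn} => [|n] un; [by left|right=> /= un'].
  by apply: un; rewrite expnSr expgnA un' expg1n.
have jE : ~~ odd j.
  apply/negP => jo; apply: un; apply: (expg_odd_eq1 jo).
  by rewrite expgnAC -vu.
have := odd_double_half j; rewrite (negbTE jE) add0n -addnn => jD.
move: vu; rewrite -jD expgnDr; set w := u ^+ _ => vw.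
have u1 : u <> 1 by move=> u1; apply: un; rewrite u1 expg1n.
have [m um] := zpow u1.
have wc : w * (w^-1 * v) = (w^-1 * v)^-1 * w.
  by rewrite mulVKg invgM invgK -mulgA -vw mulKg.
have wd : commute w d by apply/commute_sym/commuteX/commute_sym.
have cd : commute d (w^-1 * v).
  by apply: commuteM; [exact/commuteV/commute_sym|exact/commute_sym].
have [c1|c1] := pselect (w^-1 * v = 1).
  by exists (j./2); rewrite -/w -[v](mulVKg w) c1 mulg1.
have [cz|cz] := pselect (w^-1 * v = z).
  by exists (j./2 + m)%N; rewrite expgnDr um -/w -[v](mulVKg w) cz.
(* The power of [w^-1 * v] found here has square [z] and commutes with [d], so it is [d] or its
   inverse and commutes with [w]; but [w] inverts it. *)
have [r] := even_power_involution c1 cz; rewrite -expgMn // => ee.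
exfalso; apply: (inverts_not_comm _ (invertsX r wc)); first by rewrite -expgMn.
by apply: (square_involution_in_centralizer dd) => //;
  [rewrite -expgMn|exact: commuteX].
Qed.

(** The square of [g] commutes with [d]. Were it neither 1 nor [z], one of its powers would be [d]
    or the inverse of [d], and [g] would commute with [d]. *)
Lemma inverts_square d g : d * d = z -> g * d = d^-1 * g -> g * g = z.
Proof.
move=> dd gd; have ngd := inverts_not_comm dd gd.
have ggd : commute d (g * g).
  by rewrite /commute -[RHS]mulgA gd [RHS]mulgA (invertsV gd) mulgA.
have [g1|g1] := pselect (g * g = 1).
  case: (square_eq1 g1) => gE; case: ngd; rewrite gE.
    exact/commute_sym/commute1.
  exact/commute_sym/zC.
apply: contrapT => gz.
have [r] := even_power_involution g1 gz; set e := _ ^+ r => ee.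
have de : commute d e by exact: commuteX.
apply: ngd; apply: (square_involution_in_centralizer ee) => //.
by apply: commuteX; exact: commuteM.
Qed.

(** The product [g * c] inverts [d] too, so it has the same square [z] as [g]; cancelling [g] leaves
    c g c = g. *)
Lemma inverts_centralizer d g : d * d = z -> g * d = d^-1 * g ->
  forall c, commute c d -> g * c = c^-1 * g.
Proof.
move=> dd gd c cd; have gg := inverts_square dd gd.
have := @inverts_square d (g * c) dd;
  rewrite -mulgA cd mulgA gd -mulgA => /(_ erefl).
rewrite -gg -!mulgA => /mulgI cgc.
by apply: (mulgI c); rewrite mulVKg.
Qed.

Lemma ord4V d : d * d = z -> d^-1 = d * z.
Proof. by move=> dd; apply: mulg1_eq; rewrite mulgA dd zz. Qed.

(** Some power of 4 kills [h], and powers of 4 are 1 modulo 3, so [h] is the inverse of a power of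
    its cube. *)
Lemma commute_cube h d : commute (h ^+ 3) d -> commute h d.
Proof.
move=> h3d; have [a ha] := expg_two_power h.
have [q qE] : exists q, (4 ^ a = 3 * q + 1)%N.
  exists ((4 ^ a) %/ 3)%N; rewrite mulnC [LHS](divn_eq _ 3); congr (_ + _)%N.
  by rewrite -modnXm exp1n.
have : h ^+ (4 ^ a) = 1.
  by rewrite -[4%N]/(2 * 2)%N expnMn expgnA ha expg1n.
rewrite qE addn1 expgSr => /mulg1_eq => <-.
apply/commute_sym/commuteV; rewrite expgnA.
exact/commuteX/commute_sym.
Qed.

(* Conjugation by [f * g] cycles the three subgroups of order 4 of <d, e>. *)
Lemma squares_not_inverting f g d e :
  f * f = d -> g * g = e -> d * d = z -> e * e = z -> e * d = d^-1 * e -> False.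
Proof.
move=> ff gg dd ee ed; have edV := invertsV ed.
have fd : commute f d by rewrite /commute -ff mulgA.
have ge : commute g e by rewrite /commute -gg mulgA.
have de : d * e = e^-1 * d.
  by rewrite (ord4V ee) -mulgA -zC mulgA ed -mulgA zC mulgA (ord4V dd) -(mulgA
    d) zz mulg1.
have ef := inverts_centralizer dd ed fd.
have dg := inverts_centralizer ee de ge.
have fe : f * e = e * f^-1 by rewrite (invertsV ef).
have gd : g * d = d * g^-1 by rewrite (invertsV dg).
have hd : (f * g) * d = e * (f * g).
  have fdE : f * d = f^-1 * z by apply: (mulgI f); rewrite mulVKg mulgA ff.
  have geE : g * e = g^-1 * z by apply: (mulgI g); rewrite mulVKg mulgA gg.
  by rewrite -mulgA gd mulgA fdE [RHS]mulgA ef -[RHS]mulgA -ge geE -[LHS]mulgA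
    -zC.
have he : (f * g) * e = e * d^-1 * (f * g).
  by rewrite -mulgA ge mulgA fe -!mulgA -ff invgM -mulgA mulKg.
have hde : (f * g) * (e * d^-1) = d * (f * g).
  have hdV : (f * g) * d^-1 = e^-1 * (f * g).
    by apply: (mulIg d); rewrite mulgVK -mulgA hd mulKg.
  by rewrite mulgA he -mulgA hdV mulgA edV mulgK.
(* Three conjugations bring [d] back, so the cube of [f * g] commutes with [d], and then so does
   [f * g], although it conjugates [d] to [e]. *)
have : commute (f * g) d.
  apply: commute_cube; move: hd he hde; set h := f * g => hd he hde.
  rewrite /commute !expgS expg0 mulg1 -[LHS]mulgA -[in LHS](mulgA h) hd.
  by rewrite (mulgA h e) he -(mulgA (e / d)) (mulgA h (e / d)) hde -mulgA.
rewrite /commute hd => /mulIg ed'; apply: (inverts_not_comm dd ed).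
by rewrite /commute ed'.
Qed.

(** If some [f] has order 8, the square of [f] generates a normal subgroup. Otherwise every square
    is 1 or [z], and any element of order 4 will do. *)
Lemma normal_ord4 x : x <> 1 -> x <> z ->
  exists d, d * d = z /\ forall g, commute g d \/ g * d = d^-1 * g.
Proof.
move=> x1 xz.
have [[f ffz]|nobig] := pselect (exists f, (f * f) * (f * f) = z); last first.
  have sqz y : y * y = 1 \/ y * y = z.
    have [->|y1] := pselect (y = 1); first by left; rewrite mulg1.
    have [->|yz] := pselect (y = z); first by left.
    have [m mz] := even_power_involution y1 yz; right.
    have mo : odd m.
      apply/negPn/negP => me; apply: nobig; exists (y ^+ m./2).
      by rewrite -!expgnDr !addnn even_halfK // -addnn expgnDr.
    have yyz : y * y * z = 1.
      apply: (expg_odd_eq1 mo); rewrite expgMn; last exact: zC.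
      by rewrite (expg_involution_odd mo) expgMn // mz.
    by rewrite -zV -(mulg1_eq yyz) invgK.
  have xx : x * x = z by case: (sqz x) => // /square_eq1 [].
  exists x; split=> // g.
  have xVz : x^-1 * z = x by rewrite (ord4V xx) -mulgA zz mulg1.
  have gVE : g^-1 = g \/ g^-1 = g * z.
    by case: (sqz g) => gg; [left; exact: mulg1_eq|right; exact: ord4V].
  have gxV : g * x = x^-1 * g^-1 \/ g * x = x^-1 * g^-1 * z.
    rewrite -invgM; case: (sqz (g * x)) => gx; [left|right].
      by rewrite (mulg1_eq gx).
    by rewrite (ord4V gx) -mulgA zz mulg1.
  case: gVE gxV => -> [] gx; [right|left|left|right]; rewrite /commute gx //.
  - by rewrite -mulgA zC mulgA xVz.
  - by rewrite zC mulgA xVz.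
  - by rewrite -!mulgA zz mulg1.
move dE: (f * f) ffz => d ffz; exists d; split=> // g.
have [d' d'D] : exists d', d' = g * d * g^-1 by exists (g * d * g^-1).
set f' := g * f * g^-1.
have f'f' : f' * f' = d' by rewrite /f' d'D -dE !mulgA mulgVK.
have d'd' : d' * d' = z.
  by rewrite d'D !mulgA mulgVK -(mulgA g d d) ffz zC mulgK.
have gd : g * d = d' * g by rewrite d'D mulgVK.
have [dd'|ndd'] := pselect (commute d d').
  have [d'E|d'E] := square_involution_comm ffz d'd' dd'.
    by left; rewrite /commute gd d'E.
  by right; rewrite gd d'E (ord4V ffz).
have c1 : d * d' <> 1.
  by move=> /mulg1_eq d'E; apply: ndd'; rewrite -d'E; exact/commuteV.
have cz : d * d' <> z.
  move=> c_z; apply: ndd'; have -> : d' = d^-1 * z by rewrite -c_z mulKg.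
  by apply: commuteM; [exact/commuteV|exact: zC].
(* Both [d] and [d'] invert [d * d'], hence also its power [e]; therefore [e] commutes with
   [d^-1 * d']. *)
have [m] := even_power_involution c1 cz; set e := _ ^+ m => ee.
have cV : (d * d')^-1 = d' * d.
  rewrite invgM (ord4V ffz) (ord4V d'd') -mulgA; congr (_ * _).
  by rewrite -zC -mulgA zz mulg1.
have de : d * e = e^-1 * d.
  by apply: invertsX; rewrite cV mulgA ffz -mulgA ffz zC.
have d'e : d' * e = e^-1 * d' by apply: invertsX; rewrite cV mulgA.
have ed : e * d = d^-1 * e.
  by apply: (mulgI d); rewrite mulVKg mulgA de -mulgA ffz (ord4V ee) -mulgA zz
    mulg1.
have [q qD] : exists q, q = d^-1 * d' by exists (d^-1 * d').
have eq : commute e q.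
  rewrite /commute qD mulgA (invertsV ed) -[RHS]mulgA d'e mulgA; congr (_ * _).
  by rewrite -invgM ed invgM invgK.
have d'E : d' = d * q by rewrite qD mulVKg.
have [q1|q1] := pselect (q = 1).
  by left; rewrite /commute gd d'E q1 mulg1.
have [qz|qz] := pselect (q = z).
  by right; rewrite gd d'E qz (ord4V ffz).
exfalso.
have [n] := even_power_involution q1 qz; set p := q ^+ n => pp.
have ep : commute e p by exact: commuteX.
(* An even [n] would make [p], which is [e] or its inverse, a square; then [d] and [e] would both be
   squares, with [e] inverting [d]. *)
have no : odd n.
  apply/negPn/negP => ne.
  pose w := q ^+ n./2.
  have ww : w * w = p by rewrite -expgnDr addnn even_halfK.
  have [pE|pE] := square_involution_comm ee pp ep.
    exact: (squares_not_inverting dE (etrans ww pE) ffz ee ed).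
  apply: (@squares_not_inverting f w^-1 d e dE _ ffz ee ed).
  by rewrite -invgM ww pE -(ord4V ee) invgK.
have qqz : q * q = z.
  suff /mulg1_eq qV : q * q * z = 1 by rewrite -zV -qV invgK.
  apply: (expg_odd_eq1 no); rewrite expgMn; last exact: zC.
  by rewrite (expg_involution_odd no) expgMn // pp.
(* Now [q] is [e] or its inverse, so [d'] inverts [d], while both are squares, of [f'] and of
   [f]. *)
have d'd : d' * d = d^-1 * d'.
  rewrite d'E mulKg.
  have [->|->] := square_involution_comm ee qqz eq.
    by rewrite -mulgA ed mulVKg.
  by rewrite -!mulgA -zC [e * (_ * _)]mulgA ed -mulgA mulVKg.
exact: (squares_not_inverting dE f'f' ffz d'd').
Qed.
End UniqueInvolution.

(** * Roots of unity and locally cyclic 2-groups *)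

Section RootsOfUnity.
Variable R : realType.
Local Open Scope ring_scope.

(** The value -1 at level 1 is set by hand, because the principal square root of 1 is 1. The result
    is a tower of roots of unity compatible with squaring. *)
Fixpoint zeta (n : nat) : R[i] :=
  if n is m.+1 then (if m is 0 then -1 else sqrtC (zeta m)) else 1.

Lemma zetaS n : zeta n.+1 ^+ 2 = zeta n.
Proof. by case: n => [|n]; [rewrite sqrrN expr1n|rewrite /= sqrtCK]. Qed.

Lemma zeta_expS n : zeta n.+1 ^+ (2 ^ n) = -1.
Proof.
by elim: n => [|n IHn]; [rewrite expr1|rewrite expnS exprM zetaS].
Qed.

Lemma zeta_primitive n : (2 ^ n).-primitive_root (zeta n).
Proof.
case: n => [|n].
  have [m mprim] := prim_order_exists (isT : 0 < 1)%N (expr1n R[i] 1).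
  by rewrite dvdn1 => /eqP m1; rewrite m1 in mprim.
have zE : zeta n.+1 ^+ (2 ^ n.+1) = 1 by rewrite expnSr exprM zeta_expS expr2
  mulrNN mulr1.
have [m mprim] := prim_order_exists (expn_gt0 2 n.+1) zE.
case/(dvdn_pfactor _ _ (isT : prime 2)) => a an mE.
move: an; rewrite leq_eqVlt => /orP[/eqP aE|]; first by rewrite mE aE in mprim.
rewrite ltnS => an; exfalso.
have := zeta_expS n; have -> :
  (2 ^ n = m * 2 ^ (n - a))%N by rewrite mE -expnD subnKC.
rewrite exprM (prim_expr_order mprim) expr1n.
by move/eqP; rewrite eq_sym eqNr oner_eq0.
Qed.

Lemma C2fin_zeta n w : C2fin n w -> exists j, (j < 2 ^ n)%N /\ w = zeta n ^+ j.
Proof. by case/(prim_rootP (zeta_primitive n)) => i ->; exists i. Qed.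

Lemma zetaX n j : C2fin n (zeta n ^+ j).
Proof. by rewrite /C2fin /= exprAC (prim_expr_order (zeta_primitive n)) expr1n.
  Qed.

Lemma zetaD n d : zeta (n + d) ^+ (2 ^ d) = zeta n.
Proof.
by elim: d => [|d IHd]; [rewrite addn0 expr1|rewrite addnS expnS exprM zetaS].
Qed.
End RootsOfUnity.

Section CyclicTwoGroups.
Local Open Scope group_scope.
Variables (H : groupType) (z : H).
Hypotheses (z1 : z <> 1) (zz : z * z = 1).
Hypothesis zpow : forall x, x <> 1 -> exists n, x ^+ n = z.

(** The order is exactly [2 ^ n], in the shape used by [centralizer_chain]; [n = 0] is set apart
    because [n.-1] is then [n] itself. *)
Definition ord_pow2 (n : nat) (u : H) := u ^+ (2 ^ n) = 1 /\
  (n = 0 \/ u ^+ (2 ^ n.-1) <> 1).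

Lemma ord_pow2_exists x : exists n, ord_pow2 n x.
Proof.
have ex : exists n, `[< x ^+ (2 ^ n) = 1 >].
  by have [n xn] := expg_two_power z1 zz zpow x; exists n; exact/asboolP.
case: (ex_minnP ex) => n /asboolP xn nmin; exists n; split=> //.
case: n xn nmin => [|n] xn nmin; [by left|right=> /= xn'].
by have := nmin n (introT (asboolP _) xn'); rewrite ltnn.
Qed.

Lemma ord_pow2_dvd n u m : ord_pow2 n u -> (u ^+ m = 1) <-> (2 ^ n %| m)%N.
Proof.
move=> [un un']; split; last first.
  by case/dvdnP => q ->; rewrite mulnC expgnA un expg1n.
case: m => [|m]; first by rewrite dvdn0.
have [r r2 mE] := pfactor_coprime (isT : prime 2) (ltn0Sn m).
rewrite mE coprime2n in r2 * => um; apply: dvdn_mull; apply: dvdn_exp2l.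
rewrite leqNgt; apply/negP => lt; case: un' => [n0|]; first by rewrite n0 in lt.
apply; rewrite -(subnKC (_ : logn 2 m.+1 <= n.-1)%N); last by case: (n) lt.
rewrite expnD expgnA; set w := u ^+ _.
suff -> : w = 1 by rewrite expg1n.
by apply: (expg_odd_eq1 z1 zz zpow r2); rewrite /w -expgnA mulnC.
Qed.

Lemma ord_pow2_eq n u i j : ord_pow2 n u ->
  (u ^+ i = u ^+ j) <-> (i = j %[mod 2 ^ n]).
Proof.
wlog ij : i j / (i <= j)%N => [hw|] un.
  have [/hw|/ltnW /hw] := leqP i j; first exact.
  by move=> /(_ un) [h1 h2]; split=> [/esym/h1|/esym/h2].
have -> : (u ^+ i = u ^+ j) <-> (u ^+ (j - i) = 1).
  rewrite expgnFr //; split=> [->|/divg1_eq //]; exact: mulgV.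
rewrite (ord_pow2_dvd _ un); rewrite -eqn_mod_dvd //.
by split=> [/eqP|e]; [|apply/eqP].
Qed.

Variable D : set H.
Hypotheses (Dz : D z) (DM : forall x y, D x -> D y -> D (x * y)).
Hypothesis chain : forall n u v, D u -> D v -> v ^+ (2 ^ n) = 1 ->
  (n = 0 \/ u ^+ (2 ^ n.-1) <> 1) -> exists j, v = u ^+ j.

Let DX x n : D x -> D (x ^+ n).
Proof.
move=> Dx; elim: n => [|n IHn]; first by rewrite expg0 -zz; exact: DM.
by rewrite expgS; exact: DM.
Qed.

(** By [chain], [u] is a power of the longer element [x]; the exponent is even, since an odd one
    would give [x ^+ (2 ^ n) = 1]. *)
Lemma square_root_exists n u : D u -> ord_pow2 n u ->
  (exists2 x, D x & x ^+ (2 ^ n) <> 1) ->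
  exists v, [/\ D v, ord_pow2 n.+1 v & v * v = u].
Proof.
move=> Du [un un'] [x Dx xn].
case: n un un' xn => [|n] un un' xn.
  (* Here [u] is 1, and its root has to be the element of order exactly 2. *)
  rewrite expg1 in un; exists z; split=> //; last by rewrite zz.
  by split; [rewrite expg2|right].
have [|j uE] := chain Dx Du un.
  by right=> /= xn'; apply: xn; rewrite expnSr expgnA xn' expg1n.
have jE : ~~ odd j.
  apply/negP => jo; apply: xn; apply: (expg_odd_eq1 z1 zz zpow jo).
  by rewrite expgnAC -uE.
have uE' : x ^+ j./2 * x ^+ j./2 = u by rewrite -expgnDr addnn even_halfK //
  -uE.
exists (x ^+ j./2); split; [exact: DX| |by []].
case: un' => [//|un']; split; first by rewrite expnS expgnA expg2 uE'.
by right; rewrite /= expnS expgnA expg2 uE'.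
Qed.

(** [2 ^ k] is the exponent of [D], with [k] infinite when orders are unbounded. Square roots are
    extracted up to level [k], and [chain] puts each [x] among the powers of the term having the
    order of [x]. *)
Lemma power_tower : exists (k : natinf) (u : nat -> H),
  [/\ forall n, leinf n k -> D (u n) /\ ord_pow2 n (u n),
      forall n, leinf n.+1 k -> u n.+1 * u n.+1 = u n &
      forall x, D x -> exists n j, leinf n k /\ x = u n ^+ j].
Proof.
have [k kP] : exists k : natinf, forall n,
    leinf n.+1 k <-> exists2 x, D x & x ^+ (2 ^ n) <> 1.
  have [[N bN]|nb] := pselect (exists N, forall x, D x -> x ^+ (2 ^ N) = 1).
    have ex : exists N, `[< forall x, D x -> x ^+ (2 ^ N) = 1 >].
      by exists N; exact/asboolP.
    case: (ex_minnP ex) => k /asboolP bk kmin; exists (Some k) => n /=; split.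
      move=> nk; apply: contrapT => nx.
      suff : (k <= n)%N by rewrite leqNgt nk.
      apply/kmin/asboolP => x Dx.
      by apply: contrapT => xn; apply: nx; exists x.
    move=> [x Dx xn]; rewrite ltnNge; apply/negP => kn; apply: xn.
    by rewrite -(subnKC kn) expnD expgnA bk // expg1n.
  exists None => n; split=> // _; apply: contrapT => nx; apply: nb;
    exists n => x Dx.
  by apply: contrapT => xn; apply: nx; exists x.
have [sq sqP] : exists sq : nat -> H -> H, forall n u, D u -> ord_pow2 n u ->
    leinf n.+1 k -> [/\ D (sq n u),
      ord_pow2 n.+1 (sq n u) & sq n u * sq n u = u].
  have H1 n u : exists v, D u -> ord_pow2 n u ->
    leinf n.+1 k -> [/\ D v, ord_pow2 n.+1 v & v * v = u].
    have [[Du un kn]|h] := pselect [/\ D u, ord_pow2 n u & leinf n.+1 k].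
      have [v ?] := square_root_exists Du un (proj1 (kP n) kn).
      by exists v.
    by exists 1 => Du un kn; case: h.
  exists (fun n u => sval (cid (H1 n u))) => n u.
  exact: (svalP (cid (H1 n u))).
pose u := fix u n := if n is m.+1 then sq m (u m) else 1%g.
have leinfW n : leinf n.+1 k -> leinf n k by case: (k) => //= m /ltnW.
have uP n : leinf n k -> D (u n) /\ ord_pow2 n (u n).
  elim: n => [_|n IHn kn].
    by split; [rewrite /= -(expg0 z); exact: DX|split; [rewrite expg1n|left]].
  by have [Dn un] := IHn (leinfW _ kn); have [] := sqP _ _ Dn un kn.
exists k, u; split=> // [n kn|x Dx].
  by have [Dn un] := uP _ (leinfW _ kn); have [] := sqP _ _ Dn un kn.
have [n xn] := ord_pow2_exists x.
have kn : leinf n k.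
  case: n xn => [|n] xn; first by case: (k).
  by apply/kP; exists x => //; case: xn => _ [].
have [Dn [un un']] := uP _ kn; case: xn => xn _.
by have [j ->] := chain Dn Dx xn un'; exists n, j.
Qed.

Variable R : realType.

(** The map sends [u n ^+ j] to [zeta R n ^+ j]. Compatibility with squaring brings two elements to
    a common level, where the equal orders of [u n] and [zeta R n] give well-definedness and
    injectivity at once. *)
Lemma embed_C2 : exists (k : natinf) (t : H -> R[i]),
  [/\ forall x y, D x -> D y -> t (x * y) = (t x * t y)%R,
      forall x y, D x -> D y -> t x = t y -> x = y &
      forall w, C2set k w <-> exists2 x, D x & t x = w].
Proof.
have [k [u [uP uS uD]]] := power_tower.
pose rel x w := exists n j, [/\ leinf n k,
  x = u n ^+ j & w = (zeta R n ^+ j)%R].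
have lift n d : leinf (n + d) k -> u (n + d)%N ^+ (2 ^ d) = u n.
  elim: d => [|d IHd]; rewrite ?addn0 ?expg1 // addnS => kn.
  rewrite expnS expgnA expg2 uS // IHd //.
  by case: (k) kn => //= m /ltnW.
have common x w y v : rel x w -> rel y v -> exists n i j,
    [/\ leinf n k, x = u n ^+ i, w = (zeta R n ^+ i)%R,
      y = u n ^+ j & v = (zeta R n ^+ j)%R].
  move=> [n [i [kn -> ->]]] [m [j [km -> ->]]].
  wlog nm : n m i j kn km / (n <= m)%N => [hw|].
    have [nm|/ltnW mn] := leqP n m; first exact: hw.
    have [p [i' [j' [? ? ? ? ?]]]] := hw _ _ j i km kn mn.
    by exists p, j', i'.
  exists m, (2 ^ (m - n) * i)%N, j; split => //.
    by rewrite expgnA -{1}(subnKC nm) lift // subnKC.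
  by rewrite exprM -{1}(subnKC nm) zetaD.
have rel_ex x : D x -> exists w, rel x w.
  by move=> /uD[n [j [kn ->]]]; exists (zeta R n ^+ j)%R, n, j.
have rel_eq x w y v : rel x w -> rel y v -> (x = y <-> w = v).
  move=> xw yv; have [n [i [j [kn -> -> -> ->]]]] := common _ _ _ _ xw yv.
  have [_ un] := uP n kn; rewrite (ord_pow2_eq _ _ un).
  have := eq_prim_root_expr (zeta_primitive R n) i j.
  by move=> e; split=> [/eqP|] h; apply/eqP; [rewrite e|rewrite -e h].
pose t x := xget 1%R [set w | rel x w].
have tP x : D x -> rel x (t x).
  by move=> /rel_ex [w xw]; exact: (@xgetPex _ 1%R [set w | rel x w] (ex_intro
    _ w xw)).
exists k, t; split=> [x y Dx Dy|x y Dx Dy txy|w].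
- have [n [i [j [kn xE wE yE vE]]]] := common _ _ _ _ (tP _ Dx) (tP _ Dy).
  apply: (proj1 (rel_eq _ _ _ _ (tP _ (DM Dx Dy)) _)) (erefl _).
  by exists n, (i + j)%N; split => //;
    [rewrite expgnDr -xE -yE|rewrite exprD -wE -vE].
- exact: (proj2 (rel_eq _ _ _ _ (tP _ Dx) (tP _ Dy)) txy).
- have C2P : C2set k w <-> exists2 n, leinf n k & C2fin n w.
    case: (k) => [n|] /=; split.
    + by move=> wn; exists n.
    + by case=> m mn; exact: C2fin_le.
    + by case=> n _ wn; exists n.
    (* [C2set None] is a union over levels at least 1, so level [n], possibly 0, is moved up by
       one. *)
    + by case=> n _ wn; exists n.+1 => //; apply: C2fin_le wn; exact: leqnSn.
  rewrite C2P; split=> [[n kn /C2fin_zeta [j [_ ->]]]|[x Dx <-]].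
    have Dun : D (u n ^+ j) by apply: DX; case: (uP _ kn).
    exists (u n ^+ j) => //; apply: (proj1 (rel_eq _ _ _ _ (tP _ Dun) _))
      (erefl _).
    by exists n, j.
  by have [n [j [kn _ ->]]] := tP _ Dx; exists n => //; exact: zetaX.
Qed.
End CyclicTwoGroups.

(** * Classification of the 2-groups with a unique involution *)

Section QuaternionNormalForm.
Variable R : realType.
Local Open Scope ring_scope.
Implicit Types (w v : R[i]) (k : natinf).

Lemma quat_mulE (p q : quat R) : (p * q)%g =
  Quat (qfst p * qfst q - qsnd p * (qsnd q)^*)
       (qfst p * qsnd q + qsnd p * (qfst q)^*).
Proof. by []. Qed.

Lemma C2fin_conj_mul n w : C2fin n w -> w * w^* = 1.
Proof.
move=> wn; have : quat_unit (quat_of_complex w) by apply: (@Q2gen_unit _ n);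
  left; exists w.
by rewrite /quat_unit /= rmorph0 mulr0 addr0.
Qed.

Lemma C2fin_conj n w : C2fin n w -> C2fin n w^*.
Proof. by rewrite /C2fin /= -rmorphXn => ->; rewrite rmorph1. Qed.

Lemma C2finM n w v : C2fin n w -> C2fin n v -> C2fin n (w * v).
Proof. exact: (@C2setM _ (Some n)). Qed.

Lemma C2finN n w : C2fin n.+1 w -> C2fin n.+1 (- w).
Proof. by rewrite /C2fin /= exprNn => ->;
  rewrite mulr1 expnS exprM sqrrN !expr1n. Qed.

(** The right-hand side is closed under products because j moves past w by conjugating it and j^2 =
    -1 is in C_(2^n); the bound on [n] is what puts i in C_(2^n). *)
Lemma Q2finE n (q : quat R) : (2 <= n)%N ->
  Q2fin n.+1 q <-> exists2 w, C2fin n w & q = Quat w 0 \/ q = Quat 0 w.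
Proof.
case: n => [|[|n]] // _; set N := n.+2; split; last first.
  have genC w : C2fin N w -> Q2fin N.+1 (Quat w 0).
    by move=> wN G [_ genG]; apply: genG; left; exists w.
  have genj : Q2fin N.+1 (Quat 0 1 : quat R) by move=> G [_ genG];
    apply: genG; right; rewrite /Q8 /=; tauto.
  move=> [w /genC wN [->//|->]].
  have -> : Quat 0 w = ((Quat w 0)%R * (Quat 0 1)%R)%g.
    by rewrite quat_mulE /= rmorph0 rmorph1 !mulr0 !mul0r subr0 addr0 mulr1.
  exact: Q2finM.
apply: (@smallest_sub _ (@is_subgroup (quat R)) _
  [set q | exists2 w, C2fin N w & q = Quat w 0 \/ q = Quat 0 w]); last first.
  have iN : C2fin N ('i : R[i]).
    by rewrite /C2fin /= /N 2!expnS (exprM _ 2) sqrCi exprM sqrrN !expr1n.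
  have oneN : C2fin N (1 : R[i]) by rewrite /C2fin /= expr1n.
  move=> r /=; case=> [[w wN <-]|]; first by exists w => //; left.
  rewrite /Q8 /= => Hq; decompose [or] Hq; subst r.
  - by exists 1 => //; left.
  - by exists (-1); [exact: C2finN|left].
  - by exists 'i => //; left.
  - by exists (- 'i); [exact: C2finN|left].
  - by exists 1 => //; right.
  - by exists (-1); [exact: C2finN|right].
  - by exists 'i => //; right.
  - by exists (- 'i); [exact: C2finN|right].
split=> [p r [w wN pE] [v vN qE]|].
  have vN' := C2fin_conj vN.
  case: pE => ->; case: qE => ->;
    rewrite quat_mulE /= ?rmorph0 ?mulr0 ?mul0r ?subr0 ?addr0 ?add0r ?sub0r.
  - by exists (w * v); [exact: C2finM|left].
  - by exists (w * v); [exact: C2finM|right].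
  - by exists (w * v^*); [exact: C2finM|right].
  - by exists (- (w * v^*)); [exact/C2finN/C2finM|left].
exists 1%g; split.
- by exists 1; [rewrite /C2fin /= expr1n|left].
- by move=> x _; rewrite mul1g mulg1.
- move=> p [w wN qE].
  have uq : quat_unit p.
    by case: qE => ->; rewrite /quat_unit /= rmorph0 mulr0 ?addr0 ?add0r
      (C2fin_conj_mul wN).
  exists (quat_conj p); rewrite quat_mulV // quat_mulrV //; split=> //.
  case: qE => ->; rewrite /quat_conj /= ?rmorph0 ?oppr0.
    by exists w^*; [exact: C2fin_conj|left].
  by exists (- w); [exact: C2finN|right].
Qed.

Lemma Q2setE k (q : quat R) : leinf 2 k ->
  Q2set (omap succn k) q <-> exists2 w,
    C2set k w & q = Quat w 0 \/ q = Quat 0 w.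
Proof.
case: k => [n|_] /=; first exact: Q2finE.
split=> [[[|n] // n3 /(Q2finE _ n3) [w wn qE]]|[w [n n1 wn] qE]].
  by exists w => //; exists n => //; case: n n3 {wn}.
exists n.+2 => //=; apply/Q2finE => //; exists w => //.
by apply: C2fin_le wn.
Qed.

Lemma C2set_conj k w : C2set k w -> w^* = w^-1.
Proof.
move=> wk; apply: (mulfI (C2set_neq0 wk)); rewrite mulfV ?(C2set_neq0 wk) //.
by case: k wk => [n|[n _]] /C2fin_conj_mul.
Qed.
End QuaternionNormalForm.

Definition isomorphic (G H : groupType) :=
  exists f : G -> H, [/\ injective f, forall y, exists x, f x = y &
    forall x y, f (x * y)%g = (f x * f y)%g].

Section Classification.
Local Open Scope group_scope.
Variables (R : realType) (H : groupType) (z : H).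
Hypotheses (z1 : z <> 1) (zz : z * z = 1).
Hypothesis zpow : forall x, x <> 1 -> exists n, x ^+ n = z.

Let zC := involution_comm zpow.

Lemma isomorphic_C2 :
  (forall n (u v : H), v ^+ (2 ^ n) = 1 ->
    (n = 0 \/ u ^+ (2 ^ n.-1) <> 1) -> exists j, v = u ^+ j) ->
  exists k, leinf 1 k /\ isomorphic H (C2 R k).
Proof.
move=> chain.
have [//|||k [t [tM tI tk]]] := @embed_C2 H z z1 zz zpow setT _ _ _ R => //.
  by move=> n u v _ _; exact: chain.
exists k; split.
  case: k tk => [[|n]|] // tk; exfalso.
  have tx x : t x = 1%R by have /tk : exists2 y, setT y & t y = t x by exists x.
  by apply: z1; apply: tI => //; rewrite !tx.
have ct x : C2set k (t x) by apply/tk; exists x.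
exists (fun x => SigSub (mem_set (ct x)) : C2 R k); split.
- by move=> x y /(congr1 val) /=; exact: tI.
- move=> y; have /tk [x _ xy] := set_mem (valP y).
  by exists x; apply/val_inj.
- by move=> x y; apply/val_inj => /=; exact: tM.
Qed.

(** The centralizer [D] of [d] has index 2. Embed it in the roots of unity by [t] and send [e] to j:
    [e] inverts [D] as j inverts complex units, and [e * e = z] goes to -1 = j^2. *)
Lemma isomorphic_Q2 d e : d * d = z ->
  (forall g, commute g d \/ g * d = d^-1 * g) ->
  e * d = d^-1 * e ->
  exists k, leinf 3 k /\ isomorphic H (Q2 R k).
Proof.
move=> dd dN ed.
pose D := [set c | commute c d].
have Dz : D z by apply/commute_sym/zC.
have DM x y : D x -> D y -> D (x * y).
  by move=> Dx Dy; apply/commute_sym/commuteM; exact/commute_sym.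
have DV x : D x -> D x^-1 by move=> Dx; apply/commute_sym/commuteV/commute_sym.
have chain := @centralizer_chain H z z1 zz zpow d dd.
have [k [t [tM tI tk]]] := embed_C2 z1 zz zpow Dz DM chain R.
have t1 : t 1 = 1%R.
  have D1 : D 1 by exact/commute_sym/commute1.
  have t0 : t 1 != 0%R by have /tk/C2set_neq0 : exists2 y,
    D y & t y = t 1 by exists 1.
  by apply: (mulfI t0); rewrite mulr1 -tM // mulg1.
have D1 : D 1 by exact/commute_sym/commute1.
have tz : t z = (-1)%R.
  have /eqP : (t z ^+ 2 = 1)%R by rewrite expr2 -tM // zz.
  rewrite sqrf_eq1 => /orP[/eqP tz|/eqP//]; exfalso.
  by apply: z1; apply: tI; rewrite // t1.
(* The element [d] has order 4, which forces the level required by [Q2setE]. *)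
have k2 : leinf 2 k.
  have : C2set k (t d) by apply/tk; exists d.
  case: k tk => [[|[|n]]|] //= _; rewrite /C2fin /=.
    rewrite expr1 => td; exfalso.
    have d1 : d = 1 by apply: tI => //; rewrite t1.
    by apply: z1; rewrite -dd d1 mulg1.
  rewrite expr2 -tM // dd tz => /eqP; rewrite eq_sym -subr_eq0 opprK => h.
  by exfalso; move: h; rewrite -mulr2n pnatr_eq0.
have ee := inverts_square z1 zz zpow dd ed.
have einv := inverts_centralizer z1 zz zpow dd ed.
have nDe : ~ D e by exact: (inverts_not_comm z1 dd ed).
have De g : ~ D g -> D (g * e^-1).
  move=> nDg; have gd : g * d = d^-1 * g by case: (dN g).
  rewrite /D /= /commute -mulgA.
  have -> : e^-1 * d = d^-1 * e^-1 by apply: (mulgI e);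
    rewrite mulVKg mulgA (invertsV ed) mulgK.
  by rewrite mulgA (invertsV gd) mulgA.
have nDMe x : D x -> ~ D (x * e).
  by move=> Dx Dxe; apply: nDe; rewrite -(mulKg x e); apply: DM => //;
    exact: DV.
have tV x : D x -> ((t x)^*)%R = t x^-1.
  move=> Dx; have cx : C2set k (t x) by apply/tk; exists x.
  rewrite (C2set_conj cx); apply: (mulfI (C2set_neq0 cx)).
  by rewrite mulfV ?(C2set_neq0 cx) // -tM ?mulgV ?t1 //; exact: DV.
pose f g := if pselect (D g) then Quat (t g) 0%R else Quat 0%R (t (g * e^-1)).
have fD x : D x -> f x = Quat (t x) 0%R by rewrite /f; case: pselect.
have fDe x : D x -> f (x * e) = Quat 0%R (t x).
  move=> Dx; rewrite /f; case: pselect => [Dxe|nD]; last by rewrite mulgK.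
  by case: (nDMe _ Dx Dxe).
have split g : exists2 x, D x & g = x \/ g = x * e.
  have [Dg|/De Dg] := pselect (D g); first by exists g => //; left.
  by exists (g * e^-1) => //; right; rewrite mulgVK.
exists (omap succn k); split; first by case: (k) k2.
have fQ g : Q2set (omap succn k) (f g).
  apply/Q2setE => //; have [x Dx [->|->]] := split g.
    by exists (t x); [apply/tk; exists x|left; exact: fD].
  by exists (t x); [apply/tk; exists x|right; exact: fDe].
exists (fun x => SigSub (mem_set (fQ x)) : Q2 R (omap succn k)); split.
- move=> g h /(congr1 val) /=.
  have tn0 x : D x -> t x <> 0%R.
    by move=> Dx; apply/eqP; have /tk/C2set_neq0 : exists2 y,
      D y & t y = t x by exists x.
  have [x Dx gE] := split g; have [y Dy hE] := split h.
  case: gE => ->; case: hE => ->.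
  + by rewrite !fD // => -[/tI->].
  + by rewrite fD // fDe // => -[/tn0]; case.
  + by rewrite fDe // fD // => -[/esym/tn0]; case.
  + by rewrite !fDe // => -[/tI->].
- move=> y; have /Q2setE := set_mem (valP y) => /(_ k2) [w /tk [x Dx xw] yE].
  case: yE => yE; [exists x|exists (x * e)]; apply/val_inj => /=.
    by rewrite fD // xw yE.
  by rewrite fDe // xw yE.
- move=> g h; apply/val_inj => /=.
  have [x Dx gE] := split g; have [y Dy hE] := split h.
  case: gE => ->; case: hE => ->; rewrite ?mulgA.
  + have Dxy := DM _ _ Dx Dy.
    by rewrite !fD // quat_mulE /= rmorph0 !mulr0 mul0r subr0 addr0 tM.
  + have Dxy := DM _ _ Dx Dy.
    by rewrite (fDe (x * y)) // fD // fDe // quat_mulE /= rmorph0 !mul0r mulr0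
      subr0 addr0 tM.
  + have -> : x * e * y = x * y^-1 * e by rewrite -mulgA einv // mulgA.
    have DyV := DV _ Dy; have Dxy := DM _ _ Dx DyV.
    by rewrite (fDe (x * y^-1)) // (fDe x) // (fD y) // quat_mulE /= rmorph0
      mul0r !mulr0 subr0 add0r tV // tM.
  + have -> : x * e * y * e = x * y^-1 * z by rewrite -(mulgA x) einv //
    -!mulgA ee.
    have DyV := DV _ Dy; have Dxy := DM _ _ Dx DyV; have Dxyz := DM _ _ Dxy Dz.
    by rewrite fD // !fDe // quat_mulE /= rmorph0 mul0r mulr0 mul0r sub0r addr0
      tV // !tM // tz mulrN1.
Qed.

(** If nothing inverts the [d] of [normal_ord4], then [d] is central and the chain property holds in
    the whole group. The group of order 2 is treated apart, having no element of order 4. *)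
Lemma unique_involution_classification :
  exists k, (leinf 1 k /\ isomorphic H (C2 R k)) \/
            (leinf 3 k /\ isomorphic H (Q2 R k)).
Proof.
have [[x [x1 xz]]|small] := pselect (exists x, x <> 1 /\ x <> z); last first.
  have small' x : x = 1 \/ x = z.
    have [x1|x1] := pselect (x = 1); first by left.
    by right; apply: contrapT => xz; apply: small; exists x.
  have [k [k1 Hk]] : exists k, leinf 1 k /\ isomorphic H (C2 R k);
    last by exists k; left.
  apply: isomorphic_C2 => n u v vn [n0|un].
    by exists 0%N; move: vn; rewrite n0 expg1.
  have uz : u = z by case: (small' u) => // u1; case: un; rewrite u1 expg1n.
  by case: (small' v) => ->; [exists 0%N|exists 1%N].
have [d [dd dN]] := normal_ord4 z1 zz zpow x1 xz.
have [[e ed]|noe] := pselect (exists e, e * d = d^-1 * e).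
  by have [k ?] := isomorphic_Q2 dd dN ed; exists k; right.
have dC g : commute g d by case: (dN g) => // gd; case: noe; exists g.
have [k ?] : exists k, leinf 1 k /\ isomorphic H (C2 R k); last by exists k;
  left.
by apply: isomorphic_C2 => n u v; exact: (centralizer_chain z1 zz zpow dd).
Qed.
End Classification.

(** * The quotient of a subgroup by a normal subgroup, inside an ambient group *)

Section Quotient.
Variables (X : groupType) (N E : set X).
Hypotheses (N1 : N 1) (NM : forall x y, N x -> N y -> N (x * y)).
Hypothesis NV : forall x, N x -> N x^-1.
Hypotheses (E1 : E 1) (EM : forall x y, E x -> E y -> E (x * y)).
Hypothesis EV : forall x, E x -> E x^-1.
Hypothesis EJ : forall x e, N x -> E e -> E (e ^ x).

Let coset x := [set y | E (x^-1 * y)].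

Let coset_eq x y : coset x = coset y <-> E (x^-1 * y).
Proof.
split=> [xy|Exy]; first by rewrite -[E _]/(coset x y) xy /coset /= mulVg.
apply/seteqP; split=> v /= Ev.
  by have := EM (EV Exy) Ev; rewrite invgM invgK -mulgA mulVKg.
by have := EM Exy Ev; rewrite -mulgA mulVKg.
Qed.

Definition cosets := [set C : set X | exists2 x,
  N x & C = [set y | E (x^-1 * y)]].
Definition quotient_type : Type := set_type cosets.
HB.instance Definition _ := Choice.on quotient_type.

Lemma quotient_rep_subproof (C : quotient_type) :
  exists x, N x /\ val C = [set y | E (x^-1 * y)].
Proof. by have [x Nx ->] := set_mem (valP C); exists x. Qed.

Definition quotient_rep (C : quotient_type) :=
  sval (cid (quotient_rep_subproof C)).

Lemma quotient_proj_subproof x : exists C : quotient_type, N x ->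
  val C = coset x.
Proof.
have h y : N y -> cosets (coset y) by exists y.
have [Nx|nNx] := pselect (N x); first by exists (SigSub (mem_set (h _ Nx))).
by exists (SigSub (mem_set (h _ N1))).
Qed.

Definition quotient_proj x := sval (cid (quotient_proj_subproof x)).
Let p := quotient_proj.

Let pE x : N x -> val (p x) = coset x.
Proof. exact: (svalP (cid (quotient_proj_subproof x))). Qed.

Lemma quotient_proj_eq x y : N x -> N y -> p x = p y <-> E (x^-1 * y).
Proof.
move=> Nx Ny; rewrite -coset_eq -!pE //; split=> [->//|]; exact: val_inj.
Qed.

Let Nrep C : N (quotient_rep C).
Proof. by have [] := svalP (cid (quotient_rep_subproof C)). Qed.

Let repK C : p (quotient_rep C) = C.
Proof.
apply/val_inj; rewrite pE //;
  have [_ ->] := svalP (cid (quotient_rep_subproof C)).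
by [].
Qed.

Definition quotient_mul C D := p (quotient_rep C * quotient_rep D).
Definition quotient_inv C := p (quotient_rep C)^-1.

Let pM x y : N x -> N y -> quotient_mul (p x) (p y) = p (x * y).
Proof.
move=> Nx Ny; apply/quotient_proj_eq; rewrite ?invgM; [exact: NM|exact: NM|].
set x' := quotient_rep (p x); set y' := quotient_rep (p y).
have Ex : E (x'^-1 * x) := proj1 (quotient_proj_eq (Nrep _) Nx) (repK _).
have Ey : E (y'^-1 * y) := proj1 (quotient_proj_eq (Nrep _) Ny) (repK _).
have -> : y'^-1 * x'^-1 * (x * y) = y'^-1 * y * (x'^-1 * x) ^ y.
  by rewrite conjgE !mulgA mulgK.
by apply: EM => //; exact: EJ.
Qed.

Let pV x : N x -> quotient_inv (p x) = p x^-1.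
Proof.
move=> Nx; apply/quotient_proj_eq; [exact: NV|exact: NV|rewrite invgK].
set x' := quotient_rep _.
have Ex : E (x'^-1 * x) := proj1 (quotient_proj_eq (Nrep _) Nx) (repK _).
have := EJ (NV Nx) (EV Ex); rewrite conjgE invgM !invgK.
by rewrite !mulgA mulgV mul1g.
Qed.

Let ind (P : quotient_type -> Prop) : (forall x, N x -> P (p x)) ->
  forall C, P C.
Proof. by move=> h C; rewrite -(repK C); exact: h. Qed.

Let mulA : associative quotient_mul.
Proof.
elim/ind=> x Nx; elim/ind=> y Ny; elim/ind=> v Nv.
rewrite (pM Ny Nv) (pM Nx Ny) !pM ?mulgA //; exact: NM.
Qed.
Let mul1 : left_id (p 1) quotient_mul.
Proof. by elim/ind=> x Nx; rewrite pM // mul1g. Qed.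
Let mulr1 : right_id (p 1) quotient_mul.
Proof. by elim/ind=> x Nx; rewrite pM // mulg1. Qed.
Let mulV : left_inverse (p 1) quotient_inv quotient_mul.
Proof. by elim/ind=> x Nx; rewrite pV // pM ?mulVg //; exact: NV. Qed.
Let mulrV : right_inverse (p 1) quotient_inv quotient_mul.
Proof. by elim/ind=> x Nx; rewrite pV // pM ?mulgV //; exact: NV. Qed.

HB.instance Definition _ := isGroup.Build quotient_type mulA mul1 mulr1 mulV
  mulrV.

Lemma quotient_group_exists : exists (Q : groupType) (f : X -> Q),
  [/\ forall x y, N x -> N y -> f (x * y) = f x * f y,
      forall q, exists2 x, N x & f x = q &
      forall x, N x -> f x = 1 <-> E x].
Proof.
exists (quotient_type : groupType), p; split.
- by move=> x y Nx Ny; rewrite -pM.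
- by move=> C; exists (quotient_rep C).
- by move=> x Nx; rewrite -[1]/(p 1); split => [/esym|] h;
  [have := proj1 (quotient_proj_eq N1 Nx) h|apply/esym/quotient_proj_eq => //];
    rewrite invg1 mul1g.
Qed.
End Quotient.

(** * Maximal cogroups *)

Section Cogroups.
Variable X : groupType.
Implicit Types (K : set X) (k x y : X).

Definition cogroup K :=
  [/\ K !=set0, forall x y v, K x -> K y -> K v -> K (x * y * v),
      forall x, K x -> K x^-1 & forall x y, K x -> K y -> ~ K (x * y)].

(** For a cogroup this is the subgroup KK: [K] is closed under inverses, so x = (x k) k^-1 is a
    product of two of its elements. *)
Definition cosquare K : set X := [set x | exists2 k, K k & K (x * k)].

Definition conj_set x K : set X := [set y | K (y ^ x)].

Definition stabilizer K : set X := [set x | conj_set x K = K].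

Definition max_cogroup K :=
  cogroup K /\ forall K', cogroup K' -> K `<=` K' -> K' = K.

(** [t] induces an isomorphism of N(K)/KK onto [G]; it is kept as a map on all of [X] to avoid
    subtypes. *)
Definition presents (G : groupType) K (t : X -> G) :=
  [/\ forall x y, stabilizer K x -> stabilizer K y -> t (x * y) = t x * t y,
      forall g, exists2 x, stabilizer K x & t x = g &
      forall x, stabilizer K x -> t x = 1 <-> cosquare K x].

Lemma conj_set1 K : conj_set 1 K = K.
Proof. by apply/funext => y; rewrite /conj_set /= conjg1. Qed.

Lemma conj_setM x y K : conj_set (x * y) K = conj_set x (conj_set y K).
Proof. by apply/funext => v; rewrite /conj_set /= conjgM. Qed.

Lemma conj_setK x K : conj_set x (conj_set x^-1 K) = K.
Proof. by rewrite -conj_setM mulgV conj_set1. Qed.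

Lemma conj_setVK x K : conj_set x^-1 (conj_set x K) = K.
Proof. by rewrite -conj_setM mulVg conj_set1. Qed.

Lemma conj_set_sub x K K' : K `<=` K' -> conj_set x K `<=` conj_set x K'.
Proof. by move=> KK' y; exact: KK'. Qed.

Lemma stabilizer1 K : stabilizer K 1.
Proof. exact: conj_set1. Qed.

Lemma stabilizerM K x y : stabilizer K x -> stabilizer K y ->
  stabilizer K (x * y).
Proof. by rewrite /stabilizer /= conj_setM => xK ->. Qed.

Lemma stabilizerV K x : stabilizer K x -> stabilizer K x^-1.
Proof. by rewrite /stabilizer /= => {1}<-; rewrite conj_setVK. Qed.

Lemma stabilizerJ K x y : stabilizer K x -> K (y ^ x) = K y.
Proof. by move=> xK; rewrite -{2}xK. Qed.

Lemma cogroup_conj x K : cogroup K -> cogroup (conj_set x K).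
Proof.
move=> [[k Kk] K3 KV K2]; split.
- by exists (k ^ x^-1); rewrite /conj_set /= conjgKV.
- by move=> a b c Ka Kb Kc; rewrite /conj_set /= !conjMg; exact: K3.
- by move=> a Ka; rewrite /conj_set /= conjVg; exact: KV.
- by move=> a b Ka Kb; rewrite /conj_set /= conjMg; exact: K2.
Qed.

Lemma max_cogroup_conj x K : max_cogroup K -> max_cogroup (conj_set x K).
Proof.
move=> [Kc Kmax]; split=> [|K' K'c KK']; first exact: cogroup_conj.
rewrite -(Kmax (conj_set x^-1 K')) ?conj_setK //; first exact: cogroup_conj.
by rewrite -[K](conj_setVK x); exact: conj_set_sub.
Qed.

Lemma max_cogroup_exists K : cogroup K -> exists2 M, max_cogroup M & K `<=` M.
Proof.
move=> Kc; pose P K' := K' = set0 \/ cogroup K' /\ K `<=` K'.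
have [F FP Ftot|M [PM Mmax]] := @Zorn_bigcup X P.
  have [[K0 FK0 [k0 Kk0]]|F0] := pselect (exists2 K0, F K0 & K0 !=set0);
    last first.
    left; apply/seteqP; split=> // x [K' FK' K'x]; apply: F0; exists K' => //.
    by exists x.
  have FPK K' x : F K' -> K' x -> cogroup K' /\ K `<=` K'.
    by move=> FK' K'x; case: (FP _ FK') => // K'0; move: K'x; rewrite K'0.
  have join K1 K2 x y : F K1 -> F K2 -> K1 x -> K2 y ->
      exists K3, [/\ F K3, K3 x & K3 y].
    by move=> F1 F2 K1x K2y; case: (Ftot _ _ F1 F2) => s;
      [exists K2|exists K1]; split=> //; exact: s.
  right; split; last first.
    by move=> x Kx; exists K0 => //; have [_] := FPK _ _ FK0 Kk0; exact.
  split.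
  - by exists k0, K0.
  - move=> a b c [A FA Aa] [B FB Bb] [C FC Cc].
    have [D [FD Da Db]] := join _ _ _ _ FA FB Aa Bb.
    have [G [FG Ga Gc]] := join _ _ _ _ FD FC Da Cc.
    case: (Ftot _ _ FD FG) => s.
      exists G => //; have [[_ G3 _ _] _] := FPK _ _ FG Ga.
      by apply: G3 => //; exact: s.
    exists D => //; have [[_ D3 _ _] _] := FPK _ _ FD Da.
    by apply: D3 => //; exact: s.
  - move=> a [A FA Aa]; exists A => //.
    by have [[_ _ AV _] _] := FPK _ _ FA Aa; exact: AV.
  - move=> a b [A FA Aa] [B FB Bb] [C FC Cab].
    have [D [FD Da Db]] := join _ _ _ _ FA FB Aa Bb.
    have [G [FG Ga Gab]] := join _ _ _ _ FD FC Da Cab.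
    case: (Ftot _ _ FD FG) => s.
      by have [[_ _ _ G2] _] := FPK _ _ FG Ga; apply: (G2 a b) => //; exact: s.
    by have [[_ _ _ D2] _] := FPK _ _ FD Da; apply: (D2 a b) => //; exact: s.
have [M0|[Mc KM]] := PM.
  have [[k Kk] _ _ _] := Kc; exfalso.
  apply: (Mmax K); last by right; split.
  by split; [rewrite M0|rewrite M0 => /(_ _ Kk)].
exists M => //; split=> // K' K'c MK'; apply: contrapT => K'M.
apply: (Mmax K'); last by right; split=> //; exact: subset_trans MK'.
by split=> // K'M'; apply: K'M; exact/seteqP.
Qed.

Section OneCogroup.
Variable K : set X.
Hypothesis Kc : cogroup K.

Let K3 : forall x y v, K x -> K y -> K v -> K (x * y * v).
Proof. by case: Kc. Qed.
Let KV : forall x, K x -> K x^-1.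
Proof. by case: Kc. Qed.
Let K2 : forall x y, K x -> K y -> ~ K (x * y).
Proof. by case: Kc. Qed.

Lemma cosquareP x k : K k -> cosquare K x <-> K (x * k).
Proof.
move=> Kk; split=> [[k' Kk' Kxk']|Kxk]; last by exists k.
by have := K3 Kxk' (KV Kk') Kk; rewrite mulgK.
Qed.

Lemma cosquarePl x k : K k -> cosquare K x <-> K (k * x).
Proof.
move=> Kk; rewrite (cosquareP _ (KV Kk)); split=> h.
  by have := K3 Kk h Kk; rewrite mulgA mulgVK.
by have := K3 (KV Kk) h (KV Kk); rewrite mulKg.
Qed.

Lemma cosquareM x y : cosquare K x -> cosquare K y -> cosquare K (x * y).
Proof.
move=> Ex [k Kk Kyk]; exists k => //.
by rewrite -mulgA; exact/(cosquareP _ Kyk).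
Qed.

Lemma cosquare1 : cosquare K 1.
Proof. by case: Kc => [[k Kk] _ _ _]; exists k; rewrite // mul1g. Qed.

Lemma cosquareV x : cosquare K x -> cosquare K x^-1.
Proof.
move=> [k Kk Kxk]; apply/(cosquarePl _ (KV Kk)); rewrite -invgM; exact: KV.
Qed.

Lemma cosquare_notin x : cosquare K x -> ~ K x.
Proof. by move=> [k Kk Kxk] Kx; exact: (K2 Kx Kk). Qed.

Lemma cogroupM_cosquare x y : K x -> K y -> cosquare K (x * y).
Proof. by move=> Kx Ky; apply/(cosquareP _ (KV Ky)); rewrite mulgK. Qed.

Lemma cosquareJ x e : stabilizer K x -> cosquare K e -> cosquare K (e ^ x).
Proof.
move=> xK [k Kk Kek]; exists (k ^ x); first by rewrite stabilizerJ.
by rewrite -conjMg stabilizerJ.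
Qed.

Lemma cogroup_stabilizer : K `<=` stabilizer K.
Proof.
move=> k Kk; apply/seteqP; split=> y; rewrite /conj_set /= conjgE => h.
  have := K3 (K3 (KV (KV Kk)) h (KV Kk)) Kk (KV Kk).
  by rewrite invgK !mulgA mulgV mul1g mulgK mulgK.
by rewrite mulgA; exact: K3 (KV Kk) h Kk.
Qed.

End OneCogroup.

(* Otherwise the powers of [x] would enlarge the cogroup. *)
Lemma max_cogroup_power K x : max_cogroup K -> stabilizer K x ->
  ~ cosquare K x ->
  exists n, K (x ^+ n).
Proof.
move=> [Kc Kmax] xK nEx; have [K0 K3 KV K2] := Kc; apply: contrapT => nK.
have nK' n : ~ K (x ^+ n) by move=> Kxn; apply: nK; exists n.
(* The cyclic group generated by [x], with integer powers written as quotients of natural ones. The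
   enlarged cogroup will be the product of [K] with it. *)
pose P := [set y | exists m n, y = x ^+ m * x ^- n].
have cmn m n : commute (x ^+ m) (x ^- n).
  by apply/commuteV/commute_sym/commuteX/commute_sym/commuteX.
have PM y v : P y -> P v -> P (y * v).
  move=> [m [n ->]] [m' [n' ->]]; exists (m + m')%N, (n' + n)%N.
  by rewrite !expgnDr invgM !mulgA; congr (_ * _); rewrite -!mulgA cmn.
have PV y : P y -> P y^-1.
  by move=> [m [n ->]]; exists n, m; rewrite invgM invgK.
have PN y : P y -> stabilizer K y.
  have Nx n : stabilizer K (x ^+ n).
    elim: n => [|n IHn]; first exact: stabilizer1.
    by rewrite expgS; exact: stabilizerM.
  by move=> [m [n ->]]; apply: stabilizerM => //; exact: stabilizerV.
have PnK y : P y -> ~ K y.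
  move=> [m [n ->]]; have [nm|/ltnW mn] := leqP n m; first by rewrite -expgnFr.
  by move/KV; rewrite invgM invgK -expgnFr //; exact: nK'.
pose K' := [set y | exists2 k, K k & P (k^-1 * y)].
(* Granted this, maximality gives [K' = K], so [k^-1 * x] lies in [K] and [x] in KK, against the
   assumption. *)
suff K'c : cogroup K'.
  have KK' : K `<=` K'.
    by move=> k Kk; exists k => //; exists 0%N, 0%N; rewrite !expg0 mulgV mulVg.
  apply: nEx; have [k Kk] := K0; exists k^-1; first exact: KV.
  have : K' (k^-1 * x) by exists k^-1; [exact: KV|exists 1%N, 0%N;
    rewrite mulKg invg1 mulg1].
  rewrite (Kmax _ K'c KK') => Kkx.
  by rewrite -(stabilizerJ _ xK) conjgE !mulgA mulVg mul1g.
have K'E y : K' y -> exists k p, [/\ K k, P p & y = k * p].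
  by move=> [k Kk Pp]; exists k, (k^-1 * y); rewrite mulVKg.
have K'I k p : K k -> P p -> K' (k * p) by move=> Kk Pp; exists k;
  rewrite ?mulKg.
have swap p k : P p -> K k -> exists2 k', K k' & p * k = k' * p.
  move=> Pp Kk; exists (k ^ p^-1); last by rewrite conjgE invgK mulgA mulgVK.
  by rewrite (stabilizerJ _ (stabilizerV (PN _ Pp))).
split.
- by have [k Kk] := K0; exists (k * 1); apply: K'I => //; exists 0%N, 0%N;
  rewrite invg1 mulg1.
- move=> _ _ _ /K'E[k1 [p1 [? ? ->]]] /K'E[k2 [p2 [? ? ->]]] /K'E[k3 [p3 [? ?
  ->]]].
  have [//|//|k2' K2' e2] := swap p1 k2.
  have [||k3' K3' e3] := swap (p1 * p2) k3; [exact: PM|by []|].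
  have -> : k1 * p1 * (k2 * p2) * (k3 * p3) = k1 * k2' * k3' * (p1 * p2 * p3).
    rewrite -!mulgA; congr (_ * _); rewrite mulgA e2 -!mulgA; congr (_ * _).
    by rewrite (mulgA p1 p2 (k3 * p3)) (mulgA _ k3) e3 -!mulgA.
  by apply: K'I; [exact: K3|apply: (PM) => //; exact: PM].
- move=> _ /K'E[k [p [Kk Pp ->]]]; rewrite invgM.
  have [k' Kk' ->] := swap _ _ (PV _ Pp) (KV _ Kk).
  by apply: K'I => //; exact: PV.
- move=> _ _ /K'E[k1 [p1 [Kk1 Pp1 ->]]] /K'E[k2 [p2 [Kk2 Pp2 ->]]].
  have [k2' K2' e2] := swap _ _ Pp1 Kk2.
  rewrite -mulgA (mulgA p1) e2 => /K'E[k3 [p3 [Kk3 Pp3 e3]]].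
  have Pq := PM _ _ (PM _ _ Pp1 Pp2) (PV _ Pp3).
  apply: (PnK _ Pq); have := K3 _ _ _ (KV _ K2') (KV _ Kk1) Kk3.
  suff -> : k2'^-1 * k1^-1 * k3 = p1 * p2 * p3^-1 by [].
  by apply: (mulIg p3); rewrite mulgVK -[LHS]mulgA -e3 -!mulgA !mulKg.
Qed.

(** In N(K)/KK the whole of [K] becomes one involution, and [max_cogroup_power] says that it is a
    power of every nontrivial element. *)
Lemma max_cogroup_presents (R : realType) K : max_cogroup K ->
  exists k : natinf, (leinf 1 k /\ exists t, @presents (C2 R k) K t) \/
            (leinf 3 k /\ exists t, @presents (Q2 R k) K t).
Proof.
move=> Kmax; have [Kc _] := Kmax; have [[k0 Kk0] _ KV _] := Kc.
have [Q [p [pM psurj pker]]] := quotient_group_exists (stabilizer1 K)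
  (@stabilizerM K) (@stabilizerV K) (cosquare1 Kc) (cosquareM Kc) (cosquareV Kc)
  (@cosquareJ K).
have NK := cogroup_stabilizer Kc.
have Nk0 := NK _ Kk0.
have p1 : p 1 = 1 by apply/pker; [exact: stabilizer1|exact: cosquare1].
have pX x n : stabilizer K x -> stabilizer K (x ^+ n) /\ p (x ^+ n) = p x ^+ n.
  move=> Nx; elim: n => [|n [IH1 IH2]]; first by split; [exact: stabilizer1|].
  by rewrite !expgS; split; [exact: stabilizerM|rewrite pM // IH2].
have pK k : K k -> p k = p k0.
  move=> Kk; have Nk := NK _ Kk.
  have h : p (k * k0^-1) = 1.
    apply/pker; first by apply: stabilizerM => //; exact: stabilizerV.
    by apply: cogroupM_cosquare => //; exact: KV.
  by rewrite -[k in LHS](mulgVK k0) pM ?h ?mul1g //; apply: stabilizerM => //;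
    exact: stabilizerV.
have z1 : p k0 <> 1 by move/(pker _ Nk0)/(cosquare_notin Kc).
have zz : p k0 * p k0 = 1.
  by rewrite -pM //; apply/pker; [exact: stabilizerM|exact: cogroupM_cosquare].
have zpow q : q <> 1 -> exists n, q ^+ n = p k0.
  have [x Nx <-] := psurj q => px.
  have [|n Kn] := max_cogroup_power Kmax Nx; first by move=> /(pker _ Nx).
  by exists n; have [_ <-] := pX x n Nx; exact: pK.
have comp (G : groupType) : isomorphic Q G -> exists t, @presents G K t.
  move=> [f [fI fS fM]]; exists (f \o p).
  have f1 : f 1 = 1 by apply: (mulgI (f 1)); rewrite -fM !mulg1.
  split=> [x y Nx Ny|g|x Nx] /=.
  - by rewrite pM.
  - by have [q <-] := fS g; have [x Nx <-] := psurj q; exists x.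
  - by rewrite -pker // -{1}f1; split=> [/fI|->].
have [k [[k1 /comp h]|[k3 /comp h]]] :=
  unique_involution_classification R z1 zz zpow.
  by exists k; left.
by exists k; right.
Qed.
End Cogroups.

(** * Self-maps of the power-set *)

Section Translation.
Variable X : groupType.
Implicit Types (A B K : set X) (x y k : X).

Lemma ltranslateE x A : ltranslate x A = [set y | A (x^-1 * y)].
Proof. by rewrite -[x in LHS]invgK ltranslateVE. Qed.

Lemma ltranslate1 A : ltranslate 1 A = A.
Proof. by rewrite ltranslateE; apply/funext => y /=; rewrite invg1 mul1g. Qed.

Lemma ltranslateM x y A : ltranslate (x * y) A = ltranslate x (ltranslate y A).
Proof. by rewrite !ltranslateE; apply/funext => v /=; rewrite invgM mulgA. Qed.

Lemma ltranslateK x A : ltranslate x^-1 (ltranslate x A) = A.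
Proof. by rewrite -ltranslateM mulVg ltranslate1. Qed.

Lemma ltranslateVK x A : ltranslate x (ltranslate x^-1 A) = A.
Proof. by rewrite -ltranslateM mulgV ltranslate1. Qed.

Lemma ltranslateC x A : ltranslate x (~` A) = ~` ltranslate x A.
Proof. by rewrite !ltranslateE. Qed.

Lemma ltranslateI x A B : ltranslate x (A `&` B) = ltranslate x A `&`
  ltranslate x B.
Proof. by rewrite !ltranslateE. Qed.

Lemma ltranslateD x A B : ltranslate x (A `\` B) = ltranslate x A `\`
  ltranslate x B.
Proof. by rewrite !ltranslateE. Qed.

Lemma ltranslateT x : ltranslate x setT = setT :> set X.
Proof. by rewrite ltranslateE. Qed.

Lemma ltranslate0 x : ltranslate x set0 = set0 :> set X.
Proof. by rewrite ltranslateE. Qed.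

Lemma ltranslate_sub x A B : A `<=` B -> ltranslate x A `<=` ltranslate x B.
Proof. by move=> AB; rewrite !ltranslateE => y; exact: AB. Qed.

Lemma setC_neq A : ~` A <> A.
Proof.
move=> eA; have nA : ~ A 1 by move=> A1; have := A1; rewrite -eA; exact.
by apply: (nA); rewrite -eA.
Qed.

Definition antifix A : set X := [set x | ltranslate x A = ~` A].

Lemma antifix_ltranslate x A :
  antifix (ltranslate x A) = conj_set x (antifix A).
Proof.
apply/seteqP; split=> y; rewrite /antifix /conj_set /= conjgE !ltranslateM => h.
  by rewrite h -ltranslateC ltranslateK.
by apply: (can_inj (ltranslateK x^-1)); rewrite h -ltranslateC ltranslateK.
Qed.

Lemma cogroup_antifix A : antifix A !=set0 -> cogroup (antifix A).
Proof.
move=> A0; split=> //; rewrite /antifix /=.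
- by move=> x y v hx hy hv;
  rewrite !ltranslateM hv !ltranslateC hy ltranslateC hx !setCK.
- by move=> x hx; rewrite -[LHS]setCK -ltranslateC -hx ltranslateK.
- by move=> x y hx hy; rewrite ltranslateM hy ltranslateC hx setCK =>
  /esym/setC_neq.
Qed.

Lemma cosquare_antifix A x :
  antifix A !=set0 -> cosquare (antifix A) x <-> ltranslate x A = A.
Proof.
move=> A0; have [k Ak] := A0; rewrite (cosquareP (cogroup_antifix A0) _ Ak).
rewrite /antifix /= ltranslateM Ak ltranslateC; split=> [/(congr1 setC)|->//].
by rewrite !setCK.
Qed.

(** [G] is the subgroup generated by [K]. A choice of [r y] in each right coset identifies the coset
    with [G]; the set is the part corresponding to KK, which left multiplication by [K] exchanges
    with the part corresponding to [K]. *)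
Lemma twin_set_exists K : cogroup K -> exists A, K `<=` antifix A.
Proof.
move=> Kc; have [_ K3 KV K2] := Kc.
pose G y := cosquare K y \/ K y.
have GV y : G y -> G y^-1 by case=> ?; [left; exact: cosquareV|right;
  exact: KV].
have KE k e : K k -> cosquare K e ->
  K (k * e) by move=> Kk /(cosquarePl Kc _ Kk).
have GK k y : K k -> G y -> G (k * y).
  by move=> Kk [Ey|Ky]; [right; exact: KE|left; exact: cogroupM_cosquare].
have GKr y k : G y -> K k -> G (y * k).
  by move=> Gy Kk; have := GV _ (GK _ _ (KV _ Kk) (GV _ Gy));
    rewrite invgM !invgK.
pose r y := xget 1 [set v | G (v * y^-1)].
have rP y : G (y * (r y)^-1).
  rewrite -[y in y * _]invgK -invgM; apply: GV.
  apply: (@xgetPex _ 1 [set v | G (v * y^-1)]); exists y => /=.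
  by rewrite mulgV; left; exact: cosquare1.
have rK k y : K k -> r (k^-1 * y) = r y.
  move=> Kk; congr (xget _ _); apply/seteqP; split=> v /=;
    rewrite invgM invgK mulgA.
    by move=> /GKr /(_ (KV _ Kk)); rewrite mulgK.
  by move/GKr; exact.
exists [set y | cosquare K (y * (r y)^-1)] => k Kk.
rewrite /antifix /= ltranslateE; apply/seteqP; split=> y /=; rewrite rK //.
  rewrite -mulgA => Ek Ey; apply: (cosquare_notin Kc Ek).
  exact: KE (KV _ Kk) Ey.
move=> nEy; have [//|Ky] := rP y; rewrite -mulgA.
by apply: cogroupM_cosquare => //; exact: KV.
Qed.
End Translation.

Section Representation.
Variable X : groupType.
Implicit Types (L M : superextension X) (A B : set X).

Definition selfmap L A : set X := [set x | val L (ltranslate x^-1 A)].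

Lemma selfmapM L M A : selfmap (L * M) A = selfmap L (selfmap M A).
Proof.
apply/funext => x; rewrite /selfmap /= /mls_comp /=; congr (val L _).
apply/funext => y; rewrite [in RHS]ltranslateVE /=.
by rewrite ltranslateV_ltranslate.
Qed.

Lemma selfmap_ltranslate L x A :
  selfmap L (ltranslate x A) = ltranslate x (selfmap L A).
Proof.
rewrite [RHS]ltranslateE; apply/funext => y; rewrite /selfmap /=.
by rewrite -ltranslateM invgM invgK.
Qed.

Lemma selfmap_sub L A B : A `<=` B -> selfmap L A `<=` selfmap L B.
Proof.
move=> AB x; have /maximal_linkedP[_ up _] := superextensionP L.
by apply: up; exact: ltranslate_sub.
Qed.

Lemma selfmapC L A : selfmap L (~` A) = ~` selfmap L A.
Proof.
have /maximal_linkedP[lin _ LC] := superextensionP L.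
apply/seteqP; split=> x; rewrite /selfmap /= ltranslateC.
  by move=> h1 h2; have [y []] := lin _ _ h1 h2.
by move=> h; case: (LC (ltranslate x^-1 A)).
Qed.

Lemma selfmap_val L A : val L A = selfmap L A 1.
Proof. by rewrite /selfmap /= invg1 ltranslate1. Qed.

Lemma selfmap_inj L M : (forall A, selfmap L A = selfmap M A) -> L = M.
Proof. by move=> LM; apply/val_inj/funext => A; rewrite !selfmap_val LM. Qed.

(** The system consists of the sets whose image contains 1. It is linked because for disjoint A and
    B the image of A avoids that of B, and symmetry makes it maximal. *)
Lemma selfmap_surj (g : set X -> set X) :
  (forall x A, g (ltranslate x A) = ltranslate x (g A)) ->
  (forall A B, A `<=` B -> g A `<=` g B) ->
  (forall A, g (~` A) = ~` g A) ->
  exists L, forall A, selfmap L A = g A.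
Proof.
move=> gT gS gC.
have ml : maximal_linked [set A | g A 1].
  apply/maximal_linkedP; split=> /= [A B gA gB|A B AB|A].
  - apply: contrapT => AB0; have : g (~` B) 1.
      by apply: gS gA => x Ax Bx; apply: AB0; exists x.
    by rewrite gC.
  - exact: gS.
  - by rewrite gC; have [] := pselect (g A 1); [left|right].
exists (SigSub (mem_set ml)) => A; apply/funext => x.
by rewrite /selfmap /= gT ltranslateE /= invgK mulg1.
Qed.

Lemma selfmap0T L : selfmap L set0 = set0 /\ selfmap L setT = setT.
Proof.
have h0 : selfmap L set0 = set0.
  apply/seteqP; split=> // x h; have := selfmap_sub (@sub0set _ setT) h.
  rewrite -setC0 selfmapC; exact.
by split=> //; rewrite -setC0 selfmapC h0.
Qed.

Lemma antifix_selfmap L A : antifix A `<=` antifix (selfmap L A).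
Proof. by move=> x; rewrite /antifix /= => h;
  rewrite -selfmap_ltranslate h selfmapC. Qed.

Lemma antifix_selfmap_max L A : max_cogroup (antifix A) ->
  antifix (selfmap L A) = antifix A.
Proof.
move=> [Kc Kmax]; apply: Kmax; last exact: antifix_selfmap.
by apply: cogroup_antifix; have [[k Ak] _ _ _] := Kc; exists k;
  exact: antifix_selfmap.
Qed.
End Representation.

(** * Extension of prescribed values *)

Section Ideal.
Variables (X : groupType) (I : set (set X)).
Hypotheses (II : is_ideal_of_sets I) (IT : left_invariant I).
Implicit Types (A B C : set X) (x y : X) (M : set (set X)).

Let IS A B : B `<=` A -> I A -> I B.
Proof. by have [_ _ h _] := II; exact: h. Qed.
Let IU A B : I A -> I B -> I (A `|` B).
Proof. by have [_ h _ _] := II; exact: h. Qed.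
Let InT : ~ I setT. Proof. by case: II. Qed.
Let I0 : I set0.
Proof. by case: II => [[A IA] _ IS' _]; apply: IS' IA; exact: sub0set. Qed.

Lemma eq_mod_refl A : eq_mod I A A.
Proof. by split; rewrite /subset_mod setDv. Qed.

Lemma eq_mod_sym A B : eq_mod I A B -> eq_mod I B A.
Proof. by case. Qed.

Lemma subset_mod_trans B A C : subset_mod I A B -> subset_mod I B C ->
  subset_mod I A C.
Proof.
move=> AB BC; apply: IS (IU AB BC) => x [Ax nCx].
by have [Bx|nBx] := pselect (B x); [right|left].
Qed.

Lemma eq_mod_trans B A C : eq_mod I A B -> eq_mod I B C -> eq_mod I A C.
Proof.
by move=> [AB BA] [BC CB]; split;
  [exact: subset_mod_trans AB BC|exact: subset_mod_trans CB BA].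
Qed.

Lemma subset_mod_sub A B : A `<=` B -> subset_mod I A B.
Proof. by move=> AB; apply: IS I0 => x [/AB]. Qed.

Lemma subset_modC A B : subset_mod I A B -> subset_mod I (~` B) (~` A).
Proof. by apply: IS => x [nBx /contrapT Ax]. Qed.

Lemma eq_modC A B : eq_mod I A B -> eq_mod I (~` A) (~` B).
Proof. by move=> [AB BA]; split; exact: subset_modC. Qed.

Lemma subset_mod_ltranslate x A B :
  subset_mod I A B -> subset_mod I (ltranslate x A) (ltranslate x B).
Proof. by rewrite /subset_mod -ltranslateD; exact: IT. Qed.

Lemma eq_mod_ltranslate x A B :
  eq_mod I A B -> eq_mod I (ltranslate x A) (ltranslate x B).
Proof. by move=> [AB BA]; split; exact: subset_mod_ltranslate. Qed.

Lemma eq_mod_ltranslateV x A B :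
  eq_mod I (ltranslate x A) B -> eq_mod I (ltranslate x^-1 B) A.
Proof. by move=> /(eq_mod_ltranslate x^-1);
  rewrite ltranslateK => /eq_mod_sym. Qed.

Lemma not_eq_modC A : ~ eq_mod I A (~` A).
Proof.
move=> [h1 h2]; apply: InT; apply: IS (IU h1 h2) => x _ /=.
by have [Ax|nAx] := pselect (A x); [left; split=> //; apply|right].
Qed.

Definition antifix_mod A : set X := [set x | eq_mod I (ltranslate x A) (~` A)].

Lemma antifix_sub_mod A : antifix A `<=` antifix_mod A.
Proof. by move=> x; rewrite /antifix /antifix_mod /= => ->;
  exact: eq_mod_refl. Qed.

Lemma antifix_mod_ltranslate x A :
  antifix_mod (ltranslate x A) = conj_set x (antifix_mod A).
Proof.
apply/seteqP; split=> y; rewrite /antifix_mod /conj_set /= conjgE !ltranslateM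
  => h.
  by have := eq_mod_ltranslate x^-1 h; rewrite ltranslateC ltranslateK.
by have := eq_mod_ltranslate x h; rewrite ltranslateC ltranslateVK.
Qed.

Lemma antifix_mod_eq A B : eq_mod I A B -> antifix_mod A = antifix_mod B.
Proof.
suff h A' B' : eq_mod I A' B' -> antifix_mod A' `<=` antifix_mod B'.
  by move=> AB; apply/seteqP; split; apply: h => //; exact: eq_mod_sym.
move=> AB x hx; apply: (eq_mod_trans (eq_mod_ltranslate x (eq_mod_sym AB))).
exact: eq_mod_trans hx (eq_modC AB).
Qed.

Lemma cogroup_antifix_mod A : antifix_mod A !=set0 -> cogroup (antifix_mod A).
Proof.
move=> A0; split=> //; rewrite /antifix_mod /=.
- move=> x y v hx hy hv; rewrite !ltranslateM.
  have h1 := eq_mod_ltranslate (x * y) hv;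
    rewrite ltranslateC ltranslateM in h1.
  have h2 := eq_modC (eq_mod_ltranslate x hy); rewrite ltranslateC setCK in h2.
  by rewrite ltranslateM in h1; exact: eq_mod_trans h1 (eq_mod_trans h2 hx).
- by move=> x /eq_modC; rewrite setCK -ltranslateC => /eq_mod_ltranslateV.
- move=> x y hx hy; rewrite ltranslateM => hxy.
  have h := eq_mod_ltranslate x hy; rewrite ltranslateC in h.
  have := eq_mod_trans (eq_mod_sym h) hxy.
  move=> /eq_modC; rewrite !setCK => hxA.
  exact: not_eq_modC (eq_mod_trans (eq_mod_sym hxA) hx).
Qed.

Definition invariant_linked M :=
  (forall A x, M A -> M (ltranslate x A)) /\
  forall A B, M A -> M B -> ~ I (A `&` B).

Definition maximal_invariant_linked M :=
  invariant_linked M /\ forall M', invariant_linked M' -> M `<=` M' -> M' = M.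

Lemma maximal_invariant_linked_exists : exists M, maximal_invariant_linked M.
Proof.
have [F FP Ftot|M [PM Mmax]] := @Zorn_bigcup (set X) invariant_linked.
  split=> [A x [M FM MA]|A B [M1 F1 MA] [M2 F2 MB]].
    by exists M => //; have [+ _] := FP _ FM; exact.
  have [s|s] := Ftot _ _ F1 F2.
    by have [_] := FP _ F2; apply=> //; exact: s.
  by have [_] := FP _ F1; apply=> //; exact: s.
exists M; split=> // M' M'P MM'; apply: contrapT => ne.
by apply: (Mmax M') => //; split=> // M'M; apply: ne; exact/seteqP.
Qed.

Section MaximalInvariantLinked.
Variable M : set (set X).
Hypothesis Mmax : maximal_invariant_linked M.

Let MT A x : M A -> M (ltranslate x A).
Proof. by case: Mmax => [[+ _] _]; exact. Qed.
Let ML A B : M A -> M B -> ~ I (A `&` B).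
Proof. by case: Mmax => [[_ +] _]; exact. Qed.

(** All translates of [B] are added to [M]; by invariance of [M] and [I], the hypotheses cover every
    new pair. *)
Lemma maximal_invariant_linked_mem B : (forall x, ~ I (ltranslate x B `&` B)) ->
  (forall C, M C -> ~ I (B `&` C)) -> M B.
Proof.
move=> BB BC; have [_ Mx] := Mmax.
rewrite -(Mx (M `|` [set C | exists x, C = ltranslate x B])).
- by right; exists 1; rewrite ltranslate1.
- split=> [A x [MA|[y ->]]|A C]; first by left; exact: MT.
    by right; exists (x * y); rewrite ltranslateM.
  have h x C' : M C' -> ~ I (ltranslate x B `&` C').
    move=> MC' /(IT x^-1); rewrite ltranslateI ltranslateK.
    by apply: BC; exact: MT.
  move=> [MA|[x ->]] [MC|[y ->]].
  - exact: ML.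
  - by rewrite setIC; exact: h.
  - exact: h.
  - move=> /(IT y^-1); rewrite ltranslateI ltranslateK -ltranslateM.
    exact: BB.
- by move=> C MC; left.
Qed.

Lemma maximal_invariant_linked_up A B : M A -> subset_mod I A B -> M B.
Proof.
move=> MA AB; apply: maximal_invariant_linked_mem => [x|C MC] h.
  apply: (ML (MT x MA) MA); apply: IS (IU h (IU AB (IT x AB))) => y [xAy Ay] /=.
  have [By|nBy] := pselect (B y); last by right; left.
  have [xBy|nxBy] := pselect (ltranslate x B y); first by left.
  by right; right; rewrite ltranslateD.
apply: (ML MA MC); apply: IS (IU h AB) => y [Ay Cy] /=.
by have [By|nBy] := pselect (B y); [left|right].
Qed.

Lemma maximal_invariant_linked_or A :
  (forall x, ~ I (ltranslate x A `&` A)) -> M A \/ M (~` A).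
Proof.
move=> AA; have [[C MC AC]|nC] := pselect (exists2 C, M C & I (A `&` C)).
  right; apply: (maximal_invariant_linked_up MC); apply: IS AC => x [Cx].
  by move=> /contrapT.
by left; apply: maximal_invariant_linked_mem => // C MC AC; apply: nC; exists C.
Qed.

Lemma maximal_invariant_linked_C A : M A -> ~ M (~` A).
Proof. by move=> MA /(ML MA); rewrite setICr. Qed.

Lemma maximal_invariant_linked_antifix A x : M A -> ~ antifix_mod A x.
Proof.
move=> MA [h _]; apply: (ML (MT x MA) MA); apply: IS h => y [? ?]; split=> //.
Qed.

Hypothesis tw : forall A x y, subset_mod I (ltranslate x A) (~` A) ->
    subset_mod I (~` A) (ltranslate y A) ->
    eq_mod I (ltranslate x A) (ltranslate y A).

(** If [A] or its complement meets all its own translates outside [I], maximality decides. Otherwise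
    some xA lies in the complement of [A], and this complement in some yA, modulo [I]; twinicity
    turns the inclusions into equalities. *)
Lemma maximal_invariant_linked_trichotomy A :
  [\/ M A, M (~` A) | antifix_mod A !=set0].
Proof.
have [[x hx]|nx] := pselect (exists x, I (ltranslate x A `&` A)); last first.
  have [|MA|MA] := @maximal_invariant_linked_or A; last 2 first.
  - by apply: Or31.
  - by apply: Or32.
  by move=> x hx; apply: nx; exists x.
have [[y hy]|ny] := pselect (exists y, I (ltranslate y (~` A) `&` ~` A));
  last first.
  have [|MA|MA] := @maximal_invariant_linked_or (~` A); last 2 first.
  - by apply: Or32.
  - by apply: Or31; rewrite setCK in MA.
  by move=> y hy; apply: ny; exists y.
have xA : subset_mod I (ltranslate x A) (~` A) by apply: IS hx => v [?
  /contrapT].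
have yA : subset_mod I (~` A) (ltranslate y A).
  by apply: IS hy => v [? ?]; rewrite ltranslateC.
apply: Or33; exists x; split=> //.
by have [_ yx] := tw xA yA; exact: subset_mod_trans yA yx.
Qed.

(** Modulo [I], yA lies in yB = ~B, which lies in ~A = xA. Twinicity gives xA = yA, so the chain
    collapses and ~A = ~B. *)
Lemma eq_mod_of_sub A B : A `<=` B -> antifix_mod A !=set0 ->
  antifix_mod B !=set0 -> eq_mod I A B.
Proof.
move=> AB [x [xA1 xA2]] [y [yB1 yB2]].
have yA : subset_mod I (ltranslate y A) (~` A).
  apply: (subset_mod_trans (subset_mod_ltranslate y (subset_mod_sub AB))).
  by apply: subset_mod_trans yB1 _; apply: subset_mod_sub; exact: subsetC.
have [_ xy] := tw yA xA2.
split; first exact: subset_mod_sub.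
rewrite -[A]setCK -[B]setCK; apply: subset_modC.
apply: (subset_mod_trans xA2); apply: (subset_mod_trans xy).
by apply: subset_mod_trans yB1; apply/subset_mod_ltranslate/subset_mod_sub.
Qed.
End MaximalInvariantLinked.
End Ideal.

Section Extension.
Variable X : groupType.
Implicit Types (A B D K : set X) (x y : X).

Definition representatives (J : set (set X)) :=
  [/\ forall K, J K -> max_cogroup K,
      forall K x, J K -> J (conj_set x K) -> conj_set x K = K &
      forall K, max_cogroup K -> exists x, J (conj_set x K)].

Definition system (J : set (set X)) (b : set X -> set X) :=
  forall K, J K -> antifix (b K) = K.

Definition adapted (J : set (set X)) (b : set X ->
  set X) (e : superextension X) :=
  [/\ system J b, forall K, J K -> selfmap e (b K) = b K &
      forall A, [\/ selfmap e A = set0, selfmap e A = setT |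
                 exists K x, J K /\ selfmap e A = ltranslate x (b K)]].

(** Members of [M] go to X, their complements to the empty set, and a twin set goes to the translate
    of a value chosen at the representative of its class. The list of possible values in the
    conclusion is what later yields idempotents. *)
Lemma selfmap_extension (J : set (set X)) (b c : set X ->
  set X) : twinic X -> representatives J ->
  system J b -> system J c ->
  exists L : superextension X, (forall K, J K -> selfmap L (b K) = c K) /\
    forall A, [\/ selfmap L A = set0, selfmap L A = setT |
               exists K x, J K /\ selfmap L A = ltranslate x (c K)].
Proof.
move=> [I [II IT tw]] [Jmax Jconj Jrep] Jb Jc.
have [M Mmax] := maximal_invariant_linked_exists I.
have [refl trans] := (eq_mod_refl II, @eq_mod_trans _ _ II).
have tr := @eq_mod_ltranslate _ _ IT.
have trV := @eq_mod_ltranslateV _ _ IT.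
(* [D] is an admissible value for [A]: the first clause makes it respect the twin relations of [A]
   modulo [I], the last imposes the prescribed values. *)
pose good A D := [/\ antifix_mod I A `<=` antifix D,
   exists K x, J K /\ D = ltranslate x (c K) &
   forall K y, J K -> eq_mod I (ltranslate y (b K)) A ->
     D = ltranslate y (c K)].
(* Working modulo [I] can only enlarge the cogroup of [b K], which maximality forbids. *)
have Jmod K : J K -> antifix_mod I (b K) = K.
  move=> JK; have [Kc Kmax] := Jmax _ JK; apply: Kmax; last first.
    by rewrite -{1}(Jb _ JK); exact: antifix_sub_mod.
  apply: cogroup_antifix_mod => //; have [[k Kk] _ _ _] := Kc; exists k.
  by apply: antifix_sub_mod => //; rewrite (Jb _ JK).
have J0 K : J K -> K !=set0 by move=> /Jmax[[]].
have good_ex A : antifix_mod I A !=set0 -> exists D, good A D.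
  move=> A0; have [[K [y0 [JK y0A]]]|nK] :=
    pselect (exists K y, J K /\ eq_mod I (ltranslate y (b K)) A); last first.
    (* No value is prescribed here: enlarge the cogroup of [A] to a maximal one, conjugate it into
       [J], and translate back. *)
    have [N Nmax AN] := max_cogroup_exists (cogroup_antifix_mod II IT A0).
    have [x JxN] := Jrep _ Nmax; exists (ltranslate x^-1 (c (conj_set x N)));
      split.
    - by rewrite antifix_ltranslate (Jc _ JxN) conj_setVK.
    - by exists (conj_set x N), x^-1.
    - by move=> K y JK yA; case: nK; exists K, y.
  have AK : antifix_mod I A = conj_set y0 K.
    by rewrite -(antifix_mod_eq II IT y0A) antifix_mod_ltranslate // Jmod.
  exists (ltranslate y0 (c K)); split.
  - by rewrite AK antifix_ltranslate (Jc _ JK).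
  - by exists K, y0.
  (* Two prescriptions agree: [K'] and [K] are conjugate in [J], hence equal, and [y0^-1 * y] fixes
     [b K] modulo [I], so it lies in KK and fixes [c K]. *)
  - move=> K' y JK' yA.
    have AK' : antifix_mod I A = conj_set y K'.
      by rewrite -(antifix_mod_eq II IT yA) antifix_mod_ltranslate // Jmod.
    have KK' : conj_set (y0^-1 * y) K' = K by rewrite conj_setM -AK' AK
      conj_setVK.
    have K'K : K' = K by rewrite -KK' Jconj // KK'.
    rewrite K'K in yA; rewrite K'K.
    apply: (can_inj (ltranslateK y0^-1)); rewrite ltranslateK -ltranslateM.
    have c0 : antifix (c K) !=set0 by rewrite (Jc _ JK); exact: J0.
    apply/esym/(cosquare_antifix _ c0); rewrite (Jc _ JK).
    have [k Kk] := J0 _ JK; exists k => //.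
    rewrite -{1}(Jmod _ JK) /antifix_mod /= ltranslateM.
    move: (Kk); rewrite -{1}(Jb _ JK) /antifix /= => ->.
    rewrite ltranslateC; apply: eq_modC => //.
    have := tr y0^-1 _ _ (trans _ _ _ yA (eq_mod_sym y0A)).
    by rewrite ltranslateK ltranslateM.
pose cls A := [set B | exists x, eq_mod I (ltranslate x A) B].
pose rep A := xget set0 (cls A).
have repP A : exists x, eq_mod I (ltranslate x (rep A)) A.
  have : cls A (rep A).
    by apply: xgetPex; exists A, 1; rewrite ltranslate1.
  by move=> [x /trV xA]; exists x^-1.
have rep_eq A B x : eq_mod I (ltranslate x A) B -> rep A = rep B.
  move=> xAB; congr (xget _ _); apply/seteqP; split=> C [y yC].
    exists (y * x^-1); rewrite ltranslateM.
    exact: trans (tr _ _ _ (trV _ _ _ xAB)) yC.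
  exists (y * x); rewrite ltranslateM.
  exact: trans (tr _ _ _ xAB) yC.
pose psi A := xget set0 [set D | good (rep A) D].
have rep0 A : antifix_mod I A !=set0 -> antifix_mod I (rep A) !=set0.
  have [x /(antifix_mod_eq II IT)] := repP A.
  rewrite antifix_mod_ltranslate // => <- [y hy]; exists (y ^ x).
  exact: hy.
have psiP A : antifix_mod I A !=set0 -> good (rep A) (psi A).
  move=> /rep0/good_ex [D gD];
    exact: (@xgetPex _ set0 [set D | good (rep A) D] (ex_intro _ D gD)).
pose f A := xget set0 [set D | exists x,
  eq_mod I (ltranslate x (rep A)) A /\ D = ltranslate x (psi A)].
have fE A x : antifix_mod I A !=set0 -> eq_mod I (ltranslate x (rep A)) A ->
  f A = ltranslate x (psi A).
  move=> A0 xA; have : exists D y, eq_mod I (ltranslate y (rep A)) A /\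
    D = ltranslate y (psi A).
    by exists (ltranslate x (psi A)), x.
  move=> /(xgetPex set0); rewrite -/(f A) => -[y [yA ->]].
  (* Two translations of the representative onto [A] differ by an element fixing it modulo [I].
     Multiplied by [k], this element still sends the representative to its complement, so it fixes
     [psi A]. *)
  have [gA _ _] := psiP _ A0; have [k kA] := rep0 _ A0.
  have hk : antifix (psi A) k by exact: gA.
  apply: (can_inj (ltranslateK x^-1)); rewrite ltranslateK -ltranslateM.
  have p0 : antifix (psi A) !=set0 by exists k.
  apply/(cosquare_antifix _ p0); exists k => //; apply: gA.
  rewrite /antifix_mod /= ltranslateM.
  apply: (trans _ _ _ (tr (x^-1 * y) _ _ kA)).
  rewrite ltranslateC; apply: eq_modC => //.
  have := tr x^-1 _ _ (trans _ _ _ yA (eq_mod_sym xA)).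
  by rewrite ltranslateK ltranslateM.
pose g A := if pselect (M A) then setT else if pselect (M (~` A)) then set0
  else f A.
have MT A x : M A -> M (ltranslate x A) by case: (Mmax) => [[+ _] _]; exact.
have gM A : M A -> g A = setT by rewrite /g; case: pselect.
have gMC A : M (~` A) -> g A = set0.
  move=> MA; rewrite /g; case: pselect => [/(maximal_invariant_linked_C II
    Mmax)//|?].
  by case: pselect.
have gf A : antifix_mod I A !=set0 -> g A = f A.
  move=> [x Ax]; rewrite /g; case: pselect =>
    [/(maximal_invariant_linked_antifix II Mmax)/(_ Ax)//|?].
  case: pselect => // MC; case: (@maximal_invariant_linked_antifix _ _ II _
    Mmax _ x MC).
  by rewrite /antifix_mod /= ltranslateC; exact: eq_modC.
have tri := maximal_invariant_linked_trichotomy II IT Mmax tw.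
have T0 A x : antifix_mod I A !=set0 -> antifix_mod I (ltranslate x A) !=set0.
  by move=> [y Ay]; rewrite antifix_mod_ltranslate //; exists (y ^ x^-1);
    rewrite /conj_set /= conjgKV.
have C0 A : antifix_mod I A !=set0 -> antifix_mod I (~` A) !=set0.
  by move=> [y Ay]; exists y; rewrite /antifix_mod /= ltranslateC;
    exact: eq_modC.
have [L LE] : exists L, forall A, selfmap L A = g A.
  apply: selfmap_surj.
  - move=> x A; case: (tri A) => [MA|MA|A0].
    + by rewrite !gM ?ltranslateT //; exact: MT.
    + by rewrite !gMC ?ltranslate0 // -ltranslateC; exact: MT.
    + have [y yA] := repP A.
      have rE : rep (ltranslate x A) = rep A by apply/esym/(rep_eq _ _ x).
      rewrite !gf //; last exact: T0.
      rewrite (fE A y) // (fE (ltranslate x A) (x * y)); last 2 first.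
      * exact: T0.
      * by rewrite rE ltranslateM; exact: tr.
      by rewrite ltranslateM /psi rE.
  (* The substantial case of monotonicity is that of two twin sets: they are equal modulo [I], hence
     have the same value. *)
  - move=> A B AB; case: (tri B) => [MB|MB|B0].
    + by rewrite [g B]gM.
    + rewrite (gMC A) //; apply: (maximal_invariant_linked_up II IT Mmax MB).
      by apply: subset_mod_sub => //; exact: subsetC.
    + case: (tri A) => [MA|MA|A0].
      * rewrite [g B]gM //; apply: (maximal_invariant_linked_up II IT Mmax MA).
        exact: subset_mod_sub.
      * by rewrite (gMC A).
      * have ABm := eq_mod_of_sub II IT tw AB A0 B0.
        have [y yA] := repP A.
        have rE : rep A = rep B by apply: (rep_eq _ _ 1); rewrite ltranslate1.
        rewrite !gf // (fE A y) // (fE B y) //; first by rewrite /psi rE.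
        by rewrite -rE; exact: trans yA ABm.
  - move=> A; case: (tri A) => [MA|MA|A0].
    + by rewrite (gM A) // setCT gMC // setCK.
    + by rewrite (gMC A) // setC0 gM.
    + have [y yA] := repP A; have [x xA] := A0.
      have rE : rep A = rep (~` A) by exact: (rep_eq _ _ x).
      rewrite !gf //; last exact: C0.
      rewrite (fE A y) // (fE (~` A) (x * y)); last 2 first.
      * exact: C0.
      * by rewrite -rE ltranslateM; exact: trans (tr x _ _ yA) xA.
      rewrite /psi -rE -/(psi A).
      (* Seen from the representative, moving [A] to its complement by [x] is the action of
         [y^-1 * (x * y)], which must therefore send [psi A] to its complement. *)
      have [gA _ _] := psiP _ A0.
      have : antifix (psi A) (y^-1 * (x * y)).
        apply: gA; rewrite /antifix_mod /= !ltranslateM.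
        apply: (trans _ _ _ (tr y^-1 _ _ (trans _ _ _ (tr x _ _ yA) xA))).
        rewrite ltranslateC; apply: eq_modC => //; exact: trV.
      rewrite /antifix /= => /(congr1 (ltranslate y)).
      by rewrite -ltranslateM mulVKg ltranslateC.
exists L; split=> [K JK|A]; rewrite LE.
  have K0 : antifix_mod I (b K) !=set0 by rewrite Jmod //; exact: J0.
  have [y yK] := repP (b K).
  have [_ _ /(_ K y^-1 JK)] := psiP _ K0.
  rewrite gf // (fE _ _ K0 yK) => ->; first by rewrite ltranslateVK.
  exact: trV.
case: (tri A) => [MA|MA|A0].
- by apply: Or32; exact: gM.
- by apply: Or31; exact: gMC.
- apply: Or33; have [y yA] := repP A; rewrite gf // (fE _ _ A0 yA).
  have [_ [K [x [JK ->]]] _] := psiP _ A0.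
  by exists K, (y * x); rewrite ltranslateM.
Qed.
End Extension.

(** * Idempotents and their corners *)

(** One element is chosen in each conjugacy class. The last clause serves the abelian case, where
    each class is a single cogroup. *)
Lemma representatives_exist (X : groupType) : exists J : set (set X),
  representatives J /\
  ((forall x y : X, commute x y) -> forall K, max_cogroup K -> J K).
Proof.
pose orb K : set (set X) := [set K' | exists x, K' = conj_set x K].
pose can K := xget set0 (orb K).
have canP K : exists x, can K = conj_set x K.
  by apply: (@xgetPex _ set0 (orb K)); exists K, 1; rewrite conj_set1.
have canJ x K : can (conj_set x K) = can K.
  congr (xget _ _); apply/seteqP; split=> K' [y ->].
    by exists (y * x); rewrite conj_setM.
  by exists (y * x^-1); rewrite conj_setM conj_setVK.
exists [set K | max_cogroup K /\ can K = K]; split; [split|].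
- by move=> K [].
- by move=> K x [_ cK] [_]; rewrite canJ cK.
- move=> K Km; have [x xK] := canP K; exists x; split;
  first exact: max_cogroup_conj.
  by rewrite canJ.
- move=> Xab K Km; split=> //; have [x ->] := canP K.
  by apply/funext => y; rewrite /conj_set /= conjgE Xab -mulgA mulgV mulg1.
Qed.

Lemma system_exists (X : groupType) (J : set (set X)) :
  (forall K, J K -> max_cogroup K) -> exists b, system J b.
Proof.
move=> Jmax; have ex K : exists A, J K -> antifix A = K.
  have [JK|nJK] := pselect (J K); last by exists set0.
  have [Kc Kmax] := Jmax _ JK; have [A KA] := twin_set_exists Kc.
  exists A => _; apply: Kmax => //; apply: cogroup_antifix.
  by have [[k Kk] _ _ _] := Kc; exists k; exact: KA.
by exists (fun K => sval (cid (ex K))) => K; exact: (svalP (cid (ex K))).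
Qed.

Section Adapted.
Variables (X : groupType) (J : set (set X)).
Hypotheses (Xtw : twinic X) (JP : representatives J).
Implicit Types (e f g L : superextension X) (b c : set X ->
  set X) (K A : set X).

Let Jmax K : J K -> max_cogroup K. Proof. by case: JP => h _ _; exact: h. Qed.
Let J0 K : J K -> K !=set0. Proof. by move=> /Jmax[[]]. Qed.

Lemma antifix0 : antifix set0 = set0 :> set X.
Proof.
apply/seteqP; split=> // x; rewrite /antifix /= ltranslate0 setC0 => h.
by have : [set: X] x by []; rewrite -h.
Qed.

Lemma antifixT : antifix setT = set0 :> set X.
Proof.
apply/seteqP; split=> // x; rewrite /antifix /= ltranslateT setCT => h.
by have : [set: X] x by []; rewrite h.
Qed.

Lemma adapted_fix b e A : adapted J b e ->
  selfmap e (selfmap e A) = selfmap e A.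
Proof.
move=> [Jb eb eA]; have [e0 eT] := selfmap0T e.
case: (eA A) => [->|->|[K [x [JK ->]]]] //.
by rewrite selfmap_ltranslate eb.
Qed.

Lemma adapted_idem b e : adapted J b e -> e * e = e.
Proof. by move=> eb; apply: selfmap_inj => A;
  rewrite selfmapM (adapted_fix A eb). Qed.

(** By maximality the image keeps the cogroup [K], which excludes the empty set and X; comparing
    cogroups then identifies the translated set as [b K] and puts [x] in N(K). *)
Lemma adapted_value b e A K : adapted J b e -> J K -> antifix A = K ->
  exists2 x, stabilizer K x & selfmap e A = ltranslate x (b K).
Proof.
move=> [Jb eb eA] JK AK.
have eAK : antifix (selfmap e A) = K by rewrite antifix_selfmap_max AK //;
  exact: Jmax.
case: (eA A) => [e0|eT|[K' [x [JK' xE]]]].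
- by have [k] := J0 JK; rewrite -eAK e0 antifix0.
- by have [k] := J0 JK; rewrite -eAK eT antifixT.
have xK' : conj_set x K' = K by rewrite -eAK xE antifix_ltranslate (Jb _ JK').
have K'K : K' = K by case: JP => _ h _; rewrite -xK' h // xK'.
by exists x; [rewrite /stabilizer /= -{2}xK' K'K|rewrite xE K'K].
Qed.

Lemma system_selfmap b f : system J b -> system J (fun K => selfmap f (b K)).
Proof. by move=> Jb K JK; rewrite antifix_selfmap_max Jb //; exact: Jmax. Qed.

(** For [s] in the ideal the images of the [b K] under [s] form a system again. A map [g] sending
    them back makes [g * s] an adapted idempotent of the ideal, which by minimality generates it. *)
Lemma minimal_left_ideal_adapted (I : set (superextension X)) :
  minimal_left_ideal I ->
  exists b e, [/\ adapted J b e, I e & I = [set f | f * e = f]].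
Proof.
move=> [[[s Is] Iid] Imin].
have [b Jb] := system_exists Jmax.
have [g [gs gA]] := selfmap_extension Xtw JP (system_selfmap s Jb) Jb.
have gsb : adapted J b (g * s).
  split=> // [K JK|A]; rewrite selfmapM; [exact: gs|exact: gA].
have ee := adapted_idem gsb.
exists b, (g * s); split=> //; first exact: Iid.
apply/esym/Imin => [|f /= <-]; last by apply/Iid/Iid.
split=> [|t f /= fe]; first by exists (g * s).
by rewrite -mulgA fe.
Qed.

(** The minimal ideal lies in the ideal generated by an adapted [g], so e = u g v takes its values
    among the translates of the sets [c K]; idempotency forces [e] to fix each [c K]. *)
Lemma minimal_ideal_adapted e : minimal_ideal (superextension X) e ->
  e * e = e ->
  exists b, adapted J b e.
Proof.
move=> emin ee.
have [b Jb] := system_exists Jmax.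
have [g [gb gA]] := selfmap_extension Xtw JP Jb Jb.
have [u [v eE]] : exists u v, e = u * g * v.
  apply: (emin [set f | exists u v, f = u * g * v]); split=> //.
  split=> [|s _ [u [v ->]]]; first by exists (g * g * g), g, g.
  by split; [exists (s * u), v|exists u, (v * s)]; rewrite !mulgA.
pose c K := selfmap u (b K).
have Jc : system J c by exact: system_selfmap.
have [u0 uT] := selfmap0T u.
have eA A : [\/ selfmap e A = set0, selfmap e A = setT |
                 exists K x, J K /\ selfmap e A = ltranslate x (c K)].
  rewrite eE !selfmapM; case: (gA (selfmap v A)) => [->|->|[K [x [JK ->]]]].
  - exact: Or31.
  - exact: Or32.
  - by apply: Or33; exists K, x; rewrite selfmap_ltranslate.
exists c; split=> // K JK.
have eee A : selfmap e (selfmap e A) = selfmap e A by rewrite -selfmapM ee.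
have cK := Jc _ JK.
have eAK : antifix (selfmap e (c K)) = K by rewrite antifix_selfmap_max cK //;
  exact: Jmax.
case: (eA (c K)) => [e0|eT|[K' [x [JK' xE]]]].
- by have [k] := J0 JK; rewrite -eAK e0 antifix0.
- by have [k] := J0 JK; rewrite -eAK eT antifixT.
have xK' : conj_set x K' = K by rewrite -eAK xE antifix_ltranslate (Jc _ JK').
have K'K : K' = K by case: JP => _ h _; rewrite -xK' h // xK'.
have h := eee (c K); rewrite xE K'K selfmap_ltranslate in h.
exact: (can_inj (ltranslateK x)) h.
Qed.

Section Corner.
Variables (b : set X -> set X) (e : superextension X).
Hypothesis eb : adapted J b e.

Let Jb : system J b. Proof. by case: eb. Qed.
Let ebE K : J K -> selfmap e (b K) = b K. Proof. by case: eb => _ h _;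
  exact: h. Qed.
Let ee : e * e = e. Proof. exact: adapted_idem eb. Qed.

Definition corner : set (superextension X) := [set f | e * f = f /\ f * e = f].

Lemma cornerM f g : corner f -> corner g -> corner (f * g).
Proof. by move=> [ef _] [_ ge]; split; rewrite ?mulgA ?ef // -mulgA ge. Qed.

Lemma corner_value f K : corner f -> J K ->
  exists2 x, stabilizer K x & selfmap f (b K) = ltranslate x (b K).
Proof.
move=> [ef _] JK; rewrite -ef selfmapM; apply: adapted_value => //.
by rewrite (system_selfmap f Jb).
Qed.

Lemma corner_ext f g : corner f -> corner g ->
  (forall K, J K -> selfmap f (b K) = selfmap g (b K)) -> f = g.
Proof.
move=> [_ fe] [_ ge] fg; apply: selfmap_inj => A; rewrite -fe -ge !selfmapM.
have [[f0 fT] [g0 gT]] := (selfmap0T f, selfmap0T g).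
case: eb => _ _ eA; case: (eA A) => [->|->|[K [x [JK ->]]]].
- by rewrite f0 g0.
- by rewrite fT gT.
- by rewrite !selfmap_ltranslate fg.
Qed.

Lemma corner_surj (y : set X -> X) : (forall K, J K -> stabilizer K (y K)) ->
  exists2 f, corner f & forall K, J K ->
    selfmap f (b K) = ltranslate (y K) (b K).
Proof.
move=> yK; have Jc : system J (fun K => ltranslate (y K) (b K)).
  by move=> K JK; rewrite antifix_ltranslate (Jb JK); exact: yK.
have [g [gb _]] := selfmap_extension Xtw JP Jb Jc.
exists (e * g * e).
  by split; [rewrite !mulgA ee|rewrite -mulgA ee].
by move=> K JK; rewrite !selfmapM ebE // gb // selfmap_ltranslate ebE.
Qed.

Lemma ltranslate_cosquare K x y : J K ->
  ltranslate x (b K) = ltranslate y (b K) <-> cosquare K (x^-1 * y).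
Proof.
move=> JK; have b0 : antifix (b K) !=set0 by rewrite Jb //; exact: J0.
rewrite -{3}(Jb JK) (cosquare_antifix _ b0) ltranslateM; split=> [<-|{1}<-].
  by rewrite ltranslateK.
by rewrite ltranslateVK.
Qed.

Definition corner_shift f K : X :=
  xget 1 [set x | stabilizer K x /\ selfmap f (b K) = ltranslate x (b K)].

Lemma corner_shiftP f K : corner f -> J K ->
  stabilizer K (corner_shift f K) /\
  selfmap f (b K) = ltranslate (corner_shift f K) (b K).
Proof.
move=> cf JK; have [x xK fx] := corner_value cf JK.
by apply: (@xgetPex _ 1 [set x | stabilizer K x /\
  selfmap f (b K) = ltranslate x (b K)]); exists x.
Qed.

Section Coordinate.
Variables (G : groupType) (K : set X) (t : X -> G).
Hypotheses (JK : J K) (Kt : presents K t).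

(* The inverse is there because [f |-> corner_shift f K] reverses products. *)
Definition coordinate f : G := (t (corner_shift f K))^-1.

Let tM x y : stabilizer K x -> stabilizer K y -> t (x * y) = t x * t y.
Proof. by case: Kt => h _ _; exact: h. Qed.

Lemma presents1 : t 1 = 1.
Proof.
by apply: (mulgI (t 1)); rewrite -tM ?mulg1 //; exact: stabilizer1.
Qed.

Lemma presentsV x : stabilizer K x -> t x^-1 = (t x)^-1.
Proof.
move=> Kx; apply/esym/mulg1_eq; rewrite -tM ?mulgV ?presents1 //.
exact: stabilizerV.
Qed.

Lemma presents_eq x y : stabilizer K x -> stabilizer K y ->
  t x = t y <-> cosquare K (x^-1 * y).
Proof.
move=> Kx Ky; have KxV := stabilizerV Kx; have [_ _ tk] := Kt.
rewrite -tk; last exact: stabilizerM.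
rewrite tM // presentsV //; split=> [->|/mulg1_eq]; first exact: mulVg.
by rewrite invgK.
Qed.

Lemma coordinate_val f x : corner f -> stabilizer K x ->
  selfmap f (b K) = ltranslate x (b K) -> coordinate f = (t x)^-1.
Proof.
move=> cf Kx fx; congr (_^-1); have [Ks fs] := corner_shiftP cf JK.
by apply/presents_eq => //; apply/ltranslate_cosquare; rewrite -?fs.
Qed.

Lemma coordinate_eq f g : corner f -> corner g ->
  coordinate f = coordinate g <-> selfmap f (b K) = selfmap g (b K).
Proof.
move=> cf cg; have [Kf fE] := corner_shiftP cf JK;
  have [Kg gE] := corner_shiftP cg JK.
rewrite fE gE (ltranslate_cosquare _ _ JK) -presents_eq //.
by split=> [/invg_inj|h]; rewrite // /coordinate h.
Qed.

Lemma coordinateM f g : corner f -> corner g ->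
  coordinate (f * g) = coordinate f * coordinate g.
Proof.
move=> cf cg; have [Kf fE] := corner_shiftP cf JK;
  have [Kg gE] := corner_shiftP cg JK.
rewrite (@coordinate_val _ (corner_shift g K * corner_shift f K)).
- by rewrite tM // invgM.
- exact: cornerM.
- exact: stabilizerM.
- by rewrite selfmapM gE selfmap_ltranslate fE ltranslateM.
Qed.
End Coordinate.
End Corner.
End Adapted.

(** * The corner as a product of the groups N(K)/KK *)

Section Product.
Variables (X : groupType) (J : set (set X)).
Hypotheses (Xtw : twinic X) (JP : representatives J).
Variables (b : set X -> set X) (e : superextension X).
Hypothesis eb : adapted J b e.
Variables (C Q : natinf -> groupType).
Variables (cls : set X -> natinf + natinf).
Variables (tC : forall k, set X -> X -> C k) (tQ : forall k, set X -> X -> Q k).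
Variables (K1 K2 : set natinf) (qC qQ : natinf -> set (set X)).
Hypothesis clsC : forall K k, J K -> cls K = inl k ->
  K1 k /\ presents K (tC k K).
Hypothesis clsQ : forall K k, J K -> cls K = inr k ->
  K2 k /\ presents K (tQ k K).
Hypothesis qCP : forall k K, K1 k -> qC k K <-> J K /\ cls K = inl k.
Hypothesis qQP : forall k K, K2 k -> qQ k K <-> J K /\ cls K = inr k.

Local Notation PC := (prod_powers K1 C (fun k => set_type (qC k))).
Local Notation PQ := (prod_powers K2 Q (fun k => set_type (qQ k))).

(** The index of a factor is itself a cogroup: the cardinals are realised as sets of cogroups,
    sorted by the type of N(K)/KK. *)
Definition coordinates (f : superextension X) : PC * PQ :=
  ((fun k i => coordinate b (val i) (tC (val k) (val i)) f) : PC,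
   (fun k i => coordinate b (val i) (tQ (val k) (val i)) f) : PQ).

Let qCK (k : K1) (i : set_type (qC (val k))) :
  J (val i) /\ cls (val i) = inl (val k).
Proof. by apply/qCP; [exact: set_mem (valP k)|exact: set_mem (valP i)]. Qed.

Let qQK (k : K2) (i : set_type (qQ (val k))) :
  J (val i) /\ cls (val i) = inr (val k).
Proof. by apply/qQP; [exact: set_mem (valP k)|exact: set_mem (valP i)]. Qed.

Lemma coordinates_isomorphism :
  is_isomorphism (corner e) [set: PC * PQ] coordinates.
Proof.
have prC (k : K1) (i : set_type (qC (val k))) :
  presents (val i) (tC (val k) (val i)).
  by have [Ji ci] := qCK i; have [] := clsC Ji ci.
have prQ (k : K2) (i : set_type (qQ (val k))) :
  presents (val i) (tQ (val k) (val i)).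
  by have [Ji ci] := qQK i; have [] := clsQ Ji ci.
split; last first.
  move=> f g cf cg; congr pair; apply: functional_extensionality_dep => k;
    apply/funext => i.
    exact: (coordinateM JP eb (proj1 (qCK i)) (prC k i) cf cg).
  exact: (coordinateM JP eb (proj1 (qQK i)) (prQ k i) cf cg).
split=> //.
  move=> f g /set_mem cf /set_mem cg [fgC fgQ];
    apply: (corner_ext eb cf cg) => K JK.
  case cK : (cls K) => [k|k].
    have [Kk pK] := clsC JK cK; have qK : qC k K by apply/qCP.
    have := congr1 (fun h : PC => h (SigSub (mem_set Kk)) (SigSub (mem_set
      qK))) fgC.
    by move/(coordinate_eq JP eb JK pK cf cg).
  have [Kk pK] := clsQ JK cK; have qK : qQ k K by apply/qQP.
  have := congr1 (fun h : PQ => h (SigSub (mem_set Kk)) (SigSub (mem_set qK)))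
    fgQ.
  by move/(coordinate_eq JP eb JK pK cf cg).
move=> [u v] _.
(* One shift is sought for each [K]; as [cls K] takes one value, only one of the two families of
   equations has an instance. *)
have ex K : exists y, J K -> [/\ stabilizer K y,
    forall (k : K1) (i : set_type (qC (val k))), val i = K ->
      (tC (val k) (val i) y)^-1 = u k i &
    forall (k : K2) (i : set_type (qQ (val k))), val i = K ->
      (tQ (val k) (val i) y)^-1 = v k i].
  have [JK|nJK] := pselect (J K); last by exists 1.
  case cK : (cls K) => [k|k].
    have [Kk pK] := clsC JK cK; have qK : qC k K by apply/qCP.
    have [_ /(_ (u (SigSub (mem_set Kk)) (SigSub (mem_set qK)))^-1) [y Ky yE]
      _] := pK.
    exists y => _; split=> // [k' i iK|k' i iK]; last first.
      by have [_] := qQK i; rewrite iK cK.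
    have [_ ] := qCK i; rewrite iK cK => -[kk'].
    (* The level must be identified first, because the type of [i] depends on it. *)
    have kE : k' = SigSub (mem_set Kk) by apply/val_inj.
    subst k'; have -> : i = SigSub (mem_set qK) by apply/val_inj.
    by rewrite yE invgK.
  have [Kk pK] := clsQ JK cK; have qK : qQ k K by apply/qQP.
  have [_ /(_ (v (SigSub (mem_set Kk)) (SigSub (mem_set qK)))^-1) [y Ky yE] _]
    := pK.
  exists y => _; split=> // [k' i iK|k' i iK].
    by have [_] := qCK i; rewrite iK cK.
  have [_ ] := qQK i; rewrite iK cK => -[kk'].
  have kE : k' = SigSub (mem_set Kk) by apply/val_inj.
  subst k'; have -> : i = SigSub (mem_set qK) by apply/val_inj.
  by rewrite yE invgK.
have [y yP] : exists y : set X -> X, forall K, J K -> [/\ stabilizer K (y K),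
    forall (k : K1) (i : set_type (qC (val k))), val i = K ->
      (tC (val k) (val i) (y K))^-1 = u k i &
    forall (k : K2) (i : set_type (qQ (val k))), val i = K ->
      (tQ (val k) (val i) (y K))^-1 = v k i].
  by exists (fun K => sval (cid (ex K))) => K; exact: (svalP (cid (ex K))).
have [f cf fy] := corner_surj Xtw JP eb (fun K JK => let: And3 h _ _ :=
  yP K JK in h).
exists f => //; congr pair; apply: functional_extensionality_dep => k;
  apply/funext => i.
  have [Ji _] := qCK i; have [yi yC _] := yP _ Ji.
  rewrite -(yC k i erefl).
  exact: (coordinate_val JP eb Ji (prC k i) cf yi (fy _ Ji)).
have [Ji _] := qQK i; have [yi _ yQ] := yP _ Ji.
rewrite -(yQ k i erefl).
exact: (coordinate_val JP eb Ji (prQ k i) cf yi (fy _ Ji)).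
Qed.
End Product.

Definition left_zero_type (T : Type) : Type := T.

Section LeftZero.
Variable T : choiceType.
HB.instance Definition _ := Choice.on (left_zero_type T).
Definition left_zero_mul (x y : left_zero_type T) := x.
Lemma left_zero_mulA : associative left_zero_mul. Proof. by []. Qed.
HB.instance Definition _ := isSemigroup.Build (left_zero_type T) left_zero_mulA.
Lemma left_zero_left_zeros : left_zeros (left_zero_type T).
Proof. by []. Qed.
End LeftZero.

(** * Left ideals S e for an idempotent e whose corner e S e is a group *)

Section SemigroupCorner.
Variables (S : semigroupType) (G : groupType) (e : S) (phi : S -> G).
Hypothesis ee : e * e = e.
Let H := [set f : S | e * f = f /\ f * e = f].
Hypothesis phiP : is_isomorphism H [set: G] phi.

Let HM f g : H f -> H g -> H (f * g).
Proof. by move=> [ef _] [_ ge]; split; rewrite ?mulgA ?ef // -mulgA ge. Qed.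
Let He : H e. Proof. by []. Qed.
Let phiM f g : H f -> H g -> phi (f * g) = phi f * phi g.
Proof. by case: phiP => _ h; exact: h. Qed.
Let phiI f g : H f -> H g -> phi f = phi g -> f = g.
Proof.
move=> Hf Hg fg; case: phiP => -[_ h _] _.
by apply: h => //; exact: mem_set.
Qed.
Let phiS x : exists2 f, H f & phi f = x.
Proof. by case: phiP => -[_ _ h] _; have [f Hf fx] := h x I; exists f. Qed.
Let phi1 : phi e = 1.
Proof. by apply: (mulgI (phi e)); rewrite -phiM // ee mulg1. Qed.

Lemma corner_inverse f : H f -> exists g, [/\ H g, f * g = e & g * f = e].
Proof.
move=> Hf; have [g Hg gE] := phiS (phi f)^-1.
exists g; split=> //; apply: phiI => //; try exact: HM.
  by rewrite phiM // gE mulgV phi1.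
by rewrite phiM // gE mulVg phi1.
Qed.

(** An idempotent of a group is its identity, so a subgroup containing [e] has identity [e] and lies
    in the corner, which is itself a group. *)
Lemma corner_maximal_subgroup (K : set S) : is_subgroup K -> K e ->
  (forall K', is_subgroup K' -> K' e -> K' `<=` K) -> K = H.
Proof.
move=> Ksub Ke Kmax; apply/seteqP; split; last first.
  apply: Kmax; last exact: He.
  by split; [exact: HM|exists e; split;
    [exact: He|by move=> f []|exact: corner_inverse]].
move=> f Kf; have [_ [e' [Ke' e'P KV]]] := Ksub.
suff e'E : e' = e by have [h1 h2] := e'P _ Kf; rewrite e'E in h1 h2.
have [g [Kg eg _]] := KV _ Ke.
by rewrite -[LHS]eg -{1}ee -mulgA eg; case: (e'P _ Ke).
Qed.

(** The elements s with s e = s and e s = e are idempotents that multiply as left zeros. Every f in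
    S e is (f g)(e f), with g the inverse of e f in the corner, and f g is such an s. *)
Lemma left_ideal_isomorphic : exists Z : semigroupType, left_zeros Z /\
  algebraically_isomorphic [set f : S | f * e = f] [set: Z * G].
Proof.
pose T := set_type [set s : S | s * e = s /\ e * s = e].
have TE (s : T) : val s * e = val s /\
  e * val s = e by have := set_mem (valP s).
have zex f : exists s : T, f * e = f -> val s * (e * f) = f.
  have [fe|nfe] := pselect (f * e = f); last first.
    have eT : [set s : S | s * e = s /\ e * s = e] e by [].
    by exists (SigSub (mem_set eT)).
  have Hf : H (e * f) by split; rewrite ?mulgA ?ee // -mulgA fe.
  have [g [[eg ge] fg gf]] := corner_inverse Hf.
  have sT : [set s : S | s * e = s /\ e * s = e] (f * g).
    by split; rewrite ?mulgA // -mulgA ge.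
  by exists (SigSub (mem_set sT)) => _ /=; rewrite -mulgA gf fe.
pose ze f := sval (cid (zex f)).
have zeE f : f * e = f -> val (ze f) * (e * f) = f by exact: (svalP (cid (zex
  f))).
have corner_of f : f * e = f -> H (e * f).
  by move=> fe; split; rewrite ?mulgA ?ee // -mulgA fe.
have zeU f (s : T) h : H h -> f = val s * h -> f * e = f ->
  ze f = s /\ e * f = h.
  move=> Hh fE fe; have [se es] := TE s.
  have efh : e * f = h by rewrite fE mulgA es; case: Hh.
  split=> //; apply/val_inj; have := zeE f fe; rewrite efh {2}fE.
  have [g [_ hg _]] := corner_inverse Hh.
  move/(congr1 (fun x => x * g)); rewrite -!mulgA hg.
  by have [-> _] := TE (ze f); rewrite se.
exists (left_zero_type T : semigroupType); split;
  first exact: left_zero_left_zeros.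
exists (fun f => (ze f : left_zero_type T, phi (e * f))); split.
  split=> // [f g /set_mem /= fe /set_mem /= ge [zfg pfg]|[s x] _].
    rewrite -(zeE f fe) -(zeE g ge) zfg; congr (_ * _).
    by apply: phiI => //; exact: corner_of.
  have [h Hh hx] := phiS x; have [se es] := TE s.
  have fe : val s * h * e = val s * h by rewrite -mulgA; case: Hh => _ ->.
  exists (val s * h) => //.
  by have [-> ->] := zeU _ _ _ Hh erefl fe; rewrite hx.
move=> f g /= fe ge; have fge : f * g * e = f * g by rewrite -mulgA ge.
have E : f * g = val (ze f) * ((e * f) * (e * g)).
  by rewrite [RHS]mulgA (zeE f fe) [RHS]mulgA fe.
have [-> ->] := zeU _ _ _ (HM (corner_of _ fe) (corner_of _ ge)) E fge.
by congr pair; rewrite phiM //; exact: corner_of.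
Qed.
End SemigroupCorner.

(** * Topology of the corner *)

Section ProductConvergence.
Variables (I : Type) (T : I -> topologicalType).

Lemma cvg_prod_topology (F : set_system (prod_topology T)) (f :
  prod_topology T) :
  Filter F -> (forall i, (fun g : prod_topology T => g i) @ F --> f i) ->
    F --> f.
Proof.
move=> FF Ff; apply/cvg_sup => i A.
rewrite nbhsE /= => -[B [[C oC <-] Bf] BA]; apply: (filterS BA).
by apply: Ff; exact: open_nbhs_nbhs.
Qed.

Lemma nbhs_prod_topology (f : prod_topology T) i (A : set (T i)) :
  nbhs (f i) A -> nbhs f [set g : prod_topology T | A (g i)].
Proof.
have /cvg_sup/(_ i) fi : nbhs f --> f by exact: cvg_id.
move=> fA; apply: fi; exact: (@initial_continuous _ _ (@proj I T i)).
Qed.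
End ProductConvergence.

Section ProdPowersTopology.
Variables (K : set natinf) (G : natinf -> groupType) (q : natinf -> Type).
Local Notation P := (prod_powers K G q).
Local Notation T k := (prod_topology (fun _ :
  q (val k) => discrete_topology (G (val k)))).

Lemma cvg_prod_powers (F : set_system P) (f : P) : Filter F ->
  (forall k i, F [set g : P | g k i = f k i]) -> F --> f.
Proof.
move=> FF Ff; apply: (@cvg_prod_topology K (fun k => T k) F f) => k.
apply: (@cvg_prod_topology (q (val k)) (fun _ => discrete_topology (G (val k)))
  ((fun g : P => g k) @ F) (f k)) => i U Uf.
apply: (@filterS _ F _ _ _ _ (Ff k i)) => g /= gf.
by rewrite gf; exact: (@nbhs_singleton (discrete_topology (G (val k))) _ _ Uf).
Qed.

Lemma nbhs_prod_powers (f : P) k i : nbhs f [set g : P | g k i = f k i].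
Proof.
apply: (@nbhs_prod_topology K (fun k => T k) f k [set h | h i = f k i]).
apply: (@nbhs_prod_topology (q (val k)) (fun _ => discrete_topology (G (val
  k))) (f k) i [set f k i]).
exact: discrete_set1.
Qed.
End ProdPowersTopology.

Section SuperextensionTopology.
Variable X : groupType.
Implicit Types (L M : superextension X) (A : set X).

Lemma nbhs_superextension L A : nbhs L [set M | val M A <-> val L A].
Proof.
have : nbhs (superextension_embedding L) [set g : {ptws set X ->
  bool} | g A = `[< val L A >]].
  exact: (@nbhs_prod_topology (set X) (fun _ => bool : topologicalType)
    (superextension_embedding L) A [set `[< val L A >]] (discrete_set1 _)).
move/(@initial_continuous _ _ (@superextension_embedding X) L) => h.
apply: (@filterS _ (nbhs L) _ _ _ _ h) => M /= ML.
rewrite /superextension_embedding in ML.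
by split=> /asboolP; [rewrite ML|rewrite -ML] => /asboolP.
Qed.

Lemma cvg_superextension (F : set_system (superextension X)) L : Filter F ->
  (forall A, F [set M | val M A <-> val L A]) -> F --> L.
Proof.
move=> FF FL A.
rewrite nbhsE /= => -[B [[C oC <-] BL] BA]; apply: (filterS BA).
have : (superextension_embedding (X:=X)) @ F --> superextension_embedding L.
  apply: cvg_prod_topology => A' U; rewrite /= => UL.
  apply: (@filterS _ F _ _ _ _ (FL A')) => M /= ML.
  suff : superextension_embedding M A' = superextension_embedding L A'.
    by rewrite /superextension_embedding /= => ->; exact: nbhs_singleton.
  exact: asbool_equiv_eq.
by apply; exact: open_nbhs_nbhs.
Qed.
End SuperextensionTopology.

Lemma near_bounded (T : Type) (F : set_system T) (P : nat ->
  set T) N : Filter F ->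
  (forall j, F (P j)) -> F [set x | forall j, (j < N)%N -> P j x].
Proof.
move=> FF FP; elim: N => [|N IHN]; first by apply: filterS filterT.
apply: filterS (filterI (FP N) IHN) => x [PN Px] j.
by rewrite ltnS leq_eqVlt => /orP[/eqP->//|/Px].
Qed.

Definition finitely_enumerated (T : Type) :=
  exists N (h : nat -> T), forall x, exists2 j, (j < N)%N & h j = x.

Section ProductTopology.
Variables (X : groupType) (J : set (set X)).
Hypotheses (Xtw : twinic X) (JP : representatives J).
Variables (b : set X -> set X) (e : superextension X).
Hypothesis eb : adapted J b e.

(** The finitely many other values are excluded one by one. Coordinate [h j] forces the image of
    [b K] to be one fixed translate, and at a point x where it differs from the image under [f],
    membership of x^-1 [b K] separates the two. *)
Lemma coordinate_locally_constant (G : groupType) K (t : X -> G) f :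
  J K -> presents K t -> finitely_enumerated G -> corner e f ->
  nbhs f [set g | corner e g -> coordinate b K t g = coordinate b K t f].
Proof.
move=> JK Kt [N [h hN]] cf.
have sep j : exists A, forall g, corner e g -> coordinate b K t g = h j ->
    (val g A <-> val f A) -> coordinate b K t g = coordinate b K t f.
  have [hf|hf] := pselect (h j = coordinate b K t f).
    by exists set0 => g _ ->.
  have [_ /(_ (h j)^-1) [y Ky yh] _] := Kt.
  have [x xP] : exists x, ~ (ltranslate y (b K) x <-> selfmap f (b K) x).
    apply: contrapT => nx; apply: hf.
    rewrite (coordinate_val JP eb JK Kt cf Ky) ?yh ?invgK //.
    apply/funext => x; apply: propext; apply: iff_sym; apply: contrapT => xP.
    by apply: nx; exists x.
  exists (ltranslate x^-1 (b K)) => g cg gh gf; exfalso; apply: xP.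
  have [Ks gs] := corner_shiftP JP eb cg JK.
  have -> : ltranslate y (b K) = selfmap g (b K).
    rewrite gs; apply/(ltranslate_cosquare JP eb _ _ JK)/(presents_eq Kt) => //.
    by rewrite yh -gh invgK.
  exact: gf.
pose A j := sval (cid (sep j)).
have near_f := near_bounded N _ (fun j => nbhs_superextension f (A j)).
apply: filterS (near_f _) => g /= gf cg.
have [j jN jE] := hN (coordinate b K t g).
exact: (svalP (cid (sep j)) g cg (esym jE) (gf j jN)).
Qed.

Variables (C Q : natinf -> groupType).
Variables (cls : set X -> natinf + natinf).
Variables (tC : forall k, set X -> X -> C k) (tQ : forall k, set X -> X -> Q k).
Variables (K1 K2 : set natinf) (qC qQ : natinf -> set (set X)).
Hypothesis clsC : forall K k, J K -> cls K = inl k ->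
  K1 k /\ presents K (tC k K).
Hypothesis clsQ : forall K k, J K -> cls K = inr k ->
  K2 k /\ presents K (tQ k K).
Hypothesis qCP : forall k K, K1 k -> qC k K <-> J K /\ cls K = inl k.
Hypothesis qQP : forall k K, K2 k -> qQ k K <-> J K /\ cls K = inr k.
Hypothesis finC : forall k, K1 k -> finitely_enumerated (C k).
Hypothesis finQ : forall k, K2 k -> finitely_enumerated (Q k).

Local Notation PC := (prod_powers K1 C (fun k => set_type (qC k))).
Local Notation PQ := (prod_powers K2 Q (fun k => set_type (qQ k))).
Local Notation coords := (@coordinates _ b C Q tC tQ K1 K2 qC qQ).

Lemma coordinates_homeomorphism :
  is_homeomorphism (corner e) [set: PC * PQ] coords.
Proof.
have [bij _] := coordinates_isomorphism Xtw JP eb clsC clsQ qCP qQP.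
split=> //.
  apply/subspace_continuousP => f cf.
  have FF := within_filter (corner e) (nbhs_filter f).
  have pr1 : (fun g => (coords g).1) @ within (corner e) (nbhs f) --> (coords
    f).1.
    apply: cvg_prod_powers => k i.
    have [Ji ci] : J (val i) /\ cls (val i) = inl (val k).
      by apply/qCP; [exact: set_mem (valP k)|exact: set_mem (valP i)].
    have [_ pK] := clsC Ji ci.
    exact: coordinate_locally_constant Ji pK (finC (set_mem (valP k))) cf.
  have pr2 : (fun g => (coords g).2) @ within (corner e) (nbhs f) --> (coords
    f).2.
    apply: cvg_prod_powers => k i.
    have [Ji ci] : J (val i) /\ cls (val i) = inr (val k).
      by apply/qQP; [exact: set_mem (valP k)|exact: set_mem (valP i)].
    have [_ pK] := clsQ Ji ci.
    exact: coordinate_locally_constant Ji pK (finQ (set_mem (valP k))) cf.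
  exact: (cvg_pair pr1 pr2).
have [_ cI cS] := bij.
have ex t : exists f, corner e f /\ coords f = t.
  by have [f cf ft] := cS t I; exists f.
pose g t := sval (cid (ex t)).
have cg t : corner e (g t) by case: (svalP (cid (ex t))).
have gK t : coords (g t) = t by case: (svalP (cid (ex t))).
exists g; split; last first.
  by move=> f /set_mem cf; apply: cI; rewrite ?gK //; exact: mem_set.
apply/subspace_continuousP => t _; apply: cvg_superextension => A.
suff : nbhs t [set t' | val (g t') A <-> val (g t) A].
  by apply: filterS => t' ? _.
(* Elements of the corner absorb [e] on the right, so membership of [A] is read off the image of
   [selfmap e A]. This set is empty, X, or a translate of one [b K], so one coordinate at most
   decides. *)
have same t' : selfmap (g t') (selfmap e A) = selfmap (g t) (selfmap e A) ->
    (val (g t') A <-> val (g t) A).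
  rewrite !selfmap_val -!selfmapM; case: (cg t') => _ ->; case: (cg t) => _ ->.
  by move=> ->.
have [g0 gT] := (fun t => proj1 (selfmap0T (g t)),
  fun t => proj2 (selfmap0T (g t))).
case: (eb) => _ _ /(_ A)[e0|eT|[K [x [JK eA]]]].
- by apply: filterS filterT => t' _; apply: same; rewrite e0 !g0.
- by apply: filterS filterT => t' _; apply: same; rewrite eT !gT.
have sameK t' : selfmap (g t') (b K) = selfmap (g t) (b K) ->
  (val (g t') A <-> val (g t) A).
  by move=> gg; apply: same; rewrite eA !selfmap_ltranslate gg.
case cK : (cls K) => [k|k].
  have [Kk pK] := clsC JK cK; have qK : qC k K by apply/qCP.
  pose kk : K1 := SigSub (mem_set Kk);
    pose i : set_type (qC (val kk)) := SigSub (mem_set qK).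
  have near1 : nbhs t [set t' | t'.1 kk i = t.1 kk i].
    exact: (cvg_fst (nbhs_prod_powers t.1 i)).
  apply: filterS near1 => t' /= t'i; apply: sameK.
  apply/(coordinate_eq JP eb JK pK (cg t') (cg t)).
  by have := t'i; rewrite -{1}(gK t') -{1}(gK t).
have [Kk pK] := clsQ JK cK; have qK : qQ k K by apply/qQP.
pose kk : K2 := SigSub (mem_set Kk);
  pose i : set_type (qQ (val kk)) := SigSub (mem_set qK).
have near2 : nbhs t [set t' | t'.2 kk i = t.2 kk i].
  exact: (cvg_snd (nbhs_prod_powers t.2 i)).
apply: filterS near2 => t' /= t'i; apply: sameK.
apply/(coordinate_eq JP eb JK pK (cg t') (cg t)).
by have := t'i; rewrite -{1}(gK t') -{1}(gK t).
Qed.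
End ProductTopology.

(** * Abelian groups *)

Section FiniteFactors.
Variable R : realType.

Lemma finitely_enumerated_C2 n : finitely_enumerated (C2 R (Some n)).
Proof.
exists (2 ^ n)%N, (fun j => SigSub (mem_set (zetaX R n j : C2set (Some n) _))).
move=> x; have [j [jn xj]] := C2fin_zeta (set_mem (valP x)).
by exists j => //; apply/val_inj.
Qed.

Lemma finitely_enumerated_Q2 n : (3 <= n)%N ->
  finitely_enumerated (Q2 R (Some n)).
Proof.
case: n => // n n2.
have mem1 j : Q2set (Some n.+1) (Quat (zeta R n ^+ j) 0)%R.
  by apply/(Q2finE _ n2); exists (zeta R n ^+ j)%R; [exact: zetaX|left].
have mem2 j : Q2set (Some n.+1) (Quat 0 (zeta R n ^+ j))%R.
  by apply/(Q2finE _ n2); exists (zeta R n ^+ j)%R; [exact: zetaX|right].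
exists (2 ^ n + 2 ^ n)%N, (fun j => if (j < 2 ^ n)%N then SigSub (mem_set (mem1
  j))
  else SigSub (mem_set (mem2 (j - 2 ^ n)%N))).
move=> x; have /(Q2finE _ n2) [w /C2fin_zeta [j [jn ->]] xE] :=
  set_mem (valP x).
case: xE => xE.
  by exists j; [exact: ltn_addr|apply/val_inj; rewrite jn /= -xE].
exists (j + 2 ^ n)%N; first by rewrite ltn_add2r.
by apply/val_inj; rewrite ltnNge leq_addl /= addnK -xE.
Qed.

Lemma C2_valX k (x : C2 R k) n : val (x ^+ n) = (val x ^+ n)%R.
Proof. by elim: n => [//|n IHn]; rewrite expgS exprS -IHn. Qed.

(** The exponent determines [k]; this is how [abelian_presents_inj] tells the groups apart. *)
Lemma C2_exponent (k : natinf) n :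
  (forall x : C2 R k, x ^+ (2 ^ n) = 1) <-> ~~ leinf n.+1 k.
Proof.
split=> [h|].
  apply/negP => nk.
  have zk : C2set k (zeta R n.+1).
    have zn : C2fin n.+1 (zeta R n.+1) by rewrite -[zeta _ _]expr1;
      exact: zetaX.
    by case: k {h} nk => [m|_] /=; [move=> nm; exact: C2fin_le zn|exists n.+1].
  have := congr1 val (h (SigSub (mem_set zk))); rewrite C2_valX /= zeta_expS.
  by move/eqP; rewrite -subr_eq0 -opprD oppr_eq0 -mulr2n pnatr_eq0.
case: k => // m; rewrite /= -leqNgt => mn x; apply/val_inj; rewrite C2_valX.
exact: (C2fin_le mn (set_mem (valP x))).
Qed.

Lemma leinf_inj (k l : natinf) : (forall n, leinf n.+1 k = leinf n.+1 l) ->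
  k = l.
Proof.
case: k l => [m|] [n|] //= h.
- by congr Some; apply/eqP; rewrite eqn_leq leqNgt h ltnn leqNgt -h ltnn.
- by have := h m; rewrite ltnn.
- by have := h n; rewrite ltnn.
Qed.

Lemma C2_power_minus1 (k : natinf) (x : C2 R k) : x <> 1 ->
  exists n, val (x ^+ n) = (-1)%R.
Proof.
move=> x1.
have ex : exists n, x ^+ (2 ^ n) == 1.
  suff [n xn] : exists n, C2fin n (val x) by exists n; apply/eqP/val_inj;
    rewrite C2_valX.
  by have := set_mem (valP x); case: (k) x {x1} => [n|] x /= => [|[n _]] xn;
    exists n.
case: (ex_minnP ex) => -[|n] /eqP xn nmin; first by rewrite expg1 in xn.
exists (2 ^ n)%N; move: xn; rewrite expnSr expgnA => /(congr1 val).
rewrite (C2_valX (x ^+ _)) => /eqP;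
  rewrite sqrf_eq1 => /orP[/eqP xn1|/eqP ->]; [exfalso|by []].
suff : (n < n)%N by rewrite ltnn.
by apply: nmin; apply/eqP/val_inj.
Qed.

Lemma Q2_noncommutative (k : natinf) : exists x y : Q2 R k, x * y <> y * x.
Proof.
have mem (q : quat R) : Q8 q -> Q2set k q.
  move=> q8; have h n : Q2fin n q by move=> G [_ genG]; apply: genG; right.
  by case: k => [n|] /=; [exact: h|exists 3%N].
have im : Q2set k (Quat 'i 0 : quat R)%R by apply: mem; rewrite /Q8 /=; tauto.
have jm : Q2set k (Quat 0 1 : quat R)%R by apply: mem; rewrite /Q8 /=; tauto.
exists (SigSub (mem_set im)),
  (SigSub (mem_set jm)) => /(congr1 (@qsnd R \o val)) ij.
have : qsnd ((Quat 'i 0)%R * (Quat 0 1)%R :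
  quat R) = qsnd ((Quat 0 1)%R * (Quat 'i 0)%R : quat R).
  exact: ij.
rewrite !quat_mulE /qsnd /qfst rmorph0 conjCi !mul0r mulr1 mul1r addr0 add0r.
move/eqP; rewrite -subr_eq0 opprK -mulr2n mulrn_eq0 /=.
exact/negP/neq0Ci.
Qed.
End FiniteFactors.

Lemma card_eq_range (T : Type) (U : Type) (f : T -> U) (B : set U) :
  injective f -> range f = B -> [set: T] #= B.
Proof.
move=> fI <-; apply/card_esym; apply: inj_card_eq => x y _ _; exact: fI.
Qed.

Section AbelianGroups.
Variables (R : realType) (X : groupType).
Hypothesis Xab : forall x y : X, commute x y.
Implicit Types (H K : set X) (k : natinf).

Lemma abelian_stabilizer K x : stabilizer K x.
Proof.
by apply/funext => y; rewrite /conj_set /= conjgE (Xab y) mulKg.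
Qed.

Section Character.
Variables (k : natinf) (u : X -> C2 R k).
Hypotheses (k1 : leinf 1 k) (uM : forall x y, u (x * y) = u x * u y).
Hypothesis uS : forall w, exists x, u x = w.

Let K := [set x | val (u x) = (-1)%R].

Lemma character1 : u 1 = 1.
Proof. by apply: (mulgI (u 1)); rewrite -uM !mulg1. Qed.

Lemma character_expg x n : u (x ^+ n) = u x ^+ n.
Proof. by elim: n => [|n IHn]; [exact: character1|rewrite !expgS uM IHn]. Qed.

Let valM x y : val (u (x * y)) = (val (u x) * val (u y))%R.
Proof. by rewrite uM. Qed.

Let K0 : K !=set0.
Proof.
have m : C2set k (-1 : R[i])%R.
  have m1 n : C2fin n.+1 (-1 : R[i])%R by apply: C2finN;
    exact: (@C2set1 R (Some n.+1)).
  by case: (k) k1 => [[|n]|] // _; [exact: m1|exists 1%N => //; exact: m1].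
by have [x ux] := uS (SigSub (mem_set m)); exists x; rewrite /K /= ux.
Qed.

Let cosq x : cosquare K x <-> u x = 1.
Proof.
have [k0 Kk0] := K0.
split=> [[y Ky]|ux].
  rewrite /K /= valM Ky mulrN1 => /oppr_inj ux.
  exact/val_inj.
by exists k0 => //; rewrite /K /= valM ux mul1r.
Qed.

(** Let K' be a cogroup containing [K], with x in K' and x0 in [K]. If [u (x * x0)] were not 1, a
    power of [x * x0] would lie in [K], yet all these powers lie in K'K', which is disjoint from
    K'. *)
Lemma character_max_cogroup : max_cogroup K.
Proof.
have m1 : (-1 : R[i])%R <> 1%R.
  by move/eqP; rewrite -subr_eq0 -opprD oppr_eq0 -mulr2n pnatr_eq0.
split.
  split.
  - exact: K0.
  - by move=> x y v Kx Ky Kv; rewrite /K /= !valM Kx Ky Kv mulrNN !mul1r.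
  - move=> x Kx; rewrite /K /=; have := valM x x^-1;
    rewrite mulgV character1 Kx mulN1r /= => e.
    by rewrite e opprK.
  - by move=> x y Kx Ky; rewrite /K /= valM Kx Ky mulrNN mulr1 => /esym/m1.
move=> K' K'c KK'; apply/seteqP; split=> // x K'x.
have [x0 Kx0] := K0.
have Ex : cosquare K' (x * x0) by apply: cogroupM_cosquare => //; exact: KK'.
have ux : u (x * x0) = 1.
  apply: contrapT => /C2_power_minus1 [n]; rewrite -character_expg => Kn.
  apply: (cosquare_notin K'c _ (KK' _ Kn)).
  elim: n {Kn} => [|n IHn]; first exact: cosquare1.
  by rewrite expgS; exact: cosquareM.
rewrite /K /=; have := congr1 val ux; rewrite valM Kx0 mulrN1 /= => e.
by rewrite -[LHS]opprK e.
Qed.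

Lemma character_presents : presents K u.
Proof.
split=> [x y _ _|w|x _]; [exact: uM| |by rewrite cosq].
by have [x ux] := uS w; exists x => //; exact: abelian_stabilizer.
Qed.
End Character.

Section Presented.
Variables (k : natinf) (K : set X) (t : X -> C2 R k).
Hypothesis Kt : presents K t.

Lemma abelian_presentsM x y : t (x * y) = t x * t y.
Proof. by case: Kt => h _ _; apply: h; exact: abelian_stabilizer. Qed.

Lemma abelian_presents_ker x : t x = 1 <-> cosquare K x.
Proof. by case: Kt => _ _ h; apply: h; exact: abelian_stabilizer. Qed.

Lemma abelian_presents_surj w : exists x, t x = w.
Proof. by case: Kt => _ /(_ w)[x _ tx] _; exists x. Qed.

Lemma abelian_presents_eq x y : t x = t y <-> cosquare K (x^-1 * y).
Proof. by apply: presents_eq => //; exact: abelian_stabilizer. Qed.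
End Presented.

Lemma abelian_presents_inj k l K (t : X -> C2 R k) (s : X -> C2 R l) :
  presents K t -> presents K s -> k = l.
Proof.
move=> Kt Ks; apply: leinf_inj => n; apply: negb_inj; apply/idP/idP.
- move/C2_exponent => h; apply/C2_exponent => w.
  have [x <-] := abelian_presents_surj Ks w.
  rewrite -(character_expg (abelian_presentsM Ks)).
  apply/(abelian_presents_ker Ks); apply/(abelian_presents_ker Kt).
  by rewrite (character_expg (abelian_presentsM Kt)); exact: h.
- move/C2_exponent => h; apply/C2_exponent => w.
  have [x <-] := abelian_presents_surj Kt w.
  rewrite -(character_expg (abelian_presentsM Kt)).
  apply/(abelian_presents_ker Kt); apply/(abelian_presents_ker Ks).
  by rewrite (character_expg (abelian_presentsM Ks)); exact: h.
Qed.

Lemma abelian_not_presents_Q2 k K (t : X -> Q2 R k) : ~ presents K t.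
Proof.
move=> [tM tS _]; have [v [w vw]] := Q2_noncommutative R k; apply: vw.
have [x Kx <-] := tS v; have [y Ky <-] := tS w.
by rewrite -!tM // Xab.
Qed.

(** Some power of an element k of [K'] lies in [K]. Even powers of k lie in the common subgroup KK,
    so the exponent is odd and k is in [K]; both cogroups are then the coset of KK through k. *)
Lemma max_cogroup_cosquare_inj K K' : max_cogroup K -> max_cogroup K' ->
  cosquare K = cosquare K' -> K = K'.
Proof.
move=> Km K'm EE; have [Kc _] := Km; have [K'c _] := K'm.
have [[k K'k] _ _ _] := K'c.
have nEk : ~ cosquare K k by rewrite EE => /(cosquare_notin K'c).
have [n Kkn] := max_cogroup_power Km (abelian_stabilizer K k) nEk.
have Ekk m : cosquare K (k ^+ m.*2).
  elim: m => [|m IHm]; first exact: cosquare1.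
  rewrite doubleS !expgS mulgA; apply: cosquareM => //.
  by rewrite EE; exact: cogroupM_cosquare.
have Kk : K k.
  move: Kkn; rewrite -(odd_double_half n);
    case: odd => [|/(cosquare_notin Kc (Ekk _))//].
  rewrite expgnDr expg1 => Kkn.
  by have [_ _ _ _] := Kc; rewrite -(mulgK (k ^+ n./2.*2) k) Xab;
    apply/(cosquareP Kc _ Kkn)/cosquareV.
apply/funext => y; apply/propext.
rewrite -[y](mulgVK k) -(cosquareP Kc _ Kk) -(cosquareP K'c _ K'k) EE.
by [].
Qed.

Lemma is_subgroup_group H : is_subgroup H -> [/\ H 1, forall x y, H x ->
  H y -> H (x * y) &
  forall x, H x -> H x^-1].
Proof.
move=> [HM [e [He e1 HV]]]; have eE : e = 1.
  by apply: (mulgI e); rewrite mulg1; case: (e1 e He).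
split=> //; first by rewrite -eE.
by move=> x /HV[y [Hy xy _]]; rewrite (mulg1_eq (etrans xy eE)).
Qed.

Lemma lcoset_eq H x y : is_subgroup H ->
  lcoset H x = lcoset H y <-> H (x^-1 * y).
Proof.
move=> /is_subgroup_group [H1 HM HV]; rewrite /lcoset !ltranslateE;
  split=> [e|Hxy].
  by rewrite -[H _]/([set v | H (x^-1 * v)] y) e /= mulVg.
apply/seteqP; split=> v /= Hv.
  by have := HM _ _ (HV _ Hxy) Hv; rewrite invgM invgK -mulgA mulVKg.
by have := HM _ _ Hxy Hv; rewrite -mulgA mulVKg.
Qed.

Lemma cosquare_subgroup K : cogroup K -> is_subgroup (cosquare K).
Proof.
move=> Kc; split; first exact: cosquareM.
exists 1; split=> [|x _|x Ex]; first exact: cosquare1.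
  by rewrite mul1g mulg1.
by exists x^-1; rewrite mulgV mulVg; split=> //; exact: cosquareV.
Qed.

Lemma cosquare_quotient_isomorphic k K (t : X -> C2 R k) : cogroup K ->
  presents K t -> quotient_isomorphic (cosquare K) (C2 R k).
Proof.
move=> Kc Kt; have Esub := cosquare_subgroup Kc.
have E1 := cosquare1 Kc.
pose f C := t (xget 1 C).
have fE x : f (lcoset (cosquare K) x) = t x.
  apply/esym/(abelian_presents_eq Kt).
  have : lcoset (cosquare K) x (xget 1 (lcoset (cosquare K) x)).
    apply: xgetPex; exists x; rewrite /lcoset ltranslateE /= mulVg //.
  by rewrite {1}/lcoset ltranslateE.
exists f; split; last by move=> x y; rewrite !fE (abelian_presentsM Kt).
split=> //.
  move=> _ _ /set_mem [x _ <-] /set_mem [y _ <-]; rewrite !fE.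
  by move/(abelian_presents_eq Kt) => Exy; apply/lcoset_eq.
move=> w _; have [x tx] := abelian_presents_surj Kt w.
by exists (lcoset (cosquare K) x); [exists x|rewrite fE].
Qed.

Lemma quotient_isomorphic_character k H : is_subgroup H ->
  quotient_isomorphic H (C2 R k) ->
  exists u : X -> C2 R k, [/\ forall x y, u (x * y) = u x * u y,
    forall w, exists x, u x = w & forall x, u x = 1 <-> H x].
Proof.
move=> Hsub [f [[_ fI fS] fM]]; exists (fun x => f (lcoset H x)).
split=> [//|w|x].
  by have [_ [x _ <-] fx] := fS w I; exists x.
have f1 : f (lcoset H 1) = 1.
  by apply: (mulgI (f (lcoset H 1))); rewrite -fM !mulg1.
have -> : H x <-> lcoset H 1 = lcoset H x by rewrite lcoset_eq // invg1 mul1g.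
rewrite -f1; split=> [/esym|->//]; apply: fI; exact: mem_set.
Qed.
End AbelianGroups.

(** * Characters onto a cyclic group of order 2^(k+1) *)

Section CountingCharacters.
Variables (R : realType) (X : groupType) (k : nat).
Hypothesis Xab : forall x y : X, commute x y.
Variables (P : set (set X)) (t : set X -> X -> C2 R (Some k.+1)).
Hypothesis PK : forall K, P K -> max_cogroup K /\ presents K (t K).
Hypothesis KP : forall K (u : X -> C2 R (Some k.+1)),
  max_cogroup K -> presents K u -> P K.

Let powers (c : set_type P * 'I_(2 ^ k)) (x : X) : R[i] :=
  (val (t (val c.1) x) ^+ c.2.*2.+1)%R.

Let sgn_odd n : ((-1) ^+ n.*2.+1 = -1 :> R[i])%R.
Proof. by rewrite -signr_odd /= odd_double expr1. Qed.

Let m1 : (-1 : R[i])%R <> 1%R.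
Proof. by move/eqP; rewrite -subr_eq0 -opprD oppr_eq0 -mulr2n pnatr_eq0. Qed.

(** Such a character is an odd power of the one chosen for its cogroup, the preimage of -1; the
    factor 2^k counts the odd exponents below 2^(k+1). *)
Lemma card_characters :
  [set: set_type P * 'I_(2 ^ k)] #= homC2 R X k.+1 `\` homC2 R X k.
Proof.
have gen K : P K -> exists x, val (t K x) = zeta R k.+1.
  move=> /PK[_ Kt]; have zk : C2set (Some k.+1) (zeta R k.+1).
    by rewrite -[zeta _ _]expr1; exact: zetaX.
  have [x tx] := abelian_presents_surj Kt (SigSub (mem_set zk)).
  by exists x; rewrite tx.
apply: (card_eq_range (f := powers)).
  move=> [K i] [K' i'] e; have [Km Kt] := PK (set_mem (valP K)).
  have [K'm K't] := PK (set_mem (valP K')).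
  have ker L j x : powers (L, j) x = 1%R <-> t (val L) x = 1.
    split=> [h|h]; last by rewrite /powers /= h /= expr1n.
    apply: contrapT => /C2_power_minus1 [n]; rewrite C2_valX => tn.
    by apply: m1; rewrite -(sgn_odd j) -tn exprAC [X in (X ^+ _)%R]h expr1n.
  have KK' : K = K'.
    apply/val_inj/(max_cogroup_cosquare_inj Xab Km K'm)/funext => x;
      apply: propext.
    by rewrite -(abelian_presents_ker Xab Kt) -(abelian_presents_ker Xab K't)
      -(ker K i) -(ker K' i') e.
  rewrite -KK' in e *; congr pair; apply/val_inj => /=.
  have [x tx] := gen _ (set_mem (valP K)).
  have := congr1 (fun h => h x) e; rewrite /powers /= tx => /eqP.
  rewrite (eq_prim_root_expr (zeta_primitive R k.+1)).
  have lt (j : 'I_(2 ^ k)) : (j.*2.+1 < 2 ^ k.+1)%N.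
    by rewrite expnS mul2n -doubleS leq_double.
  by rewrite !modn_small // => /eqP[/double_inj].
apply/seteqP; split=> [_ [[K i] _ <-]|g [[gk gM] ng]].
  have [Km Kt] := PK (set_mem (valP K)); split.
    split=> [x|x y]; first by rewrite /C2fin /= /powers /= exprAC [X in (X ^+
      _)%R](set_mem (valP (t (val K) x))) expr1n.
    by rewrite /powers /= (abelian_presentsM Xab Kt) exprMn.
  move=> [h _]; have [x tx] := gen _ (set_mem (valP K)).
  have := h x; rewrite /C2fin /= /powers /= tx exprAC zeta_expS sgn_odd.
  exact: m1.
(* A value outside C_(2^k) generates C_(2^(k+1)), so [g] is onto. *)
have [x0 gx0] : exists x, (g x ^+ (2 ^ k))%R <> 1%R.
  apply: contrapT => nx; apply: ng; split=> // x; apply: contrapT => gx.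
  by apply: nx; exists x.
pose u x : C2 R (Some k.+1) :=
  SigSub (mem_set (gk x : C2set (Some k.+1) (g x))).
have uM x y : u (x * y) = u x * u y by apply/val_inj; rewrite /= gM.
have gX x n : g (x ^+ n) = (g x ^+ n)%R.
  by have := congr1 val (character_expg uM x n); rewrite C2_valX.
have uS w : exists x, u x = w.
  have [j [_ gj]] := C2fin_zeta (gk x0).
  have jo : odd j.
    apply: contrapT => /negP je; apply: gx0; rewrite gj exprAC zeta_expS.
    by rewrite -signr_odd (negbTE je).
  have prim : ((2 ^ k.+1).-primitive_root (g x0))%R.
    rewrite gj prim_root_exp_coprime; last exact: zeta_primitive.
    by rewrite coprimeXr // coprimen2.
  have [n wn] := prim_rootP prim (set_mem (valP w)).
  by exists (x0 ^+ n); apply/val_inj; rewrite /= gX.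
pose K := [set x | val (u x) = (-1)%R].
have KK : P K by apply: KP (character_max_cogroup _ uM uS) (character_presents
  Xab _ uM uS).
have Ku := @character_presents R X Xab (Some k.+1) u isT uM uS.
have [_ Kt] := PK KK.
have [x1 tx1] := gen _ KK; have [j [jk gj]] := C2fin_zeta (gk x1).
(* The characters [g] and [t K] have the same kernel KK, so [g] factors through [t K]; its value at
   [x1], which [t K] sends to the generator, gives the exponent. *)
have gE y : g y = (val (t K y) ^+ j)%R.
  have [a [_ ta]] := C2fin_zeta (set_mem (valP (t K y))).
  have : t K y = t K (x1 ^+ a).
    by apply/val_inj; rewrite (character_expg (abelian_presentsM Xab Kt))
      C2_valX tx1.
  move/(abelian_presents_eq Xab Kt)/(abelian_presents_eq Xab Ku)/(congr1 val)
    => /= ->.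
  by rewrite gX gj [X in (_ = X ^+ _)%R]ta exprAC.
have jo : odd j.
  apply: contrapT => /negP je; apply: gx0; rewrite gE.
  have [a [_ ->]] := C2fin_zeta (set_mem (valP (t K x0))).
  rewrite exprAC (exprAC _ a) zeta_expS exprAC -(signr_odd _ j) (negbTE je).
  exact: expr1n.
have jE : (j = j./2.*2.+1)%N by rewrite -[LHS]odd_double_half jo.
have j2 : (j./2 < 2 ^ k)%N.
  by rewrite -ltn_double -[ltnRHS]mul2n -expnS; apply: leq_ltn_trans jk;
    rewrite [leqRHS]jE.
exists (SigSub (mem_set KK), Ordinal j2) => //.
by apply/funext => y; rewrite /powers /= -jE gE.
Qed.
End CountingCharacters.

Local Close Scope group_scope.

(** This settles the trivial quotient in the abelian count, where no maximal cogroup corresponds to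
    the subgroup. *)
Lemma trivial_quotient (R : realType) (X : groupType) (H : set X) :
  is_subgroup H /\ quotient_isomorphic H (C2 R (Some 0)) <-> H = setT.
Proof.
have triv (x y : C2 R (Some 0)) : x = y.
  apply/val_inj; have := set_mem (valP x); have := set_mem (valP y).
  by rewrite /= /C2fin /= !GRing.expr1 => -> ->.
split=> [[Hsub /(quotient_isomorphic_character Hsub) [u [_ _ uH]]]|->].
  by apply/seteqP; split=> // x _; apply/uH.
split.
  split=> //; exists 1%g; split=> // [x _|x _]; first by rewrite mul1g mulg1.
  by exists x^-1%g; rewrite mulgV mulVg.
exists (fun _ => 1%g); split; last by move=> x y; exact: triv.
split=> // [_ _ /set_mem [x _ <-] /set_mem [y _ <-] _|w _].
  by rewrite /lcoset !ltranslateT.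
by exists (lcoset setT 1%g); [exists 1%g|exact: triv].
Qed.

Theorem theorem1p1 (R : realType) (X : groupType) :
  twinic X ->
  exists qC qQ : natinf -> Type,
    (forall L : set (superextension X), minimal_left_ideal L ->
      exists Z : semigroupType, left_zeros Z /\
        algebraically_isomorphic L
          [set: Z * (prod_powers (from_to_inf 1) (fun k => C2 R k : groupType) qC *
                     prod_powers (from_to_inf 3) (fun k => Q2 R k : groupType) qQ)])
    /\
    (forall G : set (superextension X),
      maximal_subgroup_of (minimal_ideal (superextension X)) G ->
      algebraically_isomorphic G
        [set: prod_powers (from_to_inf 1) (fun k => C2 R k : groupType) qC *
              prod_powers (from_to_inf 3) (fun k => Q2 R k : groupType) qQ])
    /\
    (zero_cardinal (qC None) -> zero_cardinal (qQ None) ->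
      forall G : set (superextension X),
        maximal_subgroup_of (minimal_ideal (superextension X)) G ->
        exists f : superextension X ->
            prod_powers (from_finite 1) (fun k => C2 R k : groupType) qC *
            prod_powers (from_finite 3) (fun k => Q2 R k : groupType) qQ,
          is_isomorphism G setT f /\ is_homeomorphism G setT f)
    /\
    ((forall x y : X, commute x y) ->
      ((forall k, zero_cardinal (qQ k)) /\
       (forall k, [set: qC k] #=
          [set H : set X | is_subgroup H /\ quotient_isomorphic H (C2 R k)]))
      /\
      (* division of a cardinal by 2^(k-1), stated as a multiplication *)
      (forall k : nat, (1 <= k)%N ->
        [set: qC (Some k) * 'I_(2 ^ k.-1)] #=
          homC2 R X k `\` homC2 R X k.-1)).
Proof.
move=> Xtw; have [J [JP Jab]] := representatives_exist X.
have Jmax K : J K -> max_cogroup K by case: JP => h _ _; exact: h.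
(* [cls] fixes the type of N(K)/KK for each [K] in [J]: [inl] for a C_(2^k), [inr] for a Q_(2^k). *)
have [cls clsP] : exists cls : set X -> natinf + natinf, forall K, J K ->
    match cls K with
    | inl k => leinf 1 k /\ exists t, @presents X (C2 R k) K t
    | inr k => leinf 3 k /\ exists t, @presents X (Q2 R k) K t
    end.
  have h K : exists c : natinf + natinf, J K ->
      match c with
      | inl k => leinf 1 k /\ exists t, @presents X (C2 R k) K t
      | inr k => leinf 3 k /\ exists t, @presents X (Q2 R k) K t
      end.
    have [JK|nJK] := pselect (J K); last by exists (inl None).
    by have [k [hk|hk]] := max_cogroup_presents R (Jmax _ JK);
      [exists (inl k)|exists (inr k)].
  by exists (fun K => sval (cid (h K))) => K; exact: (svalP (cid (h K))).
have choose (G : natinf -> groupType) : exists t : forall k, set X -> X -> G k,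
    forall k K, (exists s, @presents X (G k) K s) -> presents K (t k K).
  have h k K : exists s : X -> G k, (exists s', @presents X (G k) K s') ->
    presents K s.
    have [[s ps]|ns] := pselect (exists s, @presents X (G k) K s);
      first by exists s.
    by exists (fun _ => 1%g).
  by exists (fun k K => sval (cid (h k K))) => k K;
    exact: (svalP (cid (h k K))).
have [tC tCP] := choose (fun k => C2 R k : groupType).
have [tQ tQP] := choose (fun k => Q2 R k : groupType).
(* In statement (4) the trivial quotient must be counted by [qC (Some 0)],
   which does not occur in the products: [set0] stands for it. *)
pose qC k := [set K : set X | (J K /\ cls K = inl k) \/ (K = set0 /\
  k = Some 0)].
pose qQ k := [set K : set X | J K /\ cls K = inr k].
have clsC K k : J K -> cls K = inl k -> leinf 1 k /\ presents K (tC k K).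
  by move=> /clsP h cK; move: h; rewrite cK => -[? /tCP].
have clsQ K k : J K -> cls K = inr k -> leinf 3 k /\ presents K (tQ k K).
  by move=> /clsP h cK; move: h; rewrite cK => -[? /tQP].
have qCP k K : leinf 1 k -> qC k K <-> J K /\ cls K = inl k.
  by move=> k1; split=> [[//|[_ kE]]|]; [rewrite kE in k1|left].
have qQP k K : leinf 3 k -> qQ k K <-> J K /\ cls K = inr k by [].
exists (fun k => set_type (qC k)), (fun k => set_type (qQ k)).
have subgroup_corner (G : set (superextension X)) :
    maximal_subgroup_of (minimal_ideal (superextension X)) G ->
    exists b e, adapted J b e /\ forall (T : groupType) (phi :
      superextension X -> T),
      is_isomorphism (corner e) setT phi -> G = corner e.
  move=> [e [emin ee [Gsub Ge] Gmax]].
  have [b eb] := minimal_ideal_adapted Xtw JP emin ee.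
  exists b, e; split=> // T phi phiP.
  exact: (corner_maximal_subgroup ee phiP).
split; [|split; [|split]].
- move=> L /(minimal_left_ideal_adapted Xtw JP) [b [e [eb _ ->]]].
  have iso := coordinates_isomorphism Xtw JP eb
    (K1 := from_to_inf 1) (K2 := from_to_inf 3) clsC clsQ qCP qQP.
  exact: (left_ideal_isomorphic (adapted_idem eb) iso).
- move=> G /subgroup_corner [b [e [eb GE]]].
  have iso := coordinates_isomorphism Xtw JP eb
    (K1 := from_to_inf 1) (K2 := from_to_inf 3) clsC clsQ qCP qQP.
  by rewrite (GE _ _ iso); eexists; exact: iso.
- move=> C0 Q0 G /subgroup_corner [b [e [eb GE]]].
  (* Since [qC None] is empty, no cogroup of [J] has type C at infinity, and the same coordinates
     range over finite indices only. *)
  have clsC' K k : J K -> cls K = inl k ->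
    from_finite 1 k /\ presents K (tC k K).
    move=> JK cK; have [k1 pK] := clsC K k JK cK; split=> //; split=> // kN.
    have qK : qC None K by left; rewrite -kN.
    by have : [set: set_type (qC None)] (SigSub (mem_set qK)) by []; rewrite C0.
  have clsQ' K k : J K -> cls K = inr k ->
    from_finite 3 k /\ presents K (tQ k K).
    move=> JK cK; have [k3 pK] := clsQ K k JK cK; split=> //; split=> // kN.
    have qK : qQ None K by split; rewrite // -kN.
    by have : [set: set_type (qQ None)] (SigSub (mem_set qK)) by []; rewrite Q0.
  have qCP' k K : from_finite 1 k ->
    qC k K <-> J K /\ cls K = inl k by case=> /qCP.
  have qQP' k K : from_finite 3 k -> qQ k K <-> J K /\ cls K = inr k by [].
  have finC k : from_finite 1 k -> finitely_enumerated (C2 R k).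
    by case: k => [n|] [] // _ _; exact: finitely_enumerated_C2.
  have finQ k : from_finite 3 k -> finitely_enumerated (Q2 R k).
    by case: k => [n|] [] //= n3 _; exact: finitely_enumerated_Q2.
  have iso := coordinates_isomorphism Xtw JP eb clsC' clsQ' qCP' qQP'.
  have homeo := coordinates_homeomorphism Xtw JP eb clsC' clsQ' qCP' qQP' finC
    finQ.
  by rewrite (GE _ _ iso); eexists; split; [exact: iso|exact: homeo].
move=> Xab.
have qQ0 k K : ~ qQ k K.
  by move=> [JK cK]; have [_] := clsQ _ _ JK cK; exact: abelian_not_presents_Q2.
have cls_presents k K (u : X -> C2 R k) : max_cogroup K -> presents K u ->
  J K /\ cls K = inl k.
  move=> Km Ku; have JK := Jab Xab _ Km; split=> //.
  case cK : (cls K) => [l|l]; last by case: (qQ0 l K).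
  by have [_ Kt] := clsC _ _ JK cK; rewrite (abelian_presents_inj Xab Ku Kt).
split; [split|].
- move=> k; apply/seteqP; split=> // K _.
  exact: (qQ0 k (val K) (set_mem (valP K))).
- move=> k.
  have [k0|k1] : k = Some 0 \/ leinf 1 k by case: (k) => [[|n]|];
    [left|right|right].
    rewrite k0 {k k0}.
    have -> : [set H : set X | is_subgroup H /\
      quotient_isomorphic H (C2 R (Some 0))] = [set setT].
      by apply/funext => H; apply: propext; exact: trivial_quotient.
    have q0 K : qC (Some 0) K -> K = set0.
      by move=> [[JK cK]|[]] //; have [] := clsC _ _ JK cK.
    have qs : qC (Some 0) set0 by right.
    apply: (card_eq_range (f := fun _ => setT)).
      move=> K K' _; apply/val_inj.
      by rewrite (q0 _ (set_mem (valP K))) (q0 _ (set_mem (valP K'))).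
    apply/seteqP; split=> [_ [K _ <-] //|_ ->].
    by exists (SigSub (mem_set qs)).
  have qCm K : qC k K -> max_cogroup K /\ presents K (tC k K).
    by move=> /(qCP _ _ k1) [JK cK]; split;
      [exact: Jmax|have [] := clsC _ _ JK cK].
  (* The bijection is K |-> KK; conversely a subgroup H comes from the preimage of -1 under a
     character with kernel H. *)
  apply: (card_eq_range (f := fun K : set_type (qC k) => cosquare (val K))).
    move=> K K' KK'; apply/val_inj; apply: (max_cogroup_cosquare_inj Xab) => //.
      by have [] := qCm _ (set_mem (valP K)).
    by have [] := qCm _ (set_mem (valP K')).
  apply/seteqP; split=> [_ [K _ <-]|H [Hsub Hiso]].
    have [[Kc _] Kt] := qCm _ (set_mem (valP K)).
    by split; [exact: cosquare_subgroup|exact: (cosquare_quotient_isomorphic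
      Xab Kc Kt)].
  have [u [uM uS uH]] := quotient_isomorphic_character Hsub Hiso.
  have Km := character_max_cogroup k1 uM uS.
  have Ku := character_presents Xab k1 uM uS.
  have qK : qC k [set x | val (u x) = (-1)%R] by left;
    exact: cls_presents Km Ku.
  exists (SigSub (mem_set qK)) => //=; apply/funext => x; apply: propext.
  by rewrite -(abelian_presents_ker Xab Ku) uH.
- case=> // k _; apply: (card_characters Xab (t :=
  tC (Some k.+1))) => [K|K u Km Ku].
    move=> /(qCP (Some k.+1) K isT) [JK cK].
    by split; [exact: Jmax|have [] := clsC _ _ JK cK].
  by left; exact: cls_presents Km Ku.
Qed.
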